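(* Let $k$ be a field. For a measure $\nu$ for $\mathfrak{P}$ (the class of finite posets) valued in $k$, put $\nu_{p,q}=\nu(J_{p,q},\ast)$ for $p,q\ge 0$. Then $\nu$ is completely determined by the $3\times 3$ matrix $N=(\nu_{p,q})_{0\le p,q\le 2}$. Moreover, the matrices $N\in k^{3\times 3}$ that arise in this way from measures for $\mathfrak{P}$ valued in $k$ are exactly the matrices $\mathbb{A}(s,t)$, $\mathbb{B}_i(t)$ ($1\le i\le 5$), $\mathbb{C}_i$ ($1\le i\le 8$) listed in the context, for any $s,t\in k$, and their transposes.
   Context: All posets are finite; the empty poset is allowed. An embedding of posets is an injective map $\alpha\colon P\to Q$ with $x\le y\iff\alpha(x)\le\alpha(y)$. Given embeddings $\alpha\colon P\to Q$ and $\beta\colon P\to P'$, an amalgamation of $Q$ and $P'$ over $P$ is a triple $(Q',\alpha',\beta')$ where $Q'$ is a poset and $\alpha'\colon P'\to Q'$, $\beta'\colon Q\to Q'$ are embeddings with $\beta'\circ\alpha=\alpha'\circ\beta$ and $Q'=\mathrm{im}(\alpha')\cup\mathrm{im}(\beta')$; amalgamations are considered up to the evident notion of isomorphism. A measure for $\mathfrak{P}$ valued in a commutative ring $k$ is a rule $\nu$ assigning to each embedding $\alpha\colon P\to Q$ of finite posets a value $\nu(\alpha)\in k$ such that: (a) $\nu(\alpha)=1$ if $\alpha$ is an isomorphism; (b) $\nu(\beta\circ\alpha)=\nu(\beta)\nu(\alpha)$ when the composition is defined; (c) given embeddings $\alpha\colon P\to Q$ and $\beta\colon P\to P'$, with $(Q'_i,\alpha'_i,\beta'_i)$,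 $1\le i\le r$, the various amalgamations up to isomorphism, $\nu(\alpha)=\sum_{i=1}^r\nu(\alpha'_i)$. A marked poset is a pair $(P,x)$ with $x\in P$; put $P^x=P\setminus\{x\}$ (induced order) and $\nu(P,x)=\nu(P^x\to P)$. $J_{p,q}$ is the poset on $\{a_1,\dots,a_p,x,b_1,\dots,b_q\}$ with order generated by $a_i<x$ and $x<b_j$ for all $i,j$, marked at $\ast=x$. The matrices (rows and columns indexed by $0,1,2$) are: $$\mathbb{A}(s,t)=\begin{pmatrix}t&0&0\\0&s&s\\0&s&s\end{pmatrix},\ \mathbb{B}_1(t)=\begin{pmatrix}t&t&t\\t&t&t\\t&t&t\end{pmatrix},\ \mathbb{B}_2(t)=\begin{pmatrix}0&t&t\\0&t&t\\0&t&t\end{pmatrix},$$ $$\mathbb{B}_3(t)=\begin{pmatrix}t&0&0\\0&-1&0\\0&-1&0\end{pmatrix},\ \mathbb{B}_4(t)=\begin{pmatrix}t&-1&0\\-1&-1&0\\0&-1&0\end{pmatrix},\ \mathbb{B}_5(t)=\begin{pmatrix}t&-1&0\\-1&-1&0\\0&0&1\end{pmatrix},$$ $$\mathbb{C}_1=\begin{pmatrix}0&-1&0\\0&-1&0\\0&-1&0\end{pmatrix},\ \mathbb{C}_2=\begin{pmatrix}-1&-1&0\\-1&-1&0\\-1&-1&0\end{pmatrix},\ \mathbb{C}_3=\begin{pmatrix}0&0&0\\-1&-1&0\\-1&-1&0\end{pmatrix},\ \mathbb{C}_4=\begin{pmatrix}0&0&1\\-1&-1&0\\0&-1&0\end{pmatrix},$$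 $$\mathbb{C}_5=\begin{pmatrix}0&0&1\\-1&-1&0\\-1&-1&0\end{pmatrix},\ \mathbb{C}_6=\begin{pmatrix}1&0&1\\0&-1&0\\0&-1&0\end{pmatrix},\ \mathbb{C}_7=\begin{pmatrix}0&-1&0\\0&-1&0\\1&0&1\end{pmatrix},\ \mathbb{C}_8=\begin{pmatrix}1&0&1\\0&-1&0\\1&0&1\end{pmatrix}.$$ *)

(* Defs.v *)
(* MathComp *)
From HB Require Import structures.
From mathcomp Require Import all_boot all_order all_algebra.

Set Implicit Arguments.
Unset Strict Implicit.
Unset Printing Implicit Defensive.

Import Order.TTheory GRing.Theory.
Local Open Scope ring_scope.

(* Displays only affect printing: [Order.disp_t] has a single element up to
   provable equality, so working in one fixed display loses no finite poset. *)
Definition poset_display : Order.disp_t := Order.Disp tt tt.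
Notation poset := (finPOrderType poset_display).

Definition is_embedding (P Q : poset) (f : P -> Q) : bool :=
  injectiveb f && [forall x, forall y, (x <= y)%O == (f x <= f y)%O].

(* Finite functions and a boolean condition make equality of embeddings
   coincide with pointwise equality, without extensionality axioms. *)
Record embedding (P Q : poset) : predArgType := Embedding {
  emb_fun :> {ffun P -> Q};
  emb_funP : is_embedding emb_fun }.

HB.instance Definition _ (P Q : poset) := [isSub for @emb_fun P Q].
HB.instance Definition _ (P Q : poset) := [Finite of embedding P Q by <:].

Lemma is_embeddingP (P Q : poset) (f : P -> Q) :
  reflect (injective f /\ {mono f : x y / (x <= y)%O}) (is_embedding f).
Proof.
apply: (iffP andP) => [[/injectiveP fI /'forall_forallP fM]|[fI fM]].
  by split=> // x y; rewrite (eqP (fM x y)).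
by split; [exact/injectiveP | apply/'forall_forallP=> x y; rewrite fM].
Qed.

Lemma emb_comp_subproof (P Q R : poset)
    (g : embedding Q R) (f : embedding P Q) :
  is_embedding [ffun x => g (f x)].
Proof.
have [gI gM] := is_embeddingP _ (emb_funP g).
have [fI fM] := is_embeddingP _ (emb_funP f).
apply/is_embeddingP; split=> x y; rewrite !ffunE ?gM ?fM //.
by move=> /gI /fI.
Qed.

Definition emb_comp (P Q R : poset) (g : embedding Q R) (f : embedding P Q) :
  embedding P R := Embedding (emb_comp_subproof g f).

Record amalgamation (P Q P' : poset)
    (a : embedding P Q) (b : embedding P P') := Amalgamation {
  amalg_poset :> poset;
  amalg_a : embedding P' amalg_poset;
  amalg_b : embedding Q amalg_poset;
  amalg_comm : emb_comp amalg_b a = emb_comp amalg_a b;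
  amalg_cover : forall z : amalg_poset,
    (exists y : P', z = amalg_a y) \/ (exists y : Q, z = amalg_b y) }.

Definition amalg_iso (P Q P' : poset)
    (a : embedding P Q) (b : embedding P P') (A B : amalgamation a b) : Prop :=
  exists f : embedding A B,
    [/\ bijective f, emb_comp f (amalg_a A) = amalg_a B
      & emb_comp f (amalg_b A) = amalg_b B].

(* In [measure_amalg], [S] lists the amalgamations up to isomorphism: every
   amalgamation is isomorphic to exactly one [S i]. *)
Record measure (k : comPzRingType) := Measure {
  measure_val :> forall P Q : poset, embedding P Q -> k;
  measure_iso : forall (P Q : poset) (a : embedding P Q),
    bijective a -> measure_val a = 1;
  measure_comp :
    forall (P Q R : poset) (b : embedding Q R) (a : embedding P Q),
    measure_val (emb_comp b a) = measure_val b * measure_val a;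
  measure_amalg : forall (P Q P' : poset)
      (a : embedding P Q) (b : embedding P P')
      (r : nat) (S : 'I_r -> amalgamation a b),
    (forall A : amalgamation a b, exists! i : 'I_r, amalg_iso A (S i)) ->
    measure_val a = \sum_(i < r) measure_val (amalg_a (S i)) }.

Definition puncture (P : poset) (x : P) : predArgType := {y : P | y != x}.

HB.instance Definition _ (P : poset) (x : P) := Finite.on (puncture x).
HB.instance Definition _ (P : poset) (x : P) := SubChoice.on (puncture x).
HB.instance Definition _ (P : poset) (x : P) :=
  [SubChoice_isSubPOrder of puncture x by <: with poset_display].

Lemma puncture_emb_subproof (P : poset) (x : P) :
  @is_embedding (puncture x) P [ffun y => val y].
Proof.
by apply/is_embeddingP; split=> y z; rewrite !ffunE //; exact: val_inj.
Qed.

Definition puncture_emb (P : poset) (x : P) : embedding (puncture x) P :=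
  Embedding (puncture_emb_subproof x).

Definition marked_measure (k : comPzRingType) (nu : measure k)
  (P : poset) (x : P) : k := nu _ _ (puncture_emb x).

(* [None] is the marked point x, [Some (inl i)] is a_(i+1) and
   [Some (inr j)] is b_(j+1). *)
Definition J (p q : nat) : predArgType := option ('I_p + 'I_q).

HB.instance Definition _ (p q : nat) := Finite.on (J p q).

Definition J_gen (p q : nat) : rel (J p q) := fun u v =>
  match u, v with
  | Some (inl _), None => true
  | None, Some (inr _) => true
  | _, _ => false
  end.

Definition J_le (p q : nat) : rel (J p q) := connect (@J_gen p q).

Lemma J_leE (p q : nat) (u v : J p q) :
  J_le u v = (u == v) || match u, v with
                         | Some (inl _), Some (inr _) => true
                         | _, _ => J_gen u v
                         end.
Proof.
apply/idP/idP => [/connectP[s]|].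
  elim: s u => [|w s IHs] u /=; first by move=> _ ->; rewrite eqxx.
  case/andP=> uw ws vE; have {ws vE} := IHs w ws vE.
  case/orP=> [/eqP <-|].
    by case: u w uw => [[?|?]|] [[?|?]|] // _; rewrite orbT.
  by case: u w v uw {IHs} => [[?|?]|] [[?|?]|] [[?|?]|] //= _ _; rewrite orbT.
case/orP=> [/eqP->|]; first exact: connect0.
case: u v => [[i|j]|] [[i'|j']|] //= _; try exact: connect1.
exact: (@connect_trans _ _ None _ _ (connect1 _) (connect1 _)).
Qed.

Lemma J_le_refl (p q : nat) : reflexive (@J_le p q).
Proof. by move=> u; exact: connect0. Qed.

Lemma J_le_anti (p q : nat) : antisymmetric (@J_le p q).
Proof.
move=> u v /andP[]; rewrite !J_leE.
case/orP=> [/eqP //|uv]; case/orP=> [/eqP //|].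
by case: u v uv => [[?|?]|] [[?|?]|].
Qed.

Lemma J_le_trans (p q : nat) : transitive (@J_le p q).
Proof. by move=> v u w; exact: connect_trans. Qed.

HB.instance Definition _ (p q : nat) :=
  Order.Le_isPOrder.Build poset_display (J p q)
    (@J_le_refl p q) (@J_le_anti p q) (@J_le_trans p q).

Definition J_pt (p q : nat) : J p q := None.

Definition measure_mx (k : comPzRingType) (nu : measure k) : 'M[k]_3 :=
  \matrix_(p < 3, q < 3) marked_measure nu (J_pt p q).

Definition mx3 (k : pzRingType) (rows : seq (seq k)) : 'M[k]_3 :=
  \matrix_(i < 3, j < 3) nth 0 (nth [::] rows i) j.

Section Matrices.
Variable k : pzRingType.
Implicit Types s t : k.

Definition mxA s t : 'M[k]_3 := mx3 [:: [:: t; 0; 0];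
                                        [:: 0; s; s];
                                        [:: 0; s; s] ].

Definition mxB1 t : 'M[k]_3 := mx3 [:: [:: t; t; t];
                                       [:: t; t; t];
                                       [:: t; t; t] ].

Definition mxB2 t : 'M[k]_3 := mx3 [:: [:: 0; t; t];
                                       [:: 0; t; t];
                                       [:: 0; t; t] ].

Definition mxB3 t : 'M[k]_3 := mx3 [:: [:: t;  0; 0];
                                       [:: 0; -1; 0];
                                       [:: 0; -1; 0] ].

Definition mxB4 t : 'M[k]_3 := mx3 [:: [::  t; -1; 0];
                                       [:: -1; -1; 0];
                                       [::  0; -1; 0] ].

Definition mxB5 t : 'M[k]_3 := mx3 [:: [::  t; -1; 0];
                                       [:: -1; -1; 0];
                                       [::  0;  0; 1] ].

Definition mxC1 : 'M[k]_3 := mx3 [:: [:: 0; -1; 0];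
                                     [:: 0; -1; 0];
                                     [:: 0; -1; 0] ].

Definition mxC2 : 'M[k]_3 := mx3 [:: [:: -1; -1; 0];
                                     [:: -1; -1; 0];
                                     [:: -1; -1; 0] ].

Definition mxC3 : 'M[k]_3 := mx3 [:: [::  0;  0; 0];
                                     [:: -1; -1; 0];
                                     [:: -1; -1; 0] ].

Definition mxC4 : 'M[k]_3 := mx3 [:: [::  0;  0; 1];
                                     [:: -1; -1; 0];
                                     [::  0; -1; 0] ].

Definition mxC5 : 'M[k]_3 := mx3 [:: [::  0;  0; 1];
                                     [:: -1; -1; 0];
                                     [:: -1; -1; 0] ].

Definition mxC6 : 'M[k]_3 := mx3 [:: [:: 1;  0; 1];
                                     [:: 0; -1; 0];
                                     [:: 0; -1; 0] ].

Definition mxC7 : 'M[k]_3 := mx3 [:: [:: 0; -1; 0];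
                                     [:: 0; -1; 0];
                                     [:: 1;  0; 1] ].

Definition mxC8 : 'M[k]_3 := mx3 [:: [:: 1;  0; 1];
                                     [:: 0; -1; 0];
                                     [:: 1;  0; 1] ].

Variant listed_mx : 'M[k]_3 -> Prop :=
| ListedA s t : listed_mx (mxA s t)
| ListedB1 t : listed_mx (mxB1 t)
| ListedB2 t : listed_mx (mxB2 t)
| ListedB3 t : listed_mx (mxB3 t)
| ListedB4 t : listed_mx (mxB4 t)
| ListedB5 t : listed_mx (mxB5 t)
| ListedC1 : listed_mx mxC1
| ListedC2 : listed_mx mxC2
| ListedC3 : listed_mx mxC3
| ListedC4 : listed_mx mxC4
| ListedC5 : listed_mx mxC5
| ListedC6 : listed_mx mxC6
| ListedC7 : listed_mx mxC7
| ListedC8 : listed_mx mxC8.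

End Matrices.

(* Main.v *)
(* A measure is determined by its one-point values nu(P -> P + x), where the new
   point lies above exactly a down-set D and below exactly an up-set U of P.
   Summing them over all types of points lying above D and below U, and adding
   the points of P that do so, gives nu_{p,q}, with p the number of maximal
   elements of D and q the number of minimal elements of U; by Moebius inversion
   the numbers nu_{p,q} determine nu, and axiom (c) holds for any choice of them.
   The remaining axiom, multiplicativity, is a Fubini identity: a pair x < y can
   be added in either order.

   For suitable posets this identity forces nu_{p,q} = nu_{min(p,2),min(q,2)}.
   Once this is known, both sides of the identity have closed forms, so that it
   amounts to finitely many quadratic equations between the entries of the
   3 x 3 matrix, whose solutions over a field are the listed matrices. *)
Require Import Defs.
From HB Require Import structures.
From mathcomp Require Import all_boot all_order all_algebra ring.

Set Implicit Arguments.
Unset Strict Implicit.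
Unset Printing Implicit Defensive.

Import Order.TTheory GRing.Theory.
Local Open Scope ring_scope.

(** * Embeddings and one-point extensions *)

(** Both sides of the Fubini identity weigh the pairs x < y with x between D and U and y between D'
    and U', where D is contained in D' and U' in U. Old and new points are treated alike, so for
    fixed x the sum over y is again a count, now in P + x, and depends on x only through the number
    of maximal elements of D' + x. Once g is truncated, this number matters only as 1, as the number
    of maximal elements of D', or as at least 2, which is where the closed forms come from.

    Pairs of incomparable points impose no equation of their own: their commutation follows from
    axiom (c) and the comparable case. Conversely, the identity is available for nested D, D' and
    U', U only, but the weight of x < y vanishes unless the two cuts are nested, so two Moebius
    inversions recover every single exchange relation. Axiom (c) for an arbitrary embedding reduces
    to one added point because amalgamations with a composite are iterated amalgamations. *)

Section Embeddings.
Variables P Q R : poset.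

Lemma emb_inj (a : embedding P Q) : injective a.
Proof. by have [] := is_embeddingP _ (emb_funP a). Qed.

Lemma emb_le (a : embedding P Q) : {mono a : x y / (x <= y)%O}.
Proof. by have [] := is_embeddingP _ (emb_funP a). Qed.

Lemma emb_lt (a : embedding P Q) : {mono a : x y / (x < y)%O}.
Proof. by move=> x y; rewrite !lt_neqAle emb_le (inj_eq (@emb_inj a)). Qed.

Lemma embP (a b : embedding P Q) : a =1 b -> a = b.
Proof. by move=> ab; apply/val_inj/ffunP=> x; exact: ab. Qed.

Lemma emb_compE (b : embedding Q R) (a : embedding P Q) x :
  emb_comp b a x = b (a x).
Proof. by rewrite ffunE. Qed.

Lemma emb_eqP (a b : embedding P Q) : a = b -> a =1 b.
Proof. by move->. Qed.

Lemma mkemb_subproof (h : P -> Q) (hM : {mono h : x y / (x <= y)%O}) :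
  is_embedding [ffun x => h x].
Proof.
have ffM : {mono [ffun x => h x] : x y / (x <= y)%O}.
  by move=> x y; rewrite !ffunE hM.
apply/is_embeddingP; split=> // x y hxy.
by apply/le_anti; rewrite -!ffM hxy lexx.
Qed.

Definition mkemb (h : P -> Q) (hM : {mono h : x y / (x <= y)%O}) :
  embedding P Q := Embedding (mkemb_subproof hM).

Lemma mkembE (h : P -> Q) (hM : {mono h : x y / (x <= y)%O}) x :
  mkemb hM x = h x.
Proof. by rewrite ffunE. Qed.

End Embeddings.

#[global] Opaque emb_comp mkemb.

Lemma emb_compA (P Q R S : poset) (c : embedding R S) (b : embedding Q R)
    (a : embedding P Q) :
  emb_comp (emb_comp c b) a = emb_comp c (emb_comp b a).
Proof. by apply: embP => x; rewrite !emb_compE. Qed.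

Definition emb_id (P : poset) : embedding P P :=
  @mkemb P P id (fun x y => erefl).

Lemma emb_idE (P : poset) x : emb_id P x = x.
Proof. exact: mkembE. Qed.

#[global] Opaque emb_id.

Lemma emb_id_bij (P : poset) : bijective (emb_id P).
Proof. by exists id => x; rewrite emb_idE. Qed.

Lemma emb_comp_id (P Q : poset) (a : embedding P Q) : emb_comp a (emb_id P) = a.
Proof. by apply: embP => x; rewrite emb_compE emb_idE. Qed.

Lemma emb_id_comp (P Q : poset) (a : embedding P Q) : emb_comp (emb_id Q) a = a.
Proof. by apply: embP => x; rewrite emb_compE emb_idE. Qed.

Lemma emb_comp_bij (P Q R : poset) (b : embedding Q R) (a : embedding P Q) :
  bijective b -> bijective a -> bijective (emb_comp b a).
Proof.
by move=> bB aB; apply: (eq_bij (bij_comp bB aB)) => x; rewrite emb_compE.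
Qed.

Lemma emb_surj_bij (P Q : poset) (a : embedding P Q) :
  (forall y, exists x, y = a x) -> bijective a.
Proof.
move=> aS.
have aS' y : exists x, y == a x by have [x ->] := aS y; exists x.
exists (fun y => xchoose (aS' y)) => x.
  by apply: (@emb_inj _ _ a); rewrite -(eqP (xchooseP (aS' (a x)))).
by rewrite -(eqP (xchooseP (aS' x))).
Qed.

Lemma emb_inv_ex (P Q : poset) (a : embedding P Q) : bijective a ->
  exists b : embedding Q P, cancel a b /\ cancel b a.
Proof.
case=> b aK bK.
have bM : {mono b : x y / (x <= y)%O} by move=> x y; rewrite -(emb_le a) !bK.
by exists (mkemb bM); split=> x; rewrite mkembE.
Qed.

Section Extension.
Variable P : poset.

(** Transitivity through the new point forces all three conditions: the points below it lie strictly
    below those above it, and the two sets are closed downwards and upwards. *)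
Definition is_cut (c : {set P} * {set P}) : bool :=
  [&& [forall d in c.1, forall u in c.2, (d < u)%O],
      [forall x, forall y in c.1, (x <= y)%O ==> (x \in c.1)] &
      [forall x, forall y in c.2, (y <= x)%O ==> (x \in c.2)]].

Lemma is_cutP (D U : {set P}) :
  reflect [/\ {in D & U, forall d u, (d < u)%O},
              forall x y, y \in D -> (x <= y)%O -> x \in D &
              forall x y, y \in U -> (y <= x)%O -> x \in U] (is_cut (D, U)).
Proof.
apply: (iffP and3P) => /= [] [h1 h2 h3]; split.
- by move=> d u dD uU; move/forall_inP/(_ d dD)/forall_inP: h1; apply.
- by move=> x y yD xy; move/forallP/(_ x)/forall_inP/(_ y yD)/implyP: h2; apply.
- by move=> x y yU xy; move/forallP/(_ x)/forall_inP/(_ y yU)/implyP: h3; apply.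
- by apply/forall_inP=> d dD; apply/forall_inP=> u uU; apply: h1.
- by apply/forallP=> x; apply/forall_inP=> y yD; apply/implyP; exact: h2.
- by apply/forallP=> x; apply/forall_inP=> y yD; apply/implyP; exact: h3.
Qed.

Definition cut := {c | is_cut c}.

End Extension.

(** The cut is a phantom argument: the carrier is always [option P], with [None] the new point, and
    [c] only selects the order instance. *)
Definition ext (P : poset) (c : cut P) : predArgType := option P.

Section ExtensionOrder.
Variables (P : poset) (c : cut P).

HB.instance Definition _ := Finite.on (ext c).

Definition ext_le : rel (ext c) := fun x y =>
  match x, y with
  | Some a, Some b => (a <= b)%O
  | Some a, None => a \in (val c).1
  | None, Some b => b \in (val c).2
  | None, None => true
  end.

Lemma cut_lt d u : d \in (val c).1 -> u \in (val c).2 -> (d < u)%O.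
Proof. by case: c => [[D U] /= /is_cutP[h _ _]]; exact: h. Qed.

Lemma cut_down x y : y \in (val c).1 -> (x <= y)%O -> x \in (val c).1.
Proof. by case: c => [[D U] /= /is_cutP[_ h _]]; exact: h. Qed.

Lemma cut_up x y : y \in (val c).2 -> (y <= x)%O -> x \in (val c).2.
Proof. by case: c => [[D U] /= /is_cutP[_ _ h]]; exact: h. Qed.

Lemma ext_le_refl : reflexive ext_le.
Proof. by case=> [x|] /=. Qed.

Lemma ext_le_anti : antisymmetric ext_le.
Proof.
case=> [x|] [y|] //= => [/le_anti -> //|/andP[xD xU]|/andP[xU xD]];
  by have := cut_lt xD xU; rewrite ltxx.
Qed.

Lemma ext_le_trans : transitive ext_le.
Proof.
case=> [y|] [x|] [z|] //=.
- exact: le_trans.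
- by move=> xy yD; exact: cut_down yD xy.
- exact: cut_up.
- by move=> xD zU; exact: ltW (cut_lt xD zU).
Qed.

HB.instance Definition _ :=
  Order.Le_isPOrder.Build poset_display (ext c)
    ext_le_refl ext_le_anti ext_le_trans.

Definition ext_emb : embedding P (ext c) :=
  @mkemb P (ext c) Some (fun x y => erefl).

Lemma ext_embE x : ext_emb x = Some x.
Proof. exact: mkembE. Qed.

Lemma ext_leE (x y : ext c) : (x <= y)%O = ext_le x y.
Proof. by []. Qed.

Lemma ext_ltSN x : ((Some x : ext c) < (None : ext c))%O = (x \in (val c).1).
Proof. by rewrite lt_neqAle ext_leE. Qed.

Lemma ext_ltNS x : ((None : ext c) < (Some x : ext c))%O = (x \in (val c).2).
Proof. by rewrite lt_neqAle ext_leE. Qed.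

Lemma ext_ltSS x y : ((Some x : ext c) < (Some y : ext c))%O = (x < y)%O.
Proof. by rewrite !lt_neqAle ext_leE. Qed.

End ExtensionOrder.

#[global] Opaque ext_emb.

Section Types.
Variables (P Q : poset) (a : embedding P Q).

Definition lo (z : Q) : {set P} := [set p | (a p < z)%O].
Definition up (z : Q) : {set P} := [set p | (z < a p)%O].

Lemma lo_up_cut z : is_cut (lo z, up z).
Proof.
apply/is_cutP; split=> [d u|x y|x y]; rewrite !inE.
- by move=> dz zu; rewrite -(emb_lt a) (lt_trans dz zu).
- by move=> yz xy; apply: le_lt_trans yz; rewrite emb_le.
- by move=> zy yx; apply: lt_le_trans zy _; rewrite emb_le.
Qed.

Definition tp (z : Q) : cut P := Sub (lo z, up z) (lo_up_cut z).

(** A point outside the image of [a] has the same relations to it as the new point of the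
    corresponding extension. The result is informative because [one_amalg] uses the embedding as
    data. *)
Lemma ext_emb_ex (c : cut P) (z : Q) :
  z \notin codom a -> val c = (lo z, up z) ->
  {h : embedding (ext c) Q | h None = z /\ forall p, h (Some p) = a p}.
Proof.
move=> zP cE; pose h (x : ext c) := if x is Some p then a p else z.
have aNz p : a p != z by apply: contra zP => /eqP <-; exact: codom_f.
have hM : {mono h : x y / (x <= y)%O}.
  case=> [x|] [y|] /=; rewrite ext_leE /= ?cE /= ?inE ?lexx // ?emb_le //.
    by rewrite lt_neqAle aNz.
  by rewrite lt_neqAle eq_sym aNz.
by exists (mkemb hM); split=> [|p]; rewrite mkembE.
Qed.

End Types.

(** * One-point amalgamations *)

Section Amalgamations.
Variables (P Q P' : poset) (a : embedding P Q) (b : embedding P P').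

Lemma amalg_iso_refl (A : amalgamation a b) : amalg_iso A A.
Proof.
exists (emb_id A); split; first exact: emb_id_bij.
  exact: emb_id_comp.
exact: emb_id_comp.
Qed.

Lemma amalg_iso_sym (A B : amalgamation a b) : amalg_iso A B -> amalg_iso B A.
Proof.
case=> f [/emb_inv_ex[g [fK gK]] fa fb]; exists g; split; first by exists f.
  by rewrite -fa; apply: embP => x; rewrite !emb_compE fK.
by rewrite -fb; apply: embP => x; rewrite !emb_compE fK.
Qed.

Lemma amalg_iso_trans (A B C : amalgamation a b) :
  amalg_iso A B -> amalg_iso B C -> amalg_iso A C.
Proof.
case=> f [fB fa fb] [g [gB ga gb]]; exists (emb_comp g f); split.
- exact: emb_comp_bij.
- by rewrite emb_compA fa.
- by rewrite emb_compA fb.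
Qed.

Definition complete_amalg (I : Type) (S : I -> amalgamation a b) :=
  forall A : amalgamation a b, exists! i : I, amalg_iso A (S i).

Lemma complete_amalgP (I : Type) (S : I -> amalgamation a b) :
  (forall A, exists i, amalg_iso A (S i)) ->
  (forall i j, amalg_iso (S i) (S j) -> i = j) -> complete_amalg S.
Proof.
move=> exS injS A; have [i Ai] := exS A; exists i; split=> // j Aj.
exact: injS (amalg_iso_trans (amalg_iso_sym Ai) Aj).
Qed.

Lemma complete_amalg_inj (I : Type) (S : I -> amalgamation a b) i j :
  complete_amalg S -> amalg_iso (S i) (S j) -> i = j.
Proof.
move=> cS ij; have [l [_ lu]] := cS (S i).
by rewrite -(lu i (amalg_iso_refl _)) -(lu j ij).
Qed.

Lemma measure_amalg_fin (k : comPzRingType) (nu : measure k) (I : finType)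
    (S : I -> amalgamation a b) :
  complete_amalg S -> nu _ _ a = \sum_(i : I) nu _ _ (amalg_a (S i)).
Proof.
move=> cS; rewrite (@measure_amalg _ nu _ _ _ a b #|I| (S \o enum_val)) /=.
  by rewrite [RHS](reindex (@enum_val I I)) //; exact: onW_bij (@enum_val_bij I).
move=> A; have [i [Ai iu]] := cS A; exists (enum_rank i); split=> /=.
  by rewrite enum_rankK.
by move=> j /iu ->; rewrite enum_valK.
Qed.

End Amalgamations.

Section OnePointAmalgamations.
Variables (P P' : poset) (c : cut P) (b : embedding P P').

Section Build.
Variables (R : poset) (a' : embedding P' R) (z : R).
Hypothesis zP : z \notin codom (emb_comp a' b).
Hypothesis cE : val c = (lo (emb_comp a' b) z, up (emb_comp a' b) z).
Hypothesis zcover : forall r, r = z \/ exists y, r = a' y.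

Let h := ext_emb_ex zP cE.

Lemma one_amalg_comm : emb_comp (sval h) (ext_emb c) = emb_comp a' b.
Proof.
by apply: embP => p; rewrite !emb_compE ext_embE (svalP h).2 emb_compE.
Qed.

Lemma one_amalg_cover (r : R) :
  (exists y : P', r = a' y) \/ (exists y : ext c, r = sval h y).
Proof.
case: (zcover r) => [->|]; last by left.
by right; exists None; rewrite (svalP h).1.
Qed.

Definition one_amalg : amalgamation (ext_emb c) b :=
  Amalgamation one_amalg_comm one_amalg_cover.

Lemma one_amalgN : amalg_b one_amalg None = z.
Proof. exact: (svalP h).1. Qed.

End Build.

Lemma amalg_bSome (A : amalgamation (ext_emb c) b) p :
  amalg_b A (Some p) = amalg_a A (b p).
Proof.
by have /(_ p) := emb_eqP (amalg_comm A); rewrite !emb_compE ext_embE.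
Qed.

Lemma amalg_isoN (A B : amalgamation (ext_emb c) b) (f : embedding A B) :
  bijective f -> emb_comp f (amalg_a A) = amalg_a B ->
  f (amalg_b A None) = amalg_b B None -> amalg_iso A B.
Proof.
move=> fB fa fN; exists f; split=> //; apply: embP => -[p|]; rewrite emb_compE //.
by rewrite !amalg_bSome -fa emb_compE.
Qed.

(** In an amalgamation of [ext c] with [P'], the added point either coincides with a point of [P']
    outside the image of [P] ([old_pt]), or stays new and has a cut over [P'] that pulls back to [c]
    ([new_pt]). *)
Definition old_pt := {y : P' | (y \notin codom b) && ((lo b y, up b y) == val c)}.
Definition new_pt :=
  {c' : cut P' | (b @^-1: (val c').1, b @^-1: (val c').2) == val c}.

Lemma old_pt_out (y : old_pt) : val y \notin codom (emb_comp (emb_id P') b).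
Proof.
case: y => y /= /andP[yP _]; apply: contra yP => /codomP[p ->].
by rewrite emb_compE emb_idE codom_f.
Qed.

Lemma old_pt_type (y : old_pt) :
  val c = (lo (emb_comp (emb_id P') b) (val y),
           up (emb_comp (emb_id P') b) (val y)).
Proof. by case: y => y /= /andP[_ /eqP <-]; rewrite emb_id_comp. Qed.

Lemma old_pt_cover (y : old_pt) (r : P') :
  r = val y \/ exists z, r = emb_id P' z.
Proof. by right; exists r; rewrite emb_idE. Qed.

Lemma new_pt_out (c' : new_pt) :
  (None : ext (val c')) \notin codom (emb_comp (ext_emb (val c')) b).
Proof. by apply/negP => /codomP[p]; rewrite emb_compE ext_embE. Qed.

Lemma new_pt_type (c' : new_pt) :
  val c = (lo (emb_comp (ext_emb (val c')) b) None,
           up (emb_comp (ext_emb (val c')) b) None).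
Proof.
case: c' => c' /= /eqP <-; congr pair; apply/setP=> p;
by rewrite !inE emb_compE ext_embE ?ext_ltSN ?ext_ltNS.
Qed.

Lemma new_pt_cover (c' : new_pt) (r : ext (val c')) :
  r = None \/ exists z, r = ext_emb (val c') z.
Proof. by case: r => [z|]; [right; exists z; rewrite ext_embE | left]. Qed.

Definition one_point_family (i : old_pt + new_pt) :
    amalgamation (ext_emb c) b :=
  match i with
  | inl y => one_amalg (old_pt_out y) (old_pt_type y) (@old_pt_cover y)
  | inr c' => one_amalg (new_pt_out c') (new_pt_type c') (@new_pt_cover c')
  end.

Lemma old_ptN y : amalg_b (one_point_family (inl y)) None = val y.
Proof. exact: one_amalgN. Qed.

Lemma new_ptN c' : amalg_b (one_point_family (inr c')) None = None.
Proof. exact: one_amalgN. Qed.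

Lemma old_ptE y z : amalg_a (one_point_family (inl y)) z = z.
Proof. exact: emb_idE. Qed.

Lemma new_ptE c' z : amalg_a (one_point_family (inr c')) z = Some z.
Proof. exact: ext_embE. Qed.

(** An isomorphism fixes [P'] pointwise and sends added point to added point. Hence it preserves the
    point of [P'] with which the latter coincides, or else its cut over [P']. *)
Lemma one_point_inj i j :
  amalg_iso (one_point_family i) (one_point_family j) -> i = j.
Proof.
case=> f [fB fa fb].
have fN : f (amalg_b (one_point_family i) None)
        = amalg_b (one_point_family j) None by rewrite -fb emb_compE.
have fS y : f (amalg_a (one_point_family i) y)
          = amalg_a (one_point_family j) y by rewrite -fa emb_compE.
case: i j f fB fa fb fN fS => [y|d] [y'|d'] f fB _ _.
- rewrite !old_ptN => fN fS; congr inl; apply: val_inj; rewrite -fN.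
  by have := fS (val y); rewrite !old_ptE.
- rewrite old_ptN new_ptN => fN fS.
  by have := fS (val y); rewrite old_ptE new_ptE fN.
- rewrite old_ptN new_ptN => fN fS.
  by have := fS (val y'); rewrite old_ptE new_ptE -fN => /(@emb_inj _ _ f).
rewrite !new_ptN => fN fS; congr inr; apply: val_inj; apply: val_inj.
rewrite [LHS]surjective_pairing [RHS]surjective_pairing.
have {}fS p : f (Some p) = Some p by have := fS p; rewrite !new_ptE.
congr pair; apply/setP=> p.
  rewrite -[LHS]ext_ltSN -[RHS]ext_ltSN; have := emb_lt f (Some p) None.
  by rewrite fS fN.
rewrite -[LHS]ext_ltNS -[RHS]ext_ltNS; have := emb_lt f None (Some p).
by rewrite fS fN.
Qed.

Lemma one_point_ex (A : amalgamation (ext_emb c) b) :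
  exists i, amalg_iso A (one_point_family i).
Proof.
set z := amalg_b A None; set a := amalg_a A.
have cov r : r = z \/ exists y, r = a y.
  case: (amalg_cover r) => [|[[p|] ->]]; [by right| |by left].
  by right; exists (b p); rewrite amalg_bSome.
have loz p : (amalg_b A (Some p) < z)%O = (p \in (val c).1).
  by rewrite emb_lt ext_ltSN.
have upz p : (z < amalg_b A (Some p))%O = (p \in (val c).2).
  by rewrite emb_lt ext_ltNS.
have [/codomP[y zE]|zNa] := boolP (z \in codom a).
  have yP : (y \notin codom b) && ((lo b y, up b y) == val c).
    apply/andP; split.
      apply/negP => /codomP[p yE].
      have : z = amalg_b A (Some p) by rewrite zE yE amalg_bSome.
      by move/(@emb_inj _ _ (amalg_b A)).
    rewrite [val c]surjective_pairing; apply/eqP; congr pair; apply/setP=> p;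
    by rewrite inE -1?loz -1?upz amalg_bSome zE -/a emb_lt.
  exists (inl (Sub y yP)); apply: amalg_iso_sym.
  apply: (@amalg_isoN _ _ (a : embedding (one_point_family (inl (Sub y yP))) A)).
  - apply: emb_surj_bij => r; case: (cov r) => [->|//].
    by exists y.
  - exact: emb_comp_id.
  - by rewrite old_ptN /= -zE.
have dP : (b @^-1: (val (tp a z)).1, b @^-1: (val (tp a z)).2) == val c.
  rewrite [val c]surjective_pairing; apply/eqP; congr pair; apply/setP=> p;
  by rewrite !inE -1?loz -1?upz amalg_bSome.
have [h [hN hS]] := @ext_emb_ex _ _ a (tp a z) z zNa erefl.
exists (inr (exist _ (tp a z) dP)); apply: amalg_iso_sym.
apply: (@amalg_isoN _ _
  (h : embedding (one_point_family (inr (exist _ (tp a z) dP))) A)).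
- apply: emb_surj_bij => r; case: (cov r) => [->|[y ->]].
    by exists None.
  by exists (Some y).
- by apply: embP => y; rewrite emb_compE new_ptE hS.
- by rewrite new_ptN.
Qed.

Lemma one_point_complete : complete_amalg one_point_family.
Proof. exact: complete_amalgP one_point_ex one_point_inj. Qed.

End OnePointAmalgamations.

(** * One-point values *)

Notation pr P := ({set P} * {set P})%type.

(** * Posets from strict orders, and extremal elements *)

Section StrictOrders.

Record sorel (T : finType) := Sorel {
  sorel_rel :> rel T;
  sorel_irr : irreflexive sorel_rel;
  sorel_trans : transitive sorel_rel }.

Variables (T : finType) (r : sorel T).

Definition pos_of of sorel T : predArgType := T.

HB.instance Definition _ := Finite.on (pos_of r).

Definition pos_le : rel (pos_of r) := fun x y => (x == y) || r x y.

Lemma pos_le_refl : reflexive pos_le.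
Proof. by move=> x; rewrite /pos_le eqxx. Qed.

Lemma pos_le_anti : antisymmetric pos_le.
Proof.
move=> x y /andP[/orP[/eqP //|xy] /orP[/eqP //|yx]].
by have := sorel_trans xy yx; rewrite sorel_irr.
Qed.

Lemma pos_le_trans : transitive pos_le.
Proof.
move=> y x z /orP[/eqP -> //|xy] /orP[/eqP <-|yz]; apply/orP; right=> //.
exact: sorel_trans xy yz.
Qed.

HB.instance Definition _ :=
  Order.Le_isPOrder.Build poset_display (pos_of r)
    pos_le_refl pos_le_anti pos_le_trans.

Lemma pos_ltE (x y : pos_of r) : (x < y)%O = r x y.
Proof.
have leE : (x <= y)%O = (x == y) || r x y by [].
rewrite lt_neqAle leE; case: eqVneq => [->|] //=.
by rewrite sorel_irr.
Qed.

End StrictOrders.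

Section Extremal.
Variable P : poset.
Implicit Types D U : {set P}.

Definition maxs D := [set d in D | [forall e in D, ~~ (d < e)%O]].
Definition mins U := [set u in U | [forall e in U, ~~ (e < u)%O]].

Definition below D U := {in D & U, forall d u, (d < u)%O}.

Lemma maxs_sub D d : d \in maxs D -> d \in D.
Proof. by rewrite inE => /andP[]. Qed.

Lemma mins_sub U u : u \in mins U -> u \in U.
Proof. by rewrite inE => /andP[]. Qed.

Lemma maxs_above D d : d \in D -> exists2 m, m \in maxs D & (d <= m)%O.
Proof.
move=> dD; pose C m := (m \in D) && (d <= m)%O.
have Cd : C d by rewrite /C dD lexx.
(* The size of the principal down-set grows strictly along [<], so an element of [D] above [d] that
   maximises it is maximal in [D]. *)
case: (arg_maxnP (fun m => #|[set e | (e <= m)%O]|) Cd) => m /andP[mD dm] mM.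
exists m => //; rewrite inE mD; apply/forall_inP=> e eD; apply/negP => me.
have := mM e; rewrite /C eD (le_trans dm (ltW me)) => /(_ isT); apply/negP.
rewrite -ltnNge; apply/proper_card/properP; split.
  by apply/subsetP=> y; rewrite !inE => /le_trans; apply; exact: ltW.
by exists e; rewrite !inE ?lexx // lt_geF.
Qed.

Lemma mins_below U u : u \in U -> exists2 m, m \in mins U & (m <= u)%O.
Proof.
move=> uU; pose C m := (m \in U) && (m <= u)%O.
have Cu : C u by rewrite /C uU lexx.
case: (arg_maxnP (fun m => #|[set e | (m <= e)%O]|) Cu) => m /andP[mU mu] mM.
exists m => //; rewrite inE mU; apply/forall_inP=> e eU; apply/negP => em.
have := mM e; rewrite /C eU (le_trans (ltW em) mu) => /(_ isT); apply/negP.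
rewrite -ltnNge; apply/proper_card/properP; split.
  by apply/subsetP=> y; rewrite !inE; apply: le_trans; exact: ltW.
by exists e; rewrite !inE ?lexx // lt_geF.
Qed.

Lemma maxs_anti D x y : x \in maxs D -> y \in maxs D -> (x < y)%O = false.
Proof.
by rewrite inE => /andP[xD /forall_inP h] /maxs_sub /h /negbTE.
Qed.

Lemma mins_anti U x y : x \in mins U -> y \in mins U -> (x < y)%O = false.
Proof.
by move=> /mins_sub xU; rewrite inE => /andP[_ /forall_inP/(_ x xU)/negbTE].
Qed.

End Extremal.

Section Weights.
Variables (k : comPzRingType) (f : forall P : poset, pr P -> k).
Variable P : poset.

(* The points of P and the types (D, U) of possible new points; a type has the
   measure of the corresponding one-point extension as its weight. *)
Definition pts := (P + pr P)%type.
Definition wt (x : pts) : k := if x is inr c then f c else 1.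
Definition lox (x : pts) : {set P} :=
  match x with inl y => [set z | (z < y)%O] | inr c => c.1 end.
Definition upx (x : pts) : {set P} :=
  match x with inl y => [set z | (y < z)%O] | inr c => c.2 end.
Definition btw (D U : {set P}) (x : pts) := (D \subset lox x) && (U \subset upx x).

End Weights.

Section Properties.
Variables (k : comPzRingType) (f : forall P : poset, pr P -> k).

Definition cut_supported := forall (P : poset) (c : pr P), ~~ is_cut c -> f c = 0.

(** This is axiom (c) for the one-point extension by [c]: the first term counts the amalgamations
    [old_pt], each of value 1, and the sum runs over the amalgamations [new_pt]. *)
Definition restrictive := forall (P P' : poset) (b : embedding P P') (c : pr P),
  f c = #|[set y | (y \notin codom b) && ((lo b y, up b y) == c)]|%:R
      + \sum_(c' : pr P' | (b @^-1: c'.1, b @^-1: c'.2) == c) f c'.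

Definition counted_by (g : nat -> nat -> k) :=
  forall (P : poset) (D U : {set P}), below D U ->
  \sum_(x : pts P | btw D U x) wt f x = g #|maxs D| #|mins U|.

(** The cut over P + x, with x of cut [c], of a point that lies above x and has cut [c1] over P;
    [below_pt] is the same for a point below x. *)
Definition above_pt (P : poset) (c : cut P) (c1 : pr P) : pr (ext c) :=
  (None |: Some @: c1.1, Some @: c1.2).
Definition below_pt (P : poset) (c : cut P) (c1 : pr P) : pr (ext c) :=
  (Some @: c1.1, None |: Some @: c1.2).

(** Multiplicativity for x < y with cuts [c] and [c1]: the left side adds x first, the right side y.
    The inclusions say that the cuts are compatible with x < y. *)
Definition exchange := forall (P : poset) (c c1 : cut P),
  (val c).1 \subset (val c1).1 -> (val c1).2 \subset (val c).2 ->
  f (val c) * f (above_pt c (val c1)) = f (val c1) * f (below_pt c1 (val c)).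

End Properties.

Section OnePointSums.
Variables (k : comPzRingType) (f : forall P : poset, pr P -> k).
Variables (P P' : poset) (c : cut P) (b : embedding P P').

Lemma sum_old_pt :
  \sum_(y : old_pt c b) 1
  = #|[set y | (y \notin codom b) && ((lo b y, up b y) == val c)]|%:R :> k.
Proof.
rewrite sumr_const card_sig; congr (_ *+ _).
by rewrite -cardsE; apply: eq_card => y; rewrite !inE.
Qed.

Lemma sum_new_pt : cut_supported f ->
  \sum_(d : new_pt c b) f (val (val d))
  = \sum_(c' : pr P' | (b @^-1: c'.1, b @^-1: c'.2) == val c) f c'.
Proof.
move=> fS; rewrite [RHS](bigID (@is_cut P')) /= [X in _ + X]big1 ?addr0; last first.
  by move=> c' /andP[_ /fS].
rewrite [RHS](reindex_omap (fun d : new_pt c b => val (val d))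
  (fun c' => if insub c' is Some d then insub (d : cut P') else None)) /=.
  apply: eq_bigl => d; rewrite (valP (val d)) (valP d) /= valK.
  by rewrite valK eqxx.
by move=> c' /andP[c'E c'P]; rewrite insubT /= insubT.
Qed.

End OnePointSums.

Section MeasureFunction.
Variables (k : comPzRingType) (nu : measure k).

(* Set to 0 on pairs that are not cuts, so that sums can range over all pairs. *)
Definition fm (P : poset) (c : pr P) : k :=
  oapp (fun c' : cut P => nu _ _ (ext_emb c')) 0 (insub c).

Lemma fm_cut (P : poset) (c : cut P) : fm (val c) = nu _ _ (ext_emb c).
Proof. by rewrite /fm valK. Qed.

Lemma fm_supp : cut_supported fm.
Proof. by move=> P c cN; rewrite /fm insubN. Qed.

Lemma measure_isol (P Q R : poset) (a : embedding P Q) (h : embedding Q R) :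
  bijective h -> nu _ _ (emb_comp h a) = nu _ _ a.
Proof. by move=> hB; rewrite measure_comp measure_iso // mul1r. Qed.

Lemma measure_isor (P Q R : poset) (a : embedding Q R) (h : embedding P Q) :
  bijective h -> nu _ _ (emb_comp a h) = nu _ _ a.
Proof. by move=> hB; rewrite measure_comp (measure_iso _ hB) mulr1. Qed.

Lemma measure_one_pt (P Q : poset) (a : embedding P Q) (z : Q) :
  z \notin codom a -> (forall q, q = z \/ exists p, q = a p) ->
  nu _ _ a = fm (lo a z, up a z).
Proof.
move=> za cov; have [h [hN hS]] := @ext_emb_ex _ _ a (tp a z) z za erefl.
have -> : a = emb_comp h (ext_emb (tp a z)).
  by apply: embP => p; rewrite emb_compE ext_embE hS.
rewrite measure_isol; last first.
  apply: emb_surj_bij => q; case: (cov q) => [->|[p ->]]; first by exists None.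
  by exists (Some p).
rewrite -fm_cut; congr fm; congr pair; apply/setP=> p;
by rewrite !inE emb_compE ext_embE hS.
Qed.

(** On cuts this is axiom (c) for the family [one_point_family]. On other pairs both sides vanish,
    because cuts pull back to cuts along [b] and points of [P'] induce cuts of [P]. *)
Lemma fm_restrictive : restrictive fm.
Proof.
move=> P P' b c; have [cP|cN] := boolP (is_cut c); last first.
  rewrite fm_supp // big1 ?addr0; last first.
    move=> c' /eqP cE; apply: fm_supp; apply: contra cN => c'P; rewrite -cE.
    case: c' c'P {cE} => D U /= /is_cutP[h1 h2 h3]; apply/is_cutP; split.
    - by move=> d u; rewrite !inE => dD uU; rewrite -(emb_lt b) h1.
    - by move=> x y; rewrite !inE => yD xy; apply: h2 yD _; rewrite emb_le.
    - by move=> x y; rewrite !inE => yU xy; apply: h3 yU _; rewrite emb_le.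
  rewrite (_ : [set _ | _] = set0) ?cards0 //; apply/setP=> y; rewrite !inE.
  by apply/negbTE; apply: contra cN => /andP[_ /eqP <-]; exact: lo_up_cut.
pose c0 : cut P := Sub c cP.
rewrite -[c]/(val c0) fm_cut (measure_amalg_fin _ (@one_point_complete _ _ c0 b)).
rewrite big_sumType /=; congr (_ + _).
  transitivity (\sum_(y : old_pt c0 b) 1 : k); last exact: (sum_old_pt k c0 b).
  by apply: eq_bigr => y _; exact/measure_iso/emb_id_bij.
transitivity (\sum_(d : new_pt c0 b) fm (val (val d))).
  by apply: eq_bigr => d _; rewrite fm_cut.
exact: (sum_new_pt c0 b fm_supp).
Qed.

Lemma above_pt_cut (P : poset) (c c1 : cut P) :
  (val c).1 \subset (val c1).1 -> (val c1).2 \subset (val c).2 ->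
  is_cut (above_pt c (val c1)).
Proof.
move=> /subsetP s1 /subsetP s2; apply/is_cutP; split.
- move=> d u /setU1P[->|/imsetP[d' d'D ->]] /imsetP[u' u'U ->].
    by rewrite ext_ltNS s2.
  by rewrite ext_ltSS (cut_lt d'D u'U).
- move=> x y /setU1P[->|/imsetP[d' d'D ->]].
    case: x => [x|] xN; last exact: setU11.
    by apply/setU1P; right; apply: imset_f; apply: s1.
  case: x => [x|] xd; last exact: setU11.
  by apply/setU1P; right; apply: imset_f; exact: cut_down d'D xd.
- move=> x y /imsetP[u' u'U ->]; case: x => [x|] ux.
    by apply: imset_f; exact: cut_up u'U ux.
  by have := cut_lt ux (s2 _ u'U); rewrite ltxx.
Qed.

(** Both sides are the value of the embedding of P into P + x + y with x < y, factored through P + x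
    and through P + y. *)
Lemma fm_exchange : exchange fm.
Proof.
move=> P c c1 s1 s2; pose d : cut (ext c) := Sub _ (above_pt_cut s1 s2).
pose R : poset := ext d; pose a : embedding P R := emb_comp (ext_emb d) (ext_emb c).
have aE p : a p = Some (Some p) by rewrite emb_compE !ext_embE.
have NP : (None : R) \notin codom a by apply/negP => /codomP[p]; rewrite aE.
have Sin (T : finType) (A : {set T}) x : (Some x \in Some @: A) = (x \in A).
  by apply: mem_imset; exact: Some_inj.
have Nin (T : finType) (A : {set T}) : (None \in Some @: A) = false.
  by apply/negP => /imsetP[].
have cE : val c1 = (lo a None, up a None).
  rewrite [val c1]surjective_pairing; congr pair; apply/setP=> p; rewrite inE aE.
    by rewrite ext_ltSN /= in_setU1 Sin.
  by rewrite ext_ltNS /= Sin.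
have [h [hN hS]] := ext_emb_ex NP cE.
have <- : nu _ _ a = fm (val c) * fm (above_pt c (val c1)).
  by rewrite -[above_pt c _]/(val d) !fm_cut measure_comp mulrC.
have -> : a = emb_comp h (ext_emb c1).
  by apply: embP => p; rewrite emb_compE ext_embE hS.
rewrite measure_comp fm_cut mulrC; congr (_ * _).
rewrite (@measure_one_pt _ _ h (Some None : R)).
- congr fm; congr pair; apply/setP=> -[p|]; rewrite inE ?hS ?hN ?aE.
  + by rewrite ext_ltSS ext_ltSN Sin.
  + by rewrite ext_ltNS /= !Nin.
  + by rewrite ext_ltSS ext_ltNS in_setU1 Sin.
  + by rewrite ext_ltSN /= !in_setU1 !eqxx.
- by apply/negP => /codomP[[p|]]; rewrite ?hS ?hN ?aE.
- case=> [[p|]|]; [right|by left|right].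
    by exists (Some p); rewrite hS aE.
  by exists None; rewrite hN.
Qed.

End MeasureFunction.

Section TwoLevels.
Variables p q : nat.

Definition two_lt : rel ('I_p + 'I_q) := fun x y =>
  match x, y with inl _, inr _ => true | _, _ => false end.

Lemma two_irr : irreflexive two_lt.
Proof. by case. Qed.

Lemma two_trans : transitive two_lt.
Proof. by case=> ? [] ? [] ?. Qed.

(** [J p q] without its marked point, built directly to avoid the subtype [puncture (J_pt p q)];
    [two_cut] is the cut of the marked point. *)
Definition two_levels : poset := pos_of (Sorel two_irr two_trans).

Definition two_cut : pr two_levels :=
  ([set x : two_levels | if x is inl _ then true else false],
   [set x : two_levels | if x is inr _ then true else false]).

Lemma J_emb_subproof : {mono (Some : two_levels -> J p q) : x y / (x <= y)%O}.
Proof.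
move=> x y; rewrite [LHS]J_leE le_eqVlt pos_ltE.
by case: x y => ? [] ?.
Qed.

Definition J_emb := mkemb J_emb_subproof.

Lemma J_embE x : J_emb x = Some x.
Proof. exact: mkembE. Qed.

Lemma marked_measureJ (k : comPzRingType) (nu : measure k) :
  marked_measure nu (J_pt p q) = fm nu two_cut.
Proof.
have sP (x : two_levels) : (Some x : J p q) != J_pt p q by [].
pose h (x : two_levels) : puncture (J_pt p q) := Sub (Some x : J p q) (sP x).
have hM : {mono h : x y / (x <= y)%O} by move=> x y; exact: J_emb_subproof.
have JE : J_emb = emb_comp (puncture_emb (J_pt p q)) (mkemb hM).
  by apply: embP => x; rewrite J_embE emb_compE !mkembE.
rewrite /marked_measure -(@measure_isor _ nu _ _ _ _ (mkemb hM)); last first.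
  apply: emb_surj_bij => -[[y|] yN] //; exists y; rewrite mkembE.
  exact: val_inj.
rewrite -JE (@measure_one_pt _ nu _ _ _ (J_pt p q)).
- congr fm; congr pair; apply/setP=> x; rewrite !inE J_embE.
    by rewrite lt_neqAle [(_ <= _)%O]J_leE; case: x.
  by rewrite lt_neqAle [(_ <= _)%O]J_leE; case: x.
- by apply/negP => /codomP[x]; rewrite J_embE.
- by case=> [x|]; [right; exists x; rewrite J_embE | left].
Qed.

End TwoLevels.

Section Counting.
Variables (k : comPzRingType) (nu : measure k).

Lemma btw_inl (P : poset) (D U : {set P}) y :
  btw D U (inl y) = [forall d in D, (d < y)%O] && [forall u in U, (y < u)%O].
Proof.
by congr andb; apply/subsetP/forall_inP => h x /h; rewrite ?inE.
Qed.

(** The maximal elements of [D] and the minimal elements of [U] form a copy of [two_levels]. A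
    point, old or new, lies between [D] and [U] exactly when it induces [two_cut] on this copy, so
    restrictivity along the inclusion is the count. *)
Lemma fm_counted :
  counted_by (fm nu) (fun p q => marked_measure nu (J_pt p q)).
Proof.
move=> P D U DU; set p := #|_|; set q := #|mins U|.
pose h (x : two_levels p q) : P :=
  match x with inl i => enum_val i | inr j => enum_val j end.
have hM : {mono h : x y / (x <= y)%O}.
  have hi (i j : 'I_p) : (enum_val i <= enum_val j)%O = (i == j).
    rewrite le_eqVlt (inj_eq enum_val_inj) (@maxs_anti _ D) ?orbF //; exact: enum_valP.
  have hj (i j : 'I_q) : (enum_val i <= enum_val j)%O = (i == j).
    rewrite le_eqVlt (inj_eq enum_val_inj) (@mins_anti _ U) ?orbF //; exact: enum_valP.
  have hij (i : 'I_p) (j : 'I_q) : (enum_val i < enum_val j)%O.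
    by apply: DU; [apply: maxs_sub | apply: mins_sub]; exact: enum_valP.
  move=> x y; rewrite [RHS]le_eqVlt pos_ltE.
  case: x y => [i|i] [j|j] /=; rewrite ?hi ?hj ?orbF ?orbT //.
    by rewrite ltW.
  by rewrite lt_geF.
pose b := mkemb hM.
have bm m : m \in maxs D -> exists i, b (inl i) = m.
  by move=> mD; exists (enum_rank_in mD m); rewrite mkembE /= enum_rankK_in.
have bn m : m \in mins U -> exists i, b (inr i) = m.
  by move=> mU; exists (enum_rank_in mU m); rewrite mkembE /= enum_rankK_in.
have bD i : b (inl i) \in D by rewrite mkembE; apply/maxs_sub/enum_valP.
have bU i : b (inr i) \in U by rewrite mkembE; apply/mins_sub/enum_valP.
rewrite marked_measureJ (fm_restrictive nu b) big_sumType /=; congr (_ + _).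
  rewrite sumr_const; congr (_ *+ _); apply: eq_card => y.
  rewrite [LHS]unfold_in [LHS]btw_inl inE /=; apply/andP/andP.
    case=> /forall_inP hD /forall_inP hU; split.
      apply/codomP => -[[i|j] yE].
        by have := hD _ (bD i); rewrite -yE ltxx.
      by have := hU _ (bU j); rewrite -yE ltxx.
    apply/eqP; congr pair; apply/setP=> -[i|j]; rewrite !inE.
    - exact: hD.
    - by apply/negbTE; rewrite lt_gtF // hU.
    - by apply/negbTE; rewrite lt_gtF // hD.
    - exact: hU.
  case=> _ /eqP[/setP loE /setP upE]; split; apply/forall_inP => d.
    case/maxs_above => m /bm[i <-] /le_lt_trans; apply.
    by have := loE (inl i); rewrite !inE.
  case/mins_below => m /bn[i <-]; apply: lt_le_trans.
  by have := upE (inr i); rewrite !inE.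
rewrite big_mkcond [RHS]big_mkcond; apply: eq_bigr => -[D' U'] _ /=.
have [|/fm_supp ->] := boolP (is_cut (D', U')); last by rewrite !if_same.
case/is_cutP => lt' dn' up'; congr (if _ then _ else _); rewrite /btw /=.
apply/andP/eqP => [[/subsetP sD /subsetP sU]|].
  congr pair; apply/setP=> -[i|j]; rewrite !inE.
  - exact: sD.
  - by apply/negP => /lt'/(_ (sU _ (bU j))); rewrite ltxx.
  - by apply/negP => /(lt' _ _ (sD _ (bD i))); rewrite ltxx.
  - exact: sU.
case=> /setP dE /setP uE; split; apply/subsetP => d.
  case/maxs_above => m /bm[i <-]; apply: dn'.
  by have := dE (inl i); rewrite !inE.
case/mins_below => m /bn[i <-]; apply: up'.
by have := uE (inr i); rewrite !inE.
Qed.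

End Counting.

(** * The Fubini identity *)

Definition op (P : poset) : predArgType := P.

Section Opposite.
Variable P : poset.

HB.instance Definition _ := Finite.on (op P).

Definition op_le : rel (op P) := fun x y => ((y : P) <= x)%O.

Lemma op_refl : reflexive op_le.
Proof. by move=> x; exact: lexx. Qed.

Lemma op_anti : antisymmetric op_le.
Proof. by move=> x y; rewrite andbC => /le_anti. Qed.

Lemma op_trans : transitive op_le.
Proof. by move=> y x z xy yz; exact: le_trans yz xy. Qed.

HB.instance Definition _ :=
  Order.Le_isPOrder.Build poset_display (op P) op_refl op_anti op_trans.

Lemma op_leE (x y : op P) : (x <= y)%O = ((y : P) <= x)%O.
Proof. by []. Qed.

Lemma op_ltE (x y : op P) : (x < y)%O = ((y : P) < x)%O.
Proof. by rewrite !lt_neqAle op_leE eq_sym. Qed.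

Lemma maxs_op (U : {set P}) : maxs (U : {set op P}) = mins U.
Proof.
apply/setP=> u; rewrite !inE; congr andb.
by apply: eq_forallb_in => v _; rewrite op_ltE.
Qed.

Lemma mins_op (U : {set P}) : mins (U : {set op P}) = maxs U.
Proof.
apply/setP=> u; rewrite !inE; congr andb.
by apply: eq_forallb_in => v _; rewrite op_ltE.
Qed.

End Opposite.

Section ExtremalCount.

Lemma card_maxsU1 (P : poset) (z : P) (E : {set P}) :
  #|maxs (z |: E)| = if [exists e in E, (z <= e)%O] then #|maxs E|
                     else #|maxs E :\: [set e | (e < z)%O]|.+1.
Proof.
case: ifP => [/exists_inP[e eE ze]|/exists_inPn zE].
  have [->|zNe] := eqVneq z e; first by rewrite (setUidPr _) // sub1set.
  have {zNe} ze' : (z < e)%O by rewrite lt_neqAle zNe.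
  congr #|pred_of_set _|; apply/setP=> m; rewrite !inE.
  apply/andP/andP.
  - case=> mE /forall_inP mM; split; last first.
      by apply/forall_inP => x xE; apply: mM; rewrite !inE xE orbT.
    case/orP: mE => // /eqP mz; have := mM e.
    by rewrite !inE eE orbT mz ze' => /(_ isT).
  - case=> mE /forall_inP mM; split; first by rewrite mE orbT.
    apply/forall_inP => x; rewrite !inE => /orP[/eqP ->|/mM //].
    by apply: contra (mM e eE) => /lt_trans; apply.
have zE' : z \notin E by apply/negP => /zE; rewrite lexx.
rewrite (_ : maxs _ = z |: (maxs E :\: [set e | (e < z)%O])).
  by rewrite cardsU1 !inE (negbTE zE') !andbF.
apply/setP=> m; rewrite !inE; apply/andP/orP.
- case=> /orP[/eqP ->|mE] /forall_inP mM; first by left.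
  right; rewrite (mM z) ?setU11 // mE.
  by apply/forall_inP=> x xE; apply: mM; rewrite !inE xE orbT.
- case=> [/eqP ->|/andP[mz /andP[mE /forall_inP mM]]].
    rewrite eqxx; split=> //; apply/forall_inP => x; rewrite !inE.
    case/orP=> [/eqP ->|/zE]; first by rewrite ltxx.
    by apply: contra; exact: ltW.
  rewrite mE orbT; split=> //; apply/forall_inP => x; rewrite !inE.
  by case/orP=> [/eqP -> //|/mM].
Qed.

Lemma card_minsU1 (P : poset) (z : P) (E : {set P}) :
  #|mins (z |: E)| = if [exists e in E, (e <= z)%O] then #|mins E|
                     else #|mins E :\: [set e | (z < e)%O]|.+1.
Proof.
have /= := @card_maxsU1 (op P) z E; rewrite !maxs_op => ->.
have -> : [set e : op P | (e < z)%O] = [set e : P | (z < e)%O].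
  by apply/setP => e; rewrite !inE op_ltE.
by [].
Qed.

End ExtremalCount.
Lemma maxs_imset (P Q : poset) (a : embedding P Q) (D : {set P}) :
  maxs (a @: D) = a @: maxs D.
Proof.
apply/setP=> y; apply/idP/imsetP => [|[x xm ->]].
  rewrite inE => /andP[/imsetP[x xD ->] /forall_inP h]; exists x => //.
  rewrite inE xD; apply/forall_inP => e eD; rewrite -(emb_lt a).
  by apply: h; exact: imset_f.
rewrite inE imset_f ?(maxs_sub xm) //; apply/forall_inP => _ /imsetP[e eD ->].
by rewrite emb_lt; move: xm; rewrite inE => /andP[_ /forall_inP]; apply.
Qed.

Lemma mins_imset (P Q : poset) (a : embedding P Q) (D : {set P}) :
  mins (a @: D) = a @: mins D.
Proof.
apply/setP=> y; apply/idP/imsetP => [|[x xm ->]].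
  rewrite inE => /andP[/imsetP[x xD ->] /forall_inP h]; exists x => //.
  rewrite inE xD; apply/forall_inP => e eD; rewrite -(emb_lt a).
  by apply: h; exact: imset_f.
rewrite inE imset_f ?(mins_sub xm) //; apply/forall_inP => _ /imsetP[e eD ->].
by rewrite emb_lt; move: xm; rewrite inE => /andP[_ /forall_inP]; apply.
Qed.

Lemma mem_Some (T : finType) (A : {set T}) x : (Some x \in Some @: A) = (x \in A).
Proof. by apply: mem_imset; exact: Some_inj. Qed.

Lemma mem_None (T : finType) (A : {set T}) : (None \in Some @: A) = false.
Proof. by apply/negP => /imsetP[]. Qed.

Lemma preimset_Some (T : finType) (A : {set T}) : Some @^-1: (Some @: A) = A.
Proof. by apply/setP => x; rewrite inE mem_Some. Qed.

Lemma preimset_SomeU (T : finType) (A : {set T}) :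
  Some @^-1: (None |: Some @: A) = A.
Proof. by apply/setP => x; rewrite inE in_setU1 mem_Some. Qed.

Lemma sub_Some (T : finType) (A : {set T}) (B : {set option T}) :
  (Some @: A \subset B) = (A \subset Some @^-1: B).
Proof. by rewrite sub_imset_pre. Qed.

Section ClosedCount.
Variable P : poset.
Implicit Types (x y : pts P) (D U : {set P}).

Definition lepx x d := match x with inl y => (y <= d)%O | inr c => d \in c.2 end.
Definition gepx x u := match x with inl y => (u <= y)%O | inr c => u \in c.1 end.

(* The number of maximal elements of D + x, where x may be a new point. *)
Definition nmaxs D x :=
  if [exists d in D, lepx x d] then #|maxs D| else #|maxs D :\: lox x|.+1.
Definition nmins U x :=
  if [exists u in U, gepx x u] then #|mins U| else #|mins U :\: upx x|.+1.

Lemma ext_embS (c : cut P) D : (Some @: D : {set ext c}) = ext_emb c @: D.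
Proof. by apply: eq_imset => x; rewrite ext_embE. Qed.

Lemma nmaxs_inr (c : cut P) D :
  #|maxs (None |: Some @: D : {set ext c})| = nmaxs D (inr (val c)).
Proof.
rewrite card_maxsU1 /nmaxs /= ext_embS maxs_imset.
have -> : [exists e in ext_emb c @: D, ((None : ext c) <= e)%O]
        = [exists d in D, d \in (val c).2].
  apply/exists_inP/exists_inP => [[e /imsetP[d dD ->]]|[d dD du]].
    by rewrite ext_embE => du; exists d.
  by exists (Some d) => //; apply/imsetP; exists d; rewrite ?ext_embE.
rewrite (card_imset _ (@emb_inj _ _ (ext_emb c))).
rewrite (_ : _ :\: _ = ext_emb c @: (maxs D :\: (val c).1)).
  by rewrite (card_imset _ (@emb_inj _ _ (ext_emb c))).
apply/setP=> e; rewrite -!ext_embS inE; case: e => [d|].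
  by rewrite !mem_Some [RHS]in_setD; congr (~~ _ && _); rewrite inE ext_ltSN.
by rewrite !mem_None andbF.
Qed.

Lemma nmins_inr (c : cut P) D :
  #|mins (None |: Some @: D : {set ext c})| = nmins D (inr (val c)).
Proof.
rewrite card_minsU1 /nmins /= ext_embS mins_imset.
have -> : [exists e in ext_emb c @: D, (e <= (None : ext c))%O]
        = [exists d in D, d \in (val c).1].
  apply/exists_inP/exists_inP => [[e /imsetP[d dD ->]]|[d dD du]].
    by rewrite ext_embE => du; exists d.
  by exists (Some d) => //; apply/imsetP; exists d; rewrite ?ext_embE.
rewrite (card_imset _ (@emb_inj _ _ (ext_emb c))).
rewrite (_ : _ :\: _ = ext_emb c @: (mins D :\: (val c).2)).
  by rewrite (card_imset _ (@emb_inj _ _ (ext_emb c))).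
apply/setP=> e; rewrite -!ext_embS inE; case: e => [d|].
  by rewrite !mem_Some [RHS]in_setD; congr (~~ _ && _); rewrite inE ext_ltNS.
by rewrite !mem_None andbF.
Qed.

Lemma nmaxs_inl z D : #|maxs (z |: D)| = nmaxs D (inl z).
Proof. exact: card_maxsU1. Qed.

Lemma nmins_inl z D : #|mins (z |: D)| = nmins D (inl z).
Proof. exact: card_minsU1. Qed.

End ClosedCount.

Section Fubini.
Variables (k : comPzRingType) (f : forall P : poset, pr P -> k).
Variable g : nat -> nat -> k.
Hypothesis f_supp : cut_supported f.
Hypothesis f_count : counted_by f g.

Variable P : poset.
Implicit Types (x y : pts P) (D U : {set P}).

(* wt x * w_above x y is the weight of the pair x < y when x is added first,
   and wt y * w_below y x its weight when y is added first. *)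
Definition w_above x y : k :=
  match x, y with
  | inl a, inl z => (a < z)%O%:R
  | inl a, inr c1 => if a \in c1.1 then f c1 else 0
  | inr c, inl z => (z \in c.2)%:R
  | inr c, inr c1 => oapp (fun d : cut P => f (above_pt d c1)) 0 (insub c)
  end.

Definition w_below y x : k :=
  match y, x with
  | inl z, inl a => (a < z)%O%:R
  | inr c1, inl a => (a \in c1.1)%:R
  | inl z, inr c => if z \in c.2 then f c else 0
  | inr c1, inr c => oapp (fun d : cut P => f (below_pt d c)) 0 (insub c1)
  end.

(** The points [y] above [x] are those between [D] + x and [U] in P + x, so this is an instance of
    [f_count] there, or in P itself when [x] is old. *)
Lemma sum_above x D U :
  (if x is inr c then is_cut c else true) -> below D U -> U \subset upx x ->
  \sum_(y | btw D U y) w_above x y = g (nmaxs D x) #|mins U|.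
Proof.
case: x => [a _|c cP] DU /subsetP Ux.
  have aDU : below (a |: D) U.
    by move=> d u /setU1P[->|/DU h] uU; [have := Ux u uU; rewrite inE | exact: h].
  rewrite -nmaxs_inl -f_count // big_mkcond [RHS]big_mkcond; apply: eq_bigr.
  move=> [z|c1] _ /=; rewrite /btw /= subUset sub1set ?inE.
    by case: (a < z)%O => /=; rewrite ?if_same.
  by case: (a \in c1.1); rewrite /= ?if_same.
pose d : cut P := Sub c cP; rewrite -[c]/(val d) -nmaxs_inr.
have -> : #|mins U| = #|mins (Some @: U : {set ext d})|.
  by rewrite ext_embS mins_imset card_imset //; exact: emb_inj.
have DU' : @below (ext d) (None |: Some @: D) (Some @: U).
  move=> e u /setU1P[->|/imsetP[e' eD ->]] /imsetP[u' uU ->].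
    by rewrite ext_ltNS; exact: Ux.
  by rewrite ext_ltSS; exact: DU.
rewrite -f_count // !big_sumType /=; congr (_ + _).
  rewrite big_mkcond [RHS]big_mkcond.
  (* The added point is not above itself, so among the old points of [ext d] only those of [P]
     contribute. *)
  rewrite [RHS](bigID (fun z : ext d => z == None)) /= big_pred1_eq.
  rewrite [X in (if X then _ else _) + _](_ : _ = false) ?add0r; last first.
    by rewrite /btw /= subUset sub1set inE ltxx.
  rewrite [RHS](reindex_omap (Some : P -> ext d) id) //=; last by case.
  apply: eq_big => [z|z _]; first by rewrite eqxx.
  rewrite /btw /= subUset sub1set inE ext_ltNS /= !sub_Some.
  have -> : Some @^-1: [set y : ext d | (y < (Some z : ext d))%O]
          = [set y : P | (y < z)%O] by apply/setP=> y; rewrite !inE ext_ltSS.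
  have -> : Some @^-1: [set y : ext d | ((Some z : ext d) < y)%O]
          = [set y : P | (z < y)%O] by apply/setP=> y; rewrite !inE ext_ltSS.
  by case: (z \in c.2); rewrite /= ?if_same.
have -> : insub c = Some d by exact: insubT.
rewrite /= [RHS]big_mkcond /=.
(* A cut above [None] contains it in its lower set, hence not in its upper set; the pairs with this
   property are exactly the [above_pt d c1]. *)
rewrite (bigID (fun e : pr (ext d) => (None \in e.1) && (None \notin e.2))) /=.
rewrite [X in _ = _ + X]big1 ?addr0; last first.
  move=> [e1 e2] /= eN; case: ifP => // /andP[/= /subsetP s1 _]; apply: f_supp.
  have Ne1 : None \in e1 by apply: s1; exact: setU11.
  move: eN; rewrite Ne1 negbK => Ne2; apply/negP => /is_cutP[/(_ None None)].
  by rewrite ltxx => /(_ Ne1 Ne2).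
rewrite (reindex_onto (above_pt d)
  (fun e : pr (ext d) => (Some @^-1: e.1, Some @^-1: e.2))) /=; last first.
  move=> [e1 e2] /= /andP[N1 N2]; congr pair; apply/setP => -[y|].
  - by rewrite in_setU1 mem_Some inE.
  - by rewrite setU11 N1.
  - by rewrite mem_Some inE.
  - by rewrite mem_None (negbTE N2).
rewrite big_mkcond [RHS]big_mkcond /=; apply: eq_bigr => c1 _.
rewrite setU11 mem_None /=.
rewrite preimset_SomeU preimset_Some -surjective_pairing eqxx /=.
rewrite /btw /= subUset sub1set setU11 /= !sub_Some.
by rewrite preimset_SomeU preimset_Some.
Qed.

Lemma sum_below y D U :
  (if y is inr c then is_cut c else true) -> below D U -> D \subset lox y ->
  \sum_(x | btw D U x) w_below y x = g #|maxs D| (nmins U y).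
Proof.
case: y => [a _|c cP] DU /subsetP Dx.
  have aDU : below D (a |: U).
    by move=> d u dD /setU1P[->|uU]; [have := Dx d dD; rewrite inE | exact: DU].
  rewrite -nmins_inl -f_count // big_mkcond [RHS]big_mkcond; apply: eq_bigr.
  move=> [z|c1] _ /=; rewrite /btw /= subUset sub1set ?inE.
    by case: (z < a)%O => /=; rewrite ?andbF ?if_same.
  by case: (a \in c1.2); rewrite /= ?andbF ?if_same.
pose d : cut P := Sub c cP; rewrite -[c]/(val d) -nmins_inr.
have -> : #|maxs D| = #|maxs (Some @: D : {set ext d})|.
  by rewrite ext_embS maxs_imset card_imset //; exact: emb_inj.
have DU' : @below (ext d) (Some @: D) (None |: Some @: U).
  move=> e u /imsetP[e' eD ->] /setU1P[->|/imsetP[u' uU ->]].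
    by rewrite ext_ltSN; exact: Dx.
  by rewrite ext_ltSS; exact: DU.
rewrite -f_count // !big_sumType /=; congr (_ + _).
  rewrite big_mkcond [RHS]big_mkcond.
  rewrite [RHS](bigID (fun z : ext d => z == None)) /= big_pred1_eq.
  rewrite [X in (if X then _ else _) + _](_ : _ = false) ?add0r; last first.
    by rewrite /btw /= subUset sub1set inE ltxx andbF.
  rewrite [RHS](reindex_omap (Some : P -> ext d) id) //=; last by case.
  apply: eq_big => [z|z _]; first by rewrite eqxx.
  rewrite /btw /= subUset sub1set inE ext_ltSN /= !sub_Some.
  have -> : Some @^-1: [set y : ext d | (y < (Some z : ext d))%O]
          = [set y : P | (y < z)%O] by apply/setP=> y; rewrite !inE ext_ltSS.
  have -> : Some @^-1: [set y : ext d | ((Some z : ext d) < y)%O]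
          = [set y : P | (z < y)%O] by apply/setP=> y; rewrite !inE ext_ltSS.
  by case: (z \in c.1); rewrite /= ?andbF ?if_same.
have -> : insub c = Some d by exact: insubT.
rewrite /= [RHS]big_mkcond /=.
rewrite (bigID (fun e : pr (ext d) => (None \in e.2) && (None \notin e.1))) /=.
rewrite [X in _ = _ + X]big1 ?addr0; last first.
  move=> [e1 e2] /= eN; case: ifP => // /andP[/= _ /subsetP s2]; apply: f_supp.
  have Ne2 : None \in e2 by apply: s2; exact: setU11.
  move: eN; rewrite Ne2 negbK => Ne1; apply/negP => /is_cutP[/(_ None None)].
  by rewrite ltxx => /(_ Ne1 Ne2).
rewrite (reindex_onto (below_pt d)
  (fun e : pr (ext d) => (Some @^-1: e.1, Some @^-1: e.2))) /=; last first.
  move=> [e1 e2] /= /andP[N2 N1]; congr pair; apply/setP => -[y|].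
  - by rewrite mem_Some inE.
  - by rewrite mem_None (negbTE N1).
  - by rewrite in_setU1 mem_Some inE.
  - by rewrite setU11 N2.
rewrite big_mkcond [RHS]big_mkcond /=; apply: eq_bigr => c1 _.
rewrite setU11 mem_None /=.
rewrite preimset_SomeU preimset_Some -surjective_pairing eqxx /=.
rewrite /btw /= subUset sub1set setU11 /= !sub_Some.
by rewrite preimset_SomeU preimset_Some.
Qed.

End Fubini.

Lemma above_pt_cut_inv (P : poset) (c : cut P) (c1 : pr P) :
  is_cut (above_pt c c1) ->
  [/\ is_cut c1, (val c).1 \subset c1.1 & c1.2 \subset (val c).2].
Proof.
case: c1 => D U /is_cutP /= [lt dn up]; split.
- apply/is_cutP; split=> [d u dD uU|x y yD xy|x y yU yx].
  + have := lt (Some d) (Some u); rewrite in_setU1 !mem_Some ext_ltSS.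
    exact.
  + have := dn (Some x) (Some y); rewrite !in_setU1 !mem_Some /=.
    by apply.
  + have := up (Some x) (Some y); rewrite !mem_Some; exact.
- apply/subsetP=> d dD; have := dn (Some d) None.
  by rewrite !in_setU1 mem_Some /= ext_leE; apply.
- apply/subsetP=> u uU; have := lt None (Some u).
  by rewrite in_setU1 mem_Some ext_ltNS; apply.
Qed.

Lemma below_pt_cut_inv (P : poset) (c : cut P) (c1 : pr P) :
  is_cut (below_pt c c1) ->
  [/\ is_cut c1, c1.1 \subset (val c).1 & (val c).2 \subset c1.2].
Proof.
case: c1 => D U /is_cutP /= [lt dn up]; split.
- apply/is_cutP; split=> [d u dD uU|x y yD xy|x y yU yx].
  + have := lt (Some d) (Some u); rewrite in_setU1 !mem_Some ext_ltSS.
    exact.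
  + have := dn (Some x) (Some y); rewrite !mem_Some; exact.
  + have := up (Some x) (Some y); rewrite !in_setU1 !mem_Some /=.
    by apply.
- apply/subsetP=> d dD; have := lt (Some d) None.
  by rewrite in_setU1 mem_Some ext_ltSN; apply.
- apply/subsetP=> u uU; have := up (Some u) None.
  by rewrite !in_setU1 mem_Some /= ext_leE; apply.
Qed.

Section FubiniIdentity.
Variables (k : comPzRingType) (f : forall P : poset, pr P -> k).
Variable g : nat -> nat -> k.

Definition pts_exchange := forall (P : poset) (x y : pts P),
  wt f x * w_above f x y = wt f y * w_below f y x.

(** The left side sums over [y] first for each [x], the right side over [x] first for each [y];
    [sum_above] and [sum_below] have evaluated the inner sums. *)
Definition fubini := forall (P : poset) (D D' U U' : {set P}),
  D \subset D' -> U' \subset U -> below D U -> below D' U' ->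
  \sum_(x | btw D U x) wt f x * g (nmaxs D' x) #|mins U'|
  = \sum_(y | btw D' U' y) wt f y * g #|maxs D| (nmins U y).

Hypothesis f_supp : cut_supported f.

(** With an old member the relation is immediate. For two new points both sides vanish unless both
    pairs are cuts and nested, which removes the side conditions of [exchange]. *)
Lemma exchange_pts : exchange f -> pts_exchange.
Proof.
move=> fX P [a|c] [z|c1] /=; rewrite ?mul1r //.
- by case: ifP => _; rewrite ?mulr1 ?mulr0.
- by case: ifP => _; rewrite ?mulr1 ?mulr0.
have [cP|cN] := boolP (is_cut c); last first.
  rewrite (f_supp cN) mul0r.
  have [c1P|c1N] := boolP (is_cut c1); last by rewrite (f_supp c1N) mul0r.
  rewrite (insubT _ c1P) /= (@f_supp _ (below_pt _ _)) ?mulr0 //.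
  by apply: contra cN => /below_pt_cut_inv[].
have [c1P|c1N] := boolP (is_cut c1); last first.
  rewrite (f_supp c1N) mul0r (insubT _ cP) /= (@f_supp _ (above_pt _ _)) ?mulr0 //.
  by apply: contra c1N => /above_pt_cut_inv[].
rewrite (insubT _ cP) (insubT _ c1P) /=.
have [/andP[s1 s2]|sN] := boolP ((c.1 \subset c1.1) && (c1.2 \subset c.2)).
  exact: (fX P (Sub c cP) (Sub c1 c1P) s1 s2).
rewrite (@f_supp _ (above_pt _ _)) ?(@f_supp _ (below_pt _ _)) ?mulr0 //.
  by apply: contra sN => /below_pt_cut_inv[/= _ -> ->].
by apply: contra sN => /above_pt_cut_inv[/= _ -> ->].
Qed.

Hypothesis f_count : counted_by f g.

Lemma pts_exchange_fubini : pts_exchange -> fubini.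
Proof.
move=> fX P D D' U U' /subsetP sD /subsetP sU DU DU'.
transitivity (\sum_(x | btw D U x) \sum_(y | btw D' U' y)
                wt f x * w_above f x y).
  apply: eq_bigr => x /andP[_ /subsetP Ux]; rewrite -mulr_sumr.
  case: x Ux => [a|c] Ux; first rewrite (sum_above f_supp f_count) //.
    by apply/subsetP=> u /sU/Ux.
  have [cP|cN] := boolP (is_cut c); last by rewrite /= (f_supp cN) !mul0r.
  rewrite (sum_above f_supp f_count) //.
  by apply/subsetP=> u /sU/Ux.
rewrite exchange_big; apply: eq_bigr => y /andP[/subsetP Dy _] /=.
under eq_bigr do rewrite fX; rewrite -mulr_sumr.
case: y Dy => [a|c] Dy; first rewrite (sum_below f_supp f_count) //.
  by apply/subsetP=> u /sD/Dy.
have [cP|cN] := boolP (is_cut c); last by rewrite /= (f_supp cN) !mul0r.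
rewrite (sum_below f_supp f_count) //.
by apply/subsetP=> u /sD/Dy.
Qed.

End FubiniIdentity.

Section Duality.
Variables (k : comPzRingType) (f : forall P : poset, pr P -> k).
Variable g : nat -> nat -> k.

(** The weights seen from the opposite order. They turn every statement about maximal elements into
    one about minimal elements. *)
Definition fop (P : poset) (c : pr P) : k := f ((c.2, c.1) : pr (op P)).
Definition gop (p q : nat) : k := g q p.

Definition swapx (P : poset) (x : pts P) : pts (op P) :=
  match x with inl y => inl y | inr c => inr (c.2, c.1) end.

Lemma swapx_bij P : bijective (@swapx P).
Proof.
pose h (x : pts (op P)) : pts P :=
  match x with inl y => inl y | inr c => inr (c.2, c.1) end.
by exists h; case=> [y|[A B]].
Qed.

Lemma wt_swapx P (x : pts P) : wt f (swapx x) = wt fop x.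
Proof. by case: x. Qed.

Lemma lox_swapx P (x : pts P) : lox (swapx x) = upx x.
Proof. by case: x => //= y; apply/setP=> z; rewrite !inE op_ltE. Qed.

Lemma upx_swapx P (x : pts P) : upx (swapx x) = lox x.
Proof. by case: x => //= y; apply/setP=> z; rewrite !inE op_ltE. Qed.

Lemma btw_swapx P (x : pts P) (D U : {set P}) :
  @btw (op P) D U (swapx x) = btw U D x.
Proof. by rewrite /btw lox_swapx upx_swapx; exact: andbC. Qed.

Lemma below_op (P : poset) (D U : {set P}) :
  below D U -> below (U : {set op P}) D.
Proof. by move=> DU u d uU dD; rewrite op_ltE; exact: DU. Qed.

Lemma nmaxs_swapx P (x : pts P) (D : {set P}) :
  nmaxs (D : {set op P}) (swapx x) = nmins D x.
Proof. by rewrite /nmaxs /nmins maxs_op lox_swapx; case: x. Qed.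

Lemma nmins_swapx P (x : pts P) (D : {set P}) :
  nmins (D : {set op P}) (swapx x) = nmaxs D x.
Proof. by rewrite /nmaxs /nmins mins_op upx_swapx; case: x. Qed.

Lemma is_cut_op (P : poset) (c : pr P) :
  is_cut c -> is_cut ((c.2, c.1) : pr (op P)).
Proof.
case: c => D U /is_cutP[lt dn up] /=; apply/is_cutP; split.
- by move=> u d uU dD; rewrite op_ltE; exact: lt.
- by move=> x y yU xy; exact: up yU xy.
- by move=> x y yD xy; exact: dn yD xy.
Qed.

Lemma fop_supp : cut_supported f -> cut_supported fop.
Proof.
move=> fS P c cN; apply: fS; apply: contra cN => /is_cut_op /= cP.
move: cP; case: c => D U /= /is_cutP[lt dn up]; apply/is_cutP; split.
- by move=> d u dD uU; have := lt d u dD uU; rewrite !op_ltE.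
- by move=> x y yU xy; exact: dn yU xy.
- by move=> x y yD xy; exact: up yD xy.
Qed.

Lemma fop_counted : counted_by f g -> counted_by fop gop.
Proof.
move=> fC P D U DU; have := fC (op P) U D (below_op DU).
rewrite maxs_op mins_op /gop => <-.
rewrite [RHS](reindex (@swapx P)); last exact/onW_bij/swapx_bij.
by apply: eq_big => x; rewrite ?btw_swapx ?wt_swapx.
Qed.

Lemma fop_fubini : fubini f g -> fubini fop gop.
Proof.
move=> fF P D D' U U' sD sU DU DU'.
have := fF (op P) U' U D' D sU sD (below_op DU') (below_op DU).
rewrite (reindex (@swapx P)); last exact/onW_bij/swapx_bij.
rewrite [RHS](reindex (@swapx P)); last exact/onW_bij/swapx_bij.
move=> E; transitivity (\sum_(j : pts P | btw (U : {set op P}) D (swapx j))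
    wt f (swapx j) * g #|maxs (U' : {set op P})| (nmins (D' : {set op P}) (swapx j))).
  apply: eq_big => x; first by rewrite btw_swapx.
  by rewrite wt_swapx nmins_swapx maxs_op.
rewrite -E; apply: eq_big => x; first by rewrite btw_swapx.
by rewrite wt_swapx nmaxs_swapx mins_op.
Qed.

End Duality.

(** * Closed forms of the two sides for a truncated [g] *)

Section Truncated.
Variables (k : comPzRingType) (f : forall P : poset, pr P -> k).
Variable g : nat -> nat -> k.
Hypothesis f_supp : cut_supported f.
Hypothesis f_count : counted_by f g.
Hypothesis g_min : forall p q, g p q = g (minn p 2) (minn q 2).

Lemma g_ge2l p q : (2 <= p)%N -> g p q = g 2 q.
Proof. by move=> p2; rewrite g_min (minn_idPr p2) [RHS]g_min. Qed.

Lemma g_ge2r p q : (2 <= q)%N -> g p q = g p 2.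
Proof. by move=> q2; rewrite g_min (minn_idPr q2) [RHS]g_min. Qed.

Variables (P : poset) (D D' U U' : {set P}).
Hypothesis sD : D \subset D'.
Hypothesis sU : U' \subset U.
Hypothesis DU : below D U.
Hypothesis DU' : below D' U'.

Definition belowb (A B : {set P}) := [forall d in A, forall u in B, (d < u)%O].

Lemma belowP (A B : {set P}) : reflect (below A B) (belowb A B).
Proof.
apply: (iffP forall_inP) => [h d u dA uB|h d dA].
  by have /forall_inP := h d dA; apply.
by apply/forall_inP => u uB; exact: h.
Qed.

Definition crossing := [exists d in D', exists u in U, (u <= d)%O].

Definition valid_pt (x : pts P) := if x is inr c then is_cut c else true.

Lemma wt_cut (x : pts P) : ~~ valid_pt x -> wt f x = 0.
Proof. by case: x => //= c; exact: f_supp. Qed.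

Lemma pts_below (x : pts P) d u :
  valid_pt x ->
  d \in lox x -> u \in upx x -> (d < u)%O.
Proof.
case: x => [y _|[A B] /is_cutP[lt _ _]]; rewrite ?inE; first exact: lt_trans.
exact: lt.
Qed.

Lemma lepx_lox (x : pts P) d : valid_pt x ->
  lepx x d -> d \notin lox x.
Proof.
case: x => [y _|[A B] /is_cutP[lt _ _]] /=.
  by rewrite inE => /le_gtF ->.
by move=> dB; apply/negP => dA; have := lt _ _ dA dB; rewrite ltxx.
Qed.

Lemma lox_down (x : pts P) d e : valid_pt x ->
  d \in lox x -> (e <= d)%O -> e \in lox x.
Proof.
case: x => [y _|[A B] /is_cutP[_ dn _]] /=.
  by rewrite !inE => dy ed; exact: le_lt_trans ed dy.
exact: dn.
Qed.

Lemma lepx_up (x : pts P) d e : valid_pt x ->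
  lepx x d -> (d <= e)%O -> lepx x e.
Proof.
case: x => [y _|[A B] /is_cutP[_ _ up]] /=; first exact: le_trans.
exact: up.
Qed.

(** If [x] lies above all of [D'], it is the only maximal element of [D'] + x; if [x] lies weakly
    below a point of [D'], it changes nothing. Otherwise [x] and a maximal element of [D'] not below
    it are both maximal, and truncation gives [g 2 q]. *)
Lemma g_nmaxs (x : pts P) q : valid_pt x ->
  g (nmaxs D' x) q = g 2 q + (if D' \subset lox x then g 1 q - g 2 q else 0)
    + (if [exists d in D', lepx x d] then g #|maxs D'| q - g 2 q else 0).
Proof.
move=> xP; rewrite /nmaxs; case: ifP => [/exists_inP[d dD dx]|xN].
  case: ifP => [/subsetP/(_ d dD)|_]; first by rewrite (negbTE (lepx_lox xP dx)).
  by rewrite addr0 addrC subrK.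
rewrite addr0; case: ifP => [/subsetP sx|/subsetPn[d dD dx]].
  rewrite (_ : maxs D' :\: _ = set0) ?cards0; first by rewrite [RHS]addrC subrK.
  apply/setP=> d; rewrite !inE.
  by case: (boolP (d \in D')) => [/sx ->|]; rewrite ?andbF.
rewrite addr0 g_ge2l //; have [m mD dm] := maxs_above dD.
rewrite ltnS card_gt0; apply/set0Pn; exists m; rewrite in_setD mD andbT.
by apply: contra dx => mx; exact: lox_down dm.
Qed.

(** The points [x <= d] are [d] itself, provided it lies below [U], and the points between [D] and
    [d |: U]. The set [d |: U] has one minimal element if [d] is below [U], those of [U] if some
    element of [U] is [<= d], and at least two otherwise. *)
Lemma sum_lepx_point d : d \notin D -> maxs D' = [set d] ->
  \sum_(x | btw D U x && [exists e in D', lepx x e]) wt f x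
  = (if belowb D' U then g #|maxs D| 1 + 1
     else if crossing then g #|maxs D| #|mins U| else g #|maxs D| 2).
Proof.
move=> dD mD.
have ltd e : e \in D' -> (e <= d)%O.
  by case/maxs_above => m; rewrite mD => /set1P ->.
have dD' : d \in D' by apply: maxs_sub; rewrite mD set11.
have Dd e : e \in D -> (e < d)%O.
  move=> eD; rewrite lt_neqAle ltd ?(subsetP sD) // andbT.
  by apply: contraNneq dD => <-.
have Dd' : below D (d |: U).
  by move=> e u eD /setU1P[->|]; [exact: Dd | exact: DU].
have belowE : belowb D' U = [forall u in U, (d < u)%O].
  apply/belowP/forall_inP => [h u uU|h e u eD uU]; first exact: h.
  exact: le_lt_trans (ltd e eD) (h u uU).
transitivity ((belowb D' U)%:R + g #|maxs D| #|mins (d |: U)|).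
  rewrite -f_count // (bigID (fun x => x == inl d)) /=; congr (_ + _).
    rewrite big_mkcondl big_pred1_eq.
    have -> : [exists e in D', lepx (inl d) e].
      by apply/exists_inP; exists d => //=; rewrite lexx.
    rewrite /= andbT btw_inl -belowE.
    have -> : [forall e in D, (e < d)%O] by apply/forall_inP.
    by case: (belowb D' U).
  rewrite big_mkcond [RHS]big_mkcond; apply: eq_bigr => x _.
  have [xP|xN] := boolP (valid_pt x); last first.
    by rewrite wt_cut // !if_same.
  congr (if _ then _ else _); rewrite /btw subUset sub1set.
  case: (_ \subset lox x) => //=; rewrite -andbA [RHS]andbC.
  case: (_ \subset upx x) => //=.
  have -> : [exists e in D', lepx x e] = lepx x d.
    apply/exists_inP/idP => [[e eD xe]|]; last by exists d.
    exact: lepx_up xP xe (ltd e eD).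
  case: x xP => [y|c] _ /=; last by rewrite andbT.
  by rewrite inE lt_neqAle andbC.
rewrite nmins_inl /nmins /= belowE; case: forall_inP => [dU|dUN].
  have -> : [exists u in U, (u <= d)%O] = false.
    by apply/exists_inP => -[u uU ud]; have := dU u uU; rewrite le_gtF.
  rewrite (_ : _ :\: _ = set0) ?cards0; first by rewrite addrC.
  apply/setP=> u; rewrite in_setD inE in_set0; apply/negbTE.
  by apply/negP => /andP[/negbTE uN /mins_sub/dU]; rewrite uN.
rewrite add0r.
have -> : [exists u in U, (u <= d)%O] = crossing.
  apply/exists_inP/exists_inP => [[u uU ud]|[e eD /exists_inP[u uU ue]]].
    by exists d => //; apply/exists_inP; exists u.
  by exists u => //; exact: le_trans ue (ltd e eD).
case: ifP => // _; rewrite g_ge2r // ltnS card_gt0; apply/set0Pn.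
have : ~~ [forall u in U, (d < u)%O] by apply/forall_inP.
case/forall_inPn => u uU; case: (mins_below uU) => m mU mu dN.
exists m; rewrite in_setD mU andbT inE; apply: contra dN => dm.
exact: lt_le_trans dm mu.
Qed.

Definition new_greatest := (#|maxs D'| == 1)%N && ~~ (maxs D' \subset D).

(** The three terms are the three summands of [g_nmaxs]. For the second, a point above [D'] and
    below [U] exists only if [D'] is below [U]. *)
Lemma truncated_sum :
  let p := #|maxs D| in let p' := #|maxs D'| in
  let q := #|mins U| in let q' := #|mins U'| in
  \sum_(x | btw D U x) wt f x * g (nmaxs D' x) q'
  = g 2 q' * g p q
    + (if belowb D' U then g p' q * (g 1 q' - g 2 q') else 0)
    + (if new_greatest then
         (if belowb D' U then g p 1 + 1 else if crossing then g p q else g p 2)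
         * (g 1 q' - g 2 q')
       else 0).
Proof.
move=> p p' q q'.
transitivity (\sum_(x | btw D U x) (wt f x * g 2 q'
   + (if D' \subset lox x then wt f x * (g 1 q' - g 2 q') else 0)
   + (if [exists d in D', lepx x d] then wt f x * (g p' q' - g 2 q') else 0))).
  apply: eq_bigr => x _.
  have [xP|xN] := boolP (valid_pt x); last first.
    by rewrite wt_cut // !mul0r !if_same !addr0.
  rewrite g_nmaxs //.
  rewrite [LHS]mulrDr [in LHS]mulrDr.
  by congr (_ + _ + _); case: ifP => _; rewrite ?mulr0.
rewrite !big_split /= -!big_mkcondr -!mulr_suml f_count // mulrC.
congr (_ + _ + _).
  have [/belowP DU1|DU1] := boolP (belowb D' U).
    rewrite -/(g _ _) -f_count //; congr (_ * _); apply: eq_bigl => x.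
    rewrite /btw; case: (boolP (D' \subset _)) => [sx|]; rewrite ?andbF //.
    by rewrite (subset_trans sD sx) andbT.
  rewrite big1 ?mul0r // => x /andP[/andP[_ /subsetP Ux] /subsetP D'x].
  apply: wt_cut; move: DU1; apply: contraNN => xP; apply/belowP => d u dD uU.
  exact: (@pts_below x d u xP (D'x d dD) (Ux u uU)).
(* The factor [g p' q' - g 2 q'] vanishes for [2 <= p'], and [D'] is empty for [p' = 0]. For
   [p' = 1] a greatest element in [D] is excluded, because [x] lies above [D] and cannot lie below
   it. *)
rewrite /new_greatest -/p'.
have [p'1|p'N1] := eqVneq p' 1%N; last first.
  have [p'2|] := leqP 2 p'; first by rewrite g_ge2l // subrr mulr0.
  rewrite ltnS leq_eqVlt (negbTE p'N1) ltnS leqn0 => /eqP/cards0_eq mD.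
  rewrite big1 ?mul0r // => x /andP[_ /exists_inP[d /maxs_above[m]]].
  by rewrite mD inE.
move/eqP/cards1P: (p'1) => [d mD]; rewrite mD sub1set /=.
have [dD|dD] := boolP (d \in D); last by rewrite (sum_lepx_point dD mD) p'1.
rewrite big1 ?mul0r // => x /andP[/andP[/subsetP Dx _] /exists_inP[e eD' xe]].
apply/wt_cut; apply/negP => xP.
have ed : (e <= d)%O by have [m] := maxs_above eD'; rewrite mD => /set1P ->.
by have := lepx_lox xP (lepx_up xP xe ed); rewrite Dx.
Qed.

End Truncated.

(** * Stabilisation *)

Section ExtremalSets.
Variable P : poset.

Lemma maxs_antichain (D : {set P}) :
  {in D &, forall x y, (x < y)%O = false} -> maxs D = D.
Proof.
move=> anti; apply/setP=> x; rewrite inE; case: (boolP (x \in D)) => //= xD.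
by apply/forall_inP => y yD; rewrite anti.
Qed.

Lemma mins_antichain (D : {set P}) :
  {in D &, forall x y, (x < y)%O = false} -> mins D = D.
Proof.
move=> anti; apply/setP=> x; rewrite inE; case: (boolP (x \in D)) => //= xD.
by apply/forall_inP => y yD; rewrite anti.
Qed.

Lemma maxs_greatest (D : {set P}) x :
  x \in D -> {in D, forall y, (y <= x)%O} -> maxs D = [set x].
Proof.
move=> xD xM; apply/setP=> y; rewrite !inE; apply/andP/eqP => [[yD]|->].
  move/forall_inP/(_ x xD); have := xM y yD.
  by rewrite le_eqVlt => /orP[/eqP -> //|->].
by split=> //; apply/forall_inP => e /xM ex; rewrite le_gtF.
Qed.

Lemma mins_least (D : {set P}) x :
  x \in D -> {in D, forall y, (x <= y)%O} -> mins D = [set x].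
Proof.
move=> xD xM; apply/setP=> y; rewrite !inE; apply/andP/eqP => [[yD]|->].
  move/forall_inP/(_ x xD); have := xM y yD.
  by rewrite le_eqVlt => /orP[/eqP -> //|->].
by split=> //; apply/forall_inP => e /xM ex; rewrite le_gtF.
Qed.

End ExtremalSets.

Section ThreeLevels.
Variables p r q s : nat.

Definition three := ('I_p + 'I_r + 'I_q)%type.

(** The first [s] bottom points lie below all middle points, the others below none. With [s = 0]
    bottom and middle are incomparable; with two bottom points and [s = 1] exactly one of them is
    covered by the middle. *)
Definition three_lt : rel three := fun x y =>
  match x, y with
  | inl (inl i), inl (inr j) => (i < s)%N
  | inl _, inr _ => true
  | _, _ => false
  end.

Lemma three_irr : irreflexive three_lt.
Proof. by case=> [[]|]. Qed.

Lemma three_trans : transitive three_lt.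
Proof. by case=> [[]|] ? [[]|] ? [[]|] ? //=. Qed.

Definition three_levels : poset := pos_of (Sorel three_irr three_trans).

Definition bot : {set three_levels} :=
  [set x : three_levels | if x is inl (inl _) then true else false].
Definition mid : {set three_levels} :=
  [set x : three_levels | if x is inl (inr _) then true else false].
Definition top : {set three_levels} :=
  [set x : three_levels | if x is inr _ then true else false].

Lemma card_bot : #|bot| = p.
Proof.
have -> : bot = (fun i => inl (inl i)) @: [set: 'I_p].
  apply/setP=> x; rewrite inE; apply/idP/imsetP => [|[i _ -> //]].
  by case: x => [[i|//]|//] _; exists i.
by rewrite card_imset ?cardsT ?card_ord // => i j [].
Qed.

Lemma card_mid : #|mid| = r.
Proof.
have -> : mid = (fun i => inl (inr i)) @: [set: 'I_r].
  apply/setP=> x; rewrite inE; apply/idP/imsetP => [|[i _ -> //]].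
  by case: x => [[//|i]|//] _; exists i.
by rewrite card_imset ?cardsT ?card_ord // => i j [].
Qed.

Lemma card_top : #|top| = q.
Proof.
have -> : top = (fun i => inr i) @: [set: 'I_q].
  apply/setP=> x; rewrite inE; apply/idP/imsetP => [|[i _ -> //]].
  by case: x => [//|i] _; exists i.
by rewrite card_imset ?cardsT ?card_ord // => i j [].
Qed.

Lemma below_top : below (bot :|: mid) top.
Proof. by move=> x y; rewrite !inE pos_ltE; case: x y => [[]|] ? [[]|] ?. Qed.

Lemma mins_top : mins top = top.
Proof.
apply: mins_antichain => x y; rewrite !inE pos_ltE.
by case: x y => [[]|] ? [[]|] ?.
Qed.

Lemma maxs_bot : maxs bot = bot.
Proof.
apply: maxs_antichain => x y; rewrite !inE pos_ltE.
by case: x y => [[]|] ? [[]|] ?.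
Qed.

Lemma disjoint_bot_mid (T : {set three_levels}) : T \subset mid -> bot :&: T = set0.
Proof.
move/subsetP=> Tm; apply/setP=> x; rewrite in_set0 in_setI; apply/negbTE/negP.
by move=> /andP[xb /Tm]; move: xb; rewrite !inE; case: x => [[]|].
Qed.

Lemma maxs_incomparable (T : {set three_levels}) :
  s = 0 -> T \subset mid -> maxs (bot :|: T) = bot :|: T.
Proof.
move=> s0 /subsetP Tm; apply: maxs_antichain => x y; rewrite pos_ltE !in_setU.
case/orP=> [|/Tm]; rewrite inE; case: x => [[i|i]|i] // _; last first.
  by case: y => [[]|] // j; rewrite inE => /Tm; rewrite inE.
by case: y => [[]|] // j; rewrite ?inE /= ?s0 // => /Tm; rewrite inE.
Qed.

End ThreeLevels.

Lemma card_maxs_fork r q (T : {set three_levels 2 r q 1}) :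
  T \subset mid 2 r q 1 -> T != set0 -> #|maxs (bot 2 r q 1 :|: T)| = #|T|.+1.
Proof.
move=> /subsetP Tm /set0Pn[t tT].
pose a0 : three_levels 2 r q 1 := inl (inl ord0).
pose a1 : three_levels 2 r q 1 := inl (inl (lift ord0 ord0)).
rewrite (_ : maxs _ = a1 |: T); first rewrite cardsU1.
  by rewrite (_ : a1 \notin T) //; apply/negP => /Tm; rewrite inE.
apply/setP=> x; rewrite in_setU1 [LHS]inE in_setU; apply/andP/orP.
  case=> /orP[xb|xT] /forall_inP xM; last by right.
  move: xb; rewrite inE; case: x xM => [[i|//]|//] xM _; left.
  have := xM t; rewrite in_setU tT orbT pos_ltE => /(_ isT).
  have := Tm _ tT; rewrite inE; case: (t) => [[//|j]|//] _ /=.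
  rewrite ltnS leqn0 => i0; apply/eqP; congr (inl (inl _)); apply: val_inj => /=.
  by case: i i0 {xM} => -[|[]].
case=> [/eqP ->|xT].
  rewrite inE; split=> //; apply/forall_inP => y.
  rewrite in_setU pos_ltE inE => /orP[|/Tm]; first by case: y => [[]|].
  by rewrite inE; case: y => [[]|].
rewrite xT orbT; split=> //; apply/forall_inP => y.
have := Tm _ xT; rewrite in_setU pos_ltE !inE.
case: x {xT} => [[//|j]|//] _ /orP[|/Tm]; first by case: y => [[]|].
by rewrite inE; case: y => [[]|].
Qed.

Lemma disjointsU1 (T : finType) (a : T) (A C : {set T}) :
  [disjoint a |: A & C] = (a \notin C) && [disjoint A & C].
Proof. by rewrite -setI_eq0 setIUl setU_eq0 !setI_eq0 disjoints1. Qed.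

Section Stabilisation.
Variables (k : idomainType) (f : forall P : poset, pr P -> k).
Variable g : nat -> nat -> k.
Hypothesis f_supp : cut_supported f.
Hypothesis f_count : counted_by f g.
Hypothesis f_fubini : fubini f g.

Section Configuration.
Variables p r q s : nat.
Hypothesis p2 : (2 <= p)%N.
Hypothesis s1 : (s <= 1)%N.
Local Notation P := (three_levels p r q s).
Local Notation D := (bot p r q s).
Local Notation B := (mid p r q s).
Local Notation U := (top p r q s).

Lemma below_botU (T : {set P}) : T \subset B -> below (D :|: T) U.
Proof.
move=> /subsetP TB x y /setUP xD; apply: below_top; rewrite in_setU.
by case: xD => [->|/TB ->]; rewrite ?orbT.
Qed.

Lemma sum_bot (T : {set P}) : T \subset B ->
  \sum_(x | btw D U x && (T \subset lox x)) wt f x = g #|maxs (D :|: T)| q.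
Proof.
move=> TB; have -> : g #|maxs (D :|: T)| q = g #|maxs (D :|: T)| #|mins U|.
  by rewrite mins_top card_top.
rewrite -f_count; last exact: below_botU.
by apply: eq_bigl => x; rewrite /btw subUset andbAC.
Qed.

(** This is the identity for [D] inside [D :|: B] with [U' = U]. A point [x] above [D] cannot lie
    below a middle point, so the maximal elements of [D :|: B] + x are [x] and the middle points not
    below it. On the right, [y] lies below all of [U] and is the only minimal element of [U] + y. *)
Lemma three_fubini :
  \sum_(x | btw D U x) wt f x * g #|B :\: lox x|.+1 q
  = g #|maxs (D :|: B)| q * g p 1.
Proof.
have DU : below D U.
  by have := below_botU (sub0set B); rewrite setU0.
have := f_fubini (subsetUl D B) (subxx U) DU (below_botU (subxx B)).
rewrite mins_top card_top maxs_bot card_bot => F.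
transitivity (\sum_(x | btw D U x) wt f x * g (nmaxs (D :|: B) x) q).
  apply: eq_bigr => x Dx.
  have [xP|xN] := boolP (valid_pt x); last by rewrite wt_cut ?mul0r.
  have {}Dx : {subset D <= lox x} by case/andP: Dx => /subsetP.
  congr (_ * g _ _); rewrite /nmaxs; case: exists_inP => [[d dD xd]|_].
    have bD i : inl (inl i) \in D by rewrite inE.
    move/setUP: dD => [dD|]; first by have := lepx_lox xP xd; rewrite Dx.
    (* The bottom point of index 1 would lie below the middle point [d], but only indices smaller
       than [s <= 1] do. *)
    pose i1 : 'I_p := Ordinal p2.
    have ltd : ((inl (inl i1) : P) < d)%O.
      case: x xP xd Dx => [y _ yd|[A C] /is_cutP[lt _ _] dC] Dx.
        by apply: lt_le_trans yd; have := Dx _ (bD i1); rewrite inE.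
      exact: lt (Dx _ (bD i1)) dC.
    rewrite inE; case: d ltd {xd} => [[//|j]|//]; rewrite pos_ltE /=.
    by move/leq_trans/(_ s1).
  congr #|pred_of_set _|.+1; apply/setP=> b; rewrite !in_setD.
  case: (boolP (b \in lox x)) => //= bx.
  apply/idP/idP => [bB|]; last first.
    by case/maxs_sub/setUP => // /Dx bD; rewrite bD in bx.
  rewrite inE in_setU bB orbT; apply/forall_inP => y.
  move: bB; rewrite in_setU !inE pos_ltE.
  by case: b {bx} => [[]|] // ? _; case: y => [[]|].
rewrite F (eq_bigr (fun y => wt f y * g p 1)) => [|y /andP[Dy Uy]].
  by rewrite -mulr_suml f_count ?mins_top ?card_top //; exact: below_botU.
have [yP|yN] := boolP (valid_pt y); last by rewrite wt_cut ?mul0r.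
congr (_ * g _ _); rewrite /nmins mins_top (_ : U :\: _ = set0); last first.
  by apply/eqP; rewrite setD_eq0.
rewrite cards0; case: exists_inP => // -[u uU uy].
have := subsetP Uy u uU; case: y yP uy {Uy Dy} => [y|c] cP /= uy.
  by rewrite inE le_gtF.
by move=> uc; have := cut_lt (c := Sub c cP) uy uc; rewrite ltxx.
Qed.

End Configuration.

(** Take one middle point, incomparable to the bottom. Of the total weight [g p q], the part
    [g p.+1 q] lies above it and gets the factor [g 1 q], the rest gets [g 2 q]. *)
Lemma stable_step p q : (2 <= p)%N ->
  g p q * g 2 q = g p.+1 q * (g p 1 + g 2 q - g 1 q).
Proof.
move=> p2; have := @three_fubini p 1 q 0 p2 isT.
set D := bot _ _ _ _; set B := mid _ _ _ _; set U := top _ _ _ _.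
rewrite (@maxs_incomparable _ _ _ 0) // cardsU disjoint_bot_mid // cards0 subn0.
rewrite card_bot card_mid addn1.
have S0 : \sum_(x | btw D U x) wt f x = g p q.
  transitivity (g #|maxs (D :|: set0)| q); last by rewrite setU0 maxs_bot card_bot.
  by rewrite -(@sum_bot p 1 q 0 _ (sub0set _)); apply: eq_bigl => x;
    rewrite sub0set andbT.
have S1 : \sum_(x | btw D U x && (B \subset lox x)) wt f x = g p.+1 q.
  rewrite sum_bot // (@maxs_incomparable _ _ _ 0) // cardsU disjoint_bot_mid //.
  by rewrite cards0 subn0 card_bot card_mid addn1.
rewrite (eq_bigr (fun x => wt f x * g 2 q +
    (if B \subset lox x then wt f x * (g 1 q - g 2 q) else 0))); last first.
  move=> x _; case: (boolP (B \subset lox x)) => [|Bx].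
    by rewrite -setD_eq0 => /eqP ->; rewrite cards0 -mulrDr addrC subrK.
  have -> : #|B :\: lox x| = 1%N.
    apply/eqP; rewrite eqn_leq card_gt0 setD_eq0 Bx andbT.
    exact: leq_trans (subset_leq_card (subsetDl _ _)) (eq_leq (card_mid p 1 q 0)).
  by rewrite addr0.
rewrite big_split /= -big_mkcondr -!mulr_suml S0 S1 => E.
by rewrite mulrBr mulrDr -E; ring.
Qed.

Lemma fork_fubini r q : (0 < r)%N ->
  let D := bot 2 r q 1 in let U := top 2 r q 1 in let B := mid 2 r q 1 in
  [/\ \sum_(x | btw D U x) wt f x * g #|B :\: lox x|.+1 q
       = g r.+1 q * g 2 1,
      \sum_(x | btw D U x) wt f x = g 2 q &
      forall T : {set three_levels 2 r q 1}, T \subset B -> T != set0 ->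
      \sum_(x | btw D U x && (T \subset lox x)) wt f x = g #|T|.+1 q].
Proof.
move=> r0 D U B; split.
- rewrite (@three_fubini 2 r q 1) // card_maxs_fork ?card_mid //.
  by rewrite -card_gt0 card_mid.
- transitivity (g #|maxs (D :|: set0)| q); last by rewrite setU0 maxs_bot card_bot.
  by rewrite -(@sum_bot 2 r q 1 _ (sub0set _)); apply: eq_bigl => x;
    rewrite sub0set andbT.
- by move=> T TB T0; rewrite sum_bot // card_maxs_fork.
Qed.

(** Take one middle point above exactly one of two bottom points. Both the total weight and the
    weight above the middle point are [g 2 q], so only the factor [g 1 q] survives. *)
Lemma stable_eq2 q : g 2 q * (g 1 q - g 2 1) = 0.
Proof.
have [] := @fork_fubini 1 q isT.
set D := bot _ _ _ _; set B := mid _ _ _ _; set U := top _ _ _ _ => F S0 S.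
have S1 := S B (subxx B); rewrite -card_gt0 card_mid in S1.
have {}S1 := S1 isT.
rewrite (eq_bigr (fun x => wt f x * g 2 q +
    (if B \subset lox x then wt f x * (g 1 q - g 2 q) else 0))) in F; last first.
  move=> x _; case: (boolP (B \subset lox x)) => [|Bx].
    by rewrite -setD_eq0 => /eqP ->; rewrite cards0 -mulrDr addrC subrK.
  have -> : #|B :\: lox x| = 1%N.
    apply/eqP; rewrite eqn_leq card_gt0 setD_eq0 Bx andbT.
    exact: leq_trans (subset_leq_card (subsetDl _ _)) (eq_leq (card_mid 2 1 q 1)).
  by rewrite addr0.
move: F; rewrite big_split /= -big_mkcondr -!mulr_suml S0 S1 => E.
by rewrite mulrBr -E; ring.
Qed.

(** By the vanishing assumption only two kinds of [x] contribute: those above all [r] middle points,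
    with factor [g 1 q], and those above none, with factor [g r.+1 q]. The total weight of the
    latter is computed by inclusion-exclusion. *)
Lemma first_nonzero r q : (2 <= r)%N ->
  (forall j, (2 <= j <= r)%N -> g j q = 0) ->
  g r.+1 q * ((-1) ^+ r * g r.+1 q + g 1 q - g 2 1) = 0.
Proof.
move=> r2 g0; have [] := @fork_fubini r q (ltnW r2).
set D := bot _ _ _ _; set B := mid _ _ _ _; set U := top _ _ _ _ => F S0 S.
have cB : #|B| = r := card_mid 2 r q 1.
have B0 : B != set0 by rewrite -card_gt0 cB ltnW.
(* A proper nonempty [T] gives [g #|T|.+1 q] with index between 2 and [r], and the empty one gives
   [g 2 q]; all of these are zero. *)
have Sall (T : {set three_levels 2 r q 1}) : T \subset B ->
    \sum_(x | btw D U x && (T \subset lox x)) wt f x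
    = if T == B then g r.+1 q else 0.
  move=> TB; have [->|T0] := eqVneq T set0.
    rewrite (eq_bigl (btw D U)) => [|x]; last by rewrite sub0set andbT.
    by rewrite S0 g0 ?r2 // eq_sym (negbTE B0).
  rewrite S //; case: eqVneq => [->|TNB]; first by rewrite cB.
  have : (#|T| < #|B|)%N by rewrite proper_card // properEneq TNB.
  by rewrite cB => Tr; apply: g0; rewrite ltnS card_gt0 T0.
have Sdisj n (A T : {set three_levels 2 r q 1}) :
    #|A| = n -> [disjoint A & T] -> A :|: T \subset B ->
    \sum_(x | btw D U x && (T \subset lox x) && [disjoint A & lox x]) wt f x
    = if A :|: T == B then (-1) ^+ n * g r.+1 q else 0.
  (* Inclusion-exclusion over the elements of A. *)
  elim: n A T => [|n IHn] A T.
    move/cards0_eq => -> _; rewrite set0U mul1r => /Sall <-.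
    by apply: eq_bigl => x; rewrite -setI_eq0 set0I eqxx andbT.
  move=> cA; have /set0Pn[a aA] : A != set0 by rewrite -card_gt0 cA.
  have cA' : #|A :\ a| = n by move: cA; rewrite (cardsD1 a) aA => -[].
  move=> AT ATB; have aT : a \notin T by rewrite (disjointFr AT aA).
  have AT' : [disjoint A :\ a & T].
    by apply: disjointWl AT; exact: subsetDl.
  have aAT : (A :\ a) :|: (a |: T) = A :|: T.
    by rewrite setUA [_ :|: [set a]]setUC setD1K.
  have := IHn (A :\ a) T cA' AT' (subset_trans (setSU _ (subsetDl _ _)) ATB).
  rewrite [_ == B](_ : _ = false); last first.
    apply/negbTE/eqP => /setP/(_ a); rewrite in_setU in_setD1 eqxx (negbTE aT).
    by move/esym; rewrite (subsetP ATB) // in_setU aA.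
  rewrite (bigID (fun x => a \in lox x)) /=.
  have := IHn (A :\ a) (a |: T) cA'; rewrite aAT => /(_ _ ATB) IHa.
  rewrite (eq_bigl (fun x => btw D U x && (a |: T \subset lox x)
      && [disjoint A :\ a & lox x])); last first.
    move=> x; rewrite subUset sub1set.
    by case: (a \in lox x); rewrite ?andbT ?andbF.
  rewrite IHa; last first.
    by rewrite disjoint_sym disjointsU1 in_setD1 eqxx /= disjoint_sym.
  move/eqP; rewrite addrC addr_eq0 => /eqP E.
  rewrite -[RHS]opprK.
  have -> : - (if A :|: T == B then (-1) ^+ n.+1 * g r.+1 q else 0)
          = if A :|: T == B then (-1) ^+ n * g r.+1 q else 0.
    by case: ifP => _; rewrite ?oppr0 // exprS mulN1r mulNr opprK.
  rewrite -E; apply: eq_bigl => x; rewrite -!andbA; congr [&& _, _ & _].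
  have -> : [disjoint A & lox x] = [disjoint a |: (A :\ a) & lox x].
    by rewrite setD1K.
  by rewrite disjointsU1; case: (_ \subset _) => //=; exact: andbC.
have Bset0 : [disjoint B & set0 : {set three_levels 2 r q 1}].
  by rewrite -setI_eq0 setI0.
have := Sdisj r B set0 cB Bset0; rewrite setU0 subxx eqxx => /(_ isT) E0.
have {}E0 : \sum_(x | btw D U x && [disjoint B & lox x]) wt f x
          = (-1) ^+ r * g r.+1 q.
  by rewrite -E0; apply: eq_bigl => x; rewrite sub0set andbT.
move: F.
rewrite (eq_bigr (fun x => (if B \subset lox x then wt f x * g 1 q else 0) +
    (if [disjoint B & lox x] then wt f x * g r.+1 q else 0))); last first.
  move=> x _; case: (boolP (B \subset lox x)) => [|Bx].
    move=> Bx; rewrite [X in _ + if X then _ else _](_ : _ = false).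
      by move: Bx; rewrite -setD_eq0 => /eqP ->; rewrite cards0 addr0.
    apply/negbTE; apply: contra B0 => dis.
    by rewrite -(setIidPl Bx) setI_eq0.
  rewrite add0r; case: (boolP [disjoint _ & _]) => [/setDidPl ->|dis].
    by rewrite cB.
  have : (#|B :\: lox x| < #|B|)%N.
    by rewrite proper_card // properE subsetDl subsetD subxx.
  by rewrite cB => Br; rewrite g0 ?mulr0 // ltnS card_gt0 setD_eq0 Bx.
rewrite big_split /= -!big_mkcondr -!mulr_suml E0 Sall // eqxx => E.
by rewrite mulrBr -E; ring.
Qed.

(** At the first possible nonzero entry, [stable_step] forces [g 1 q = g 2 1], and then
    [first_nonzero] makes its square zero. The hypothesis on column 1 is conditional so that the
    case [q = 1], where it is trivial, can be settled before the other columns. *)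
Lemma zero_column q :
  (forall r, (2 <= r)%N -> (forall j, (2 <= j <= r)%N -> g j q = 0) ->
     g r 1 = g 2 1) ->
  g 2 q = 0 -> forall p, (2 <= p)%N -> g p q = 0.
Proof.
move=> col1 V2 p; have [n] := ubnP p; elim: n p => // n IHn [|p] // pn.
rewrite ltnS leq_eqVlt => /orP[/eqP <- //|p2].
have V0 j : (2 <= j <= p)%N -> g j q = 0.
  by case/andP=> j2 jp; apply: IHn => //; exact: leq_ltn_trans jp pn.
have := stable_step q p2; rewrite V0 ?p2 ?leqnn // mul0r V2 addr0 col1 //.
move/esym/eqP; rewrite mulf_eq0 => /orP[/eqP //|]; rewrite subr_eq0 => /eqP V1.
have /eqP := first_nonzero p2 V0; rewrite V1 addrK mulf_eq0.
by case/orP=> /eqP // /eqP; rewrite mulf_eq0 signr_eq0 => /eqP.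
Qed.

Lemma stable_column1 p : (2 <= p)%N -> g p 1 = g 2 1.
Proof.
have [V2|V2] := eqVneq (g 2 1) 0.
  move=> p2; rewrite V2 zero_column // => r r2 V0.
  by rewrite !V0 ?r2 ?leqnn.
have V1 : g 1 1 = g 2 1.
  by have /eqP := stable_eq2 1; rewrite mulf_eq0 (negbTE V2) subr_eq0 => /eqP.
elim: p => // p IHp; rewrite ltnS leq_eqVlt => /orP[/eqP <- //|p2].
have := stable_step 1 p2; rewrite V1 addrK IHp // => /(mulIf V2).
by move=> ->.
Qed.

(** If [g 2 q] is nonzero, [stable_eq2] gives [g 1 q = g 2 1], and [stable_step] reduces to
    [g p q * g 2 q = g p.+1 q * g 2 q], where [g 2 q] cancels. *)
Lemma stable_column p q : (2 <= p)%N -> g p q = g 2 q.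
Proof.
have [V2|V2] := eqVneq (g 2 q) 0.
  move=> p2; rewrite V2 zero_column // => r r2 _; exact: stable_column1.
have V1 : g 1 q = g 2 1.
  by have /eqP := stable_eq2 q; rewrite mulf_eq0 (negbTE V2) subr_eq0 => /eqP.
elim: p => // p IHp; rewrite ltnS leq_eqVlt => /orP[/eqP <- //|p2].
have := stable_step q p2; rewrite V1 stable_column1 // addrAC subrr add0r IHp //.
by move/(mulIf V2) => <-.
Qed.

End Stabilisation.

(** Stability in the second argument is [stable_column] for the opposite weights. *)
Lemma fubini_truncated (k : idomainType) (f : forall P : poset, pr P -> k)
    (g : nat -> nat -> k) :
  cut_supported f -> counted_by f g -> fubini f g ->
  forall p q, g p q = g (minn p 2) (minn q 2).
Proof.
move=> fS fC fF p q.
have col p' q' : g p' q' = g (minn p' 2) q'.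
  rewrite minnC /minn; case: ltnP => // p2.
  exact (stable_column fS fC fF _ (ltnW p2)).
rewrite [LHS]col; rewrite [in RHS]minnC [in RHS](minnC q) [minn 2 q]/minn.
case: ltnP => [q2|_]; last by rewrite minnC.
rewrite minnC.
exact (stable_column (fop_supp fS) (fop_counted fC) (fop_fubini fF) _ (ltnW q2)).
Qed.

(** * Quadratic equations *)

(* p and p' are the truncated numbers of maximal elements of D and of D', which
   contains D; n tells that D' has a greatest element and that it is not in D. *)
Definition step_ok (p p' : nat) (n : bool) : bool :=
  [&& p <= 2, p' <= 2 & if n then p' == 1 else (p == p') || (p' == 2)]%N.

(** The closed forms of the two sides when [D'] lies below [U]. When it does not, they agree for
    every truncated [g], so no further equation arises. *)
Definition quad_eqs (k : comPzRingType) (g : nat -> nat -> k) :=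
  forall p p' n q' q m, step_ok p p' n -> step_ok q' q m ->
  g 2 q' * g p q + g p' q * (g 1 q' - g 2 q')
    + (if n then (g p 1 + 1) * (g 1 q' - g 2 q') else 0)
  = g p 2 * g p' q' + g p' q * (g p 1 - g p 2)
    + (if m then (g 1 q' + 1) * (g p 1 - g p 2) else 0).

Section RestrictiveIso.
Variables (k : comPzRingType) (f : forall P : poset, pr P -> k).

Lemma restrictive_iso (P Q : poset) (h : embedding P Q) (c : pr P) :
  restrictive f -> bijective h -> f c = f (h @: c.1, h @: c.2).
Proof.
move=> fR hB; rewrite (fR _ _ h c) (_ : [set _ | _] = set0) ?cards0 ?add0r.
  rewrite (big_pred1 (h @: c.1, h @: c.2)) // => -[D U] /=.
  case: hB => h' hK h'K; have hI := can_inj hK.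
  rewrite [c]surjective_pairing; apply/eqP/eqP => [[<- <-]|[-> ->]] /=.
    congr pair; apply/setP => y; rewrite -(h'K y) mem_imset // inE //.
  by congr pair; apply/setP => y; rewrite inE mem_imset.
apply/setP=> y; rewrite !inE; apply/negbTE; rewrite negb_and negbK.
by case: hB => h' hK h'K; rewrite -(h'K y) codom_f.
Qed.

(** The structure of [op (op P)] is built differently from that of [P], although the orders agree,
    so the equality goes through invariance under isomorphism. *)
Lemma restrictive_opop (P : poset) (c : pr P) :
  restrictive f -> f (c : pr (op (op P))) = f c.
Proof.
move=> fR; have hM : {mono (id : P -> op (op P)) : x y / (x <= y)%O} by [].
have hB : bijective (mkemb hM) by exists id => x; rewrite mkembE.
rewrite (restrictive_iso c fR hB); congr f; case: c => D U.
have E (A : {set P}) : mkemb hM @: A = A.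
  by rewrite -[RHS]imset_id; apply: eq_imset => x; rewrite mkembE.
by rewrite /= !E.
Qed.

End RestrictiveIso.

Section TruncatedFubini.
Variables (k : comPzRingType) (f : forall P : poset, pr P -> k).
Variable g : nat -> nat -> k.
Hypothesis f_supp : cut_supported f.
Hypothesis f_count : counted_by f g.
Hypothesis g_min : forall p q, g p q = g (minn p 2) (minn q 2).
Hypothesis f_opop : forall (P : poset) (c : pr P), f (c : pr (op (op P))) = f c.

Section Sides.
Variables (P : poset) (D D' U U' : {set P}).
Hypothesis sD : D \subset D'.
Hypothesis sU : U' \subset U.
Hypothesis DU : below D U.
Hypothesis DU' : below D' U'.
Let p := #|maxs D|.
Let p' := #|maxs D'|.
Let q := #|mins U|.
Let q' := #|mins U'|.

Definition new_least := (#|mins U| == 1)%N && ~~ (mins U \subset U').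

(** This is [truncated_sum] for the opposite weights on [op P], with [U'], [U] in the roles of [D],
    [D']; [f_opop] removes the double opposite that appears. *)
Lemma truncated_sum_dual :
  \sum_(y | btw D' U' y) wt f y * g p (nmins U y)
  = g p 2 * g p' q'
    + (if belowb D' U then g p' q * (g p 1 - g p 2) else 0)
    + (if new_least then
         (if belowb D' U then g 1 q' + 1 else
          if crossing D' U then g p' q' else g 2 q') * (g p 1 - g p 2)
       else 0).
Proof.
have gop_min a b : gop g a b = gop g (minn a 2) (minn b 2) by exact: g_min.
have := @truncated_sum k (fop f) (gop g) (fop_supp f_supp)
  (fop_counted f_count) gop_min (op P) U' U D' D sU (below_op DU').
rewrite /= !maxs_op !mins_op /gop -/p -/p' -/q -/q'.
have -> : new_greatest (P := op P) U' U = new_least.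
  by rewrite /new_greatest /new_least maxs_op.
have -> : @belowb (op P) U D' = belowb D' U.
  apply/belowP/belowP => h x y xX yY; first by have := h y x yY xX; rewrite op_ltE.
  by rewrite op_ltE; exact: h.
have -> : @crossing (op P) U D' = crossing D' U.
  apply/exists_inP/exists_inP => [[u uU /exists_inP[d dD]]|[d dD /exists_inP[u uU]]].
    by rewrite op_leE => ud; exists d => //; apply/exists_inP; exists u.
  by move=> ud; exists u => //; apply/exists_inP; exists d; rewrite ?op_leE.
move=> <-; rewrite [RHS](reindex (@swapx P)); last exact/onW_bij/swapx_bij.
apply: eq_big => x; first by rewrite btw_swapx.
rewrite nmaxs_swapx => _; congr (_ * _).
by case: x => //= c; rewrite /fop -surjective_pairing f_opop.
Qed.

End Sides.

(** A greatest element of [D'] that lies in [D] is greatest in [D] too, so both counts are 1; and an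
    empty [D'] makes [D] empty. *)
Lemma step_new_greatest (P : poset) (D D' : {set P}) : D \subset D' ->
  step_ok (minn #|maxs D| 2) (minn #|maxs D'| 2) (new_greatest D D').
Proof.
move=> sD; rewrite /step_ok !geq_minr /= /new_greatest.
case: ifP => [/andP[/eqP -> _] //|].
have [/cards1P[d mD] /= /negbFE|p'N1 _] := boolP (#|maxs D'| == 1)%N.
  rewrite mD sub1set => dD; rewrite cards1.
  have ltd e : e \in D' -> (e <= d)%O.
    by case/maxs_above => m; rewrite mD => /set1P ->.
  rewrite (maxs_greatest dD) ?cards1 // => e eD; apply: ltd.
  exact: subsetP sD _ eD.
have [p'2|] := leqP 2 #|maxs D'|; first by rewrite eqxx orbT.
rewrite ltnS leq_eqVlt (negbTE p'N1) ltnS leqn0 => /eqP p0.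
have D'0 : D' = set0.
  apply/setP=> x; rewrite in_set0; apply/negP => /maxs_above[m].
  by rewrite (cards0_eq p0) inE.
have D0 : D = set0 by apply/eqP; rewrite -subset0 -D'0.
by rewrite D0 -D'0 p0.
Qed.

Lemma step_new_least (P : poset) (U U' : {set P}) : U' \subset U ->
  step_ok (minn #|mins U'| 2) (minn #|mins U| 2) (new_least U U').
Proof.
move=> sU; have := @step_new_greatest (op P) U' U sU.
by rewrite !maxs_op /new_greatest maxs_op.
Qed.

(** [D'] is nonempty, and a greatest element in [D] would put all of [D'] below [U]. *)
Lemma not_below_greatest (P : poset) (D D' U : {set P}) : below D U ->
  ~~ belowb D' U -> if new_greatest D D' then #|maxs D'| = 1 else (2 <= #|maxs D'|)%N.
Proof.
move=> DU; rewrite /new_greatest; case: ifP => [/andP[/eqP] //|].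
have [/cards1P[d mD] /= /negbFE|p'N1 _] := boolP (#|maxs D'| == 1)%N.
  rewrite mD sub1set => dD /belowP[] e u /maxs_above[m].
  by rewrite mD => /set1P -> ed uU; exact: le_lt_trans ed (DU d u dD uU).
rewrite ltnNge leq_eqVlt (negbTE p'N1) ltnS leqn0 cards_eq0.
apply: contraNN => /eqP p0; apply/belowP => e u /maxs_above[m].
by rewrite p0 inE.
Qed.

Lemma not_below_least (P : poset) (D' U U' : {set P}) : below D' U' ->
  ~~ belowb D' U -> if new_least U U' then #|mins U| = 1 else (2 <= #|mins U|)%N.
Proof.
move=> DU' DU; have := @not_below_greatest (op P) U' U D' (below_op DU').
rewrite /new_greatest maxs_op; apply; apply: contra DU => /belowP h.
by apply/belowP => d u dD uU; have := h u d uU dD; rewrite op_ltE.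
Qed.

(** If [D'] is not below [U], then [D'] has a new greatest element or at least two maximal ones, and
    dually for [U]; in each of the four cases the closed forms agree identically. *)
Lemma quad_fubini : quad_eqs g -> fubini f g.
Proof.
move=> gQ P D D' U U' sD sU DU DU'.
rewrite (truncated_sum f_supp f_count g_min U' sD DU).
rewrite (truncated_sum_dual D sU DU').
have := gQ _ _ _ _ _ _ (@step_new_greatest P D D' sD) (@step_new_least P U U' sU).
have gl a b : g (minn a 2) b = g a b.
  by rewrite [LHS]g_min [RHS]g_min -minnA minnn.
have gr a b : g a (minn b 2) = g a b.
  by rewrite [LHS]g_min [RHS]g_min -minnA minnn.
rewrite !(gl, gr); have [bDU|nDU] := boolP (belowb D' U) => //= _.
have := not_below_greatest DU nDU; have := not_below_least DU' nDU.
case: ifP => _ hq; case: ifP => _ hp; rewrite ?hp ?hq.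
- by case: ifP => _; ring.
- by rewrite !(g_ge2l g_min _ hp) if_same; ring.
- by rewrite !(g_ge2r g_min _ hq) if_same; ring.
- by rewrite !(g_ge2l g_min _ hp) !(g_ge2r g_min _ hq) !addr0 mulrC.
Qed.

End TruncatedFubini.

(** * A poset that realises every equation *)

Section SixPoints.

Definition level (i : 'I_6) : nat := nth 0%N [:: 0; 0; 1; 2; 3; 3]%N i.
Definition level_lt : rel 'I_6 := fun i j => (level i < level j)%N.

Lemma level_irr : irreflexive level_lt.
Proof. by move=> i; rewrite /level_lt ltnn. Qed.

Lemma level_trans : transitive level_lt.
Proof. by move=> j i l; exact: ltn_trans. Qed.

(* 0, 1 < 2 < 3 < 4, 5 *)
Definition six : poset := pos_of (Sorel level_irr level_trans).

(** Up to two minimal points, together with the point 2 if [n] holds, which is then a greatest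
    element; [high] is the dual, with the point 3. *)
Definition low (p : nat) (n : bool) : {set six} :=
  [set x : six | (x < p)%N || n && (x == 2 :> nat)].
Definition high (q : nat) (m : bool) : {set six} :=
  [set x : six | (4 <= x < 4 + q)%N || m && (x == 3 :> nat)].

Lemma six_ltE (x y : six) : (x < y)%O = (level x < level y)%N.
Proof. exact: pos_ltE. Qed.

Lemma maxs_low p : (p <= 2)%N -> maxs (low p false) = low p false.
Proof.
move=> p2; apply: maxs_antichain => x y; rewrite !inE !orbF six_ltE => xp yp.
have {xp} := leq_trans xp p2; have {yp} := leq_trans yp p2.
by case: x => -[|[|]] //= ?; case: y => -[|[|]].
Qed.

Lemma maxs_low_new p : (p <= 2)%N -> maxs (low p true) = [set inord 2].
Proof.
move=> p2; apply: maxs_greatest; first by rewrite inE inordK ?orbT.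
move=> x; rewrite inE le_eqVlt six_ltE => /orP[xp|/= /eqP x2].
  have {xp} := leq_trans xp p2; rewrite /level inordK //.
  by case: x => -[|[|]] //= ? _; rewrite orbT.
by apply/orP; left; apply/eqP/val_inj; rewrite /= inordK.
Qed.

Lemma mins_high q : (q <= 2)%N -> mins (high q false) = high q false.
Proof.
move=> q2; apply: mins_antichain => x y; rewrite !inE !orbF six_ltE.
move=> /andP[+ _] /andP[+ _].
by case: x => -[|[|[|[|[|[|]]]]]] //= ?; case: y => -[|[|[|[|[|[|]]]]]].
Qed.

Lemma mins_high_new q : (q <= 2)%N -> mins (high q true) = [set inord 3].
Proof.
move=> q2; apply: mins_least; first by rewrite inE inordK ?orbT.
move=> x; rewrite inE le_eqVlt six_ltE => /orP[/andP[+ _]|/= /eqP x2].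
  rewrite /level inordK //.
  by case: x => -[|[|[|[|[|[|]]]]]] //= ? _; rewrite orbT.
by apply/orP; left; apply/eqP/val_inj; rewrite /= inordK.
Qed.

Lemma card_low p : (p <= 2)%N -> #|low p false| = p.
Proof.
move=> p2; rewrite -sum1_card big_mkcond !big_ord_recl big_ord0 !inE /=.
by case: p p2 => [|[|[|]]].
Qed.

Lemma card_high q : (q <= 2)%N -> #|high q false| = q.
Proof.
move=> q2; rewrite -sum1_card big_mkcond !big_ord_recl big_ord0 !inE /=.
by case: q q2 => [|[|[|]]].
Qed.

Lemma below_low_high p n q m : (p <= 2)%N -> below (low p n) (high q m).
Proof.
move=> p2 x y; rewrite !inE six_ltE => xl yh.
have x2 : (x <= 2)%N.
  by case/orP: xl => [xp|/andP[_ /eqP -> //]]; exact: ltnW (leq_trans xp p2).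
have y3 : (3 <= y)%N.
  by case/orP: yh => [/andP[y4 _]|/andP[_ /eqP -> //]]; exact: ltnW y4.
move: x2 y3; case: x {xl} => -[|[|[|]]] //= ? _;
by case: y {yh} => -[|[|[|[|[|[|]]]]]].
Qed.

(** Every two admissible steps occur in [six] with [D'] below [U], so the identity there is exactly
    the required equation. *)
Lemma fubini_quad (k : comPzRingType) (f : forall P : poset, pr P -> k)
    (g : nat -> nat -> k) :
  cut_supported f -> counted_by f g ->
  (forall p q, g p q = g (minn p 2) (minn q 2)) ->
  (forall (P : poset) (c : pr P), f (op (op P)) c = f P c) ->
  fubini f g -> quad_eqs g.
Proof.
move=> fS fC gM fO fF p p' n q' q m /and3P[p2 p'2 pp'] /and3P[q'2 q2 qq'].
pose D := low p false; pose D' := if n then low p true else low p' false.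
pose U' := high q' false; pose U := if m then high q' true else high q false.
have sD : D \subset D'.
  rewrite /D /D'; case: (n) pp' => [_|/orP[]/eqP -> //].
    by apply/subsetP => x; rewrite !inE orbF => ->.
  by apply/subsetP => x; rewrite !inE !orbF => xp; exact: leq_trans xp p2.
have sU : U' \subset U.
  rewrite /U /U'; case: (m) qq' => [_|/orP[]/eqP -> //].
    by apply/subsetP => x; rewrite !inE orbF => ->.
  apply/subsetP => x; rewrite !inE !orbF => /andP[-> xq].
  by apply: leq_trans xq _; rewrite leq_add2l.
have [cD cD'] : #|maxs D| = p /\ #|maxs D'| = p'.
  rewrite /D /D' maxs_low // card_low //; case: (n) pp' => [/eqP ->|_].
    by rewrite maxs_low_new // cards1.
  by rewrite maxs_low // card_low.
have [cU cU'] : #|mins U| = q /\ #|mins U'| = q'.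
  rewrite /U /U' mins_high // card_high //; case: (m) qq' => [/eqP ->|_].
    by rewrite mins_high_new // cards1.
  by rewrite mins_high // card_high.
have DU' : below D' U'.
  by rewrite /D' /U'; case: (n); exact: below_low_high.
have DU : below D U.
  by rewrite /D /U; case: (m); exact: below_low_high.
have bDU : belowb D' U.
  by apply/belowP; rewrite /D' /U; case: (n); case: (m); exact: below_low_high.
have ng : new_greatest D D' = n.
  rewrite /new_greatest cD' /D /D'; case: (n) pp' => [/eqP ->|pp'].
    by rewrite maxs_low_new // sub1set inE inordK //= orbF -leqNgt.
  rewrite maxs_low //; case/orP: pp' => /eqP -> //.
  by rewrite subxx andbF.
have nl : new_least U U' = m.
  rewrite /new_least cU /U /U'; case: (m) qq' => [/eqP ->|qq'].
    by rewrite mins_high_new // sub1set inE inordK //= orbF.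
  rewrite mins_high //; case/orP: qq' => /eqP -> //.
  by rewrite subxx andbF.
have := fF _ _ _ _ _ sD sU DU DU'.
rewrite (truncated_sum fS fC gM U' sD DU).
rewrite (truncated_sum_dual fS fC gM fO D sU DU').
by rewrite bDU ng nl cD cD' cU cU'.
Qed.

End SixPoints.

(** * Classification of the solutions *)

Definition mxfun (k : pzRingType) (N : 'M[k]_3) (p q : nat) : k :=
  N (inord (minn p 2)) (inord (minn q 2)).

Definition listed_or_tr (k : pzRingType) (N : 'M[k]_3) :=
  exists L : 'M[k]_3, listed_mx L /\ (N = L \/ N = L^T).

Lemma mxfun_mx3 (k : pzRingType) (rows : seq (seq k)) p q :
  mxfun (mx3 rows) p q = nth 0 (nth [::] rows (minn p 2)) (minn q 2).
Proof. by rewrite /mxfun /mx3 mxE !inordK // ltnS geq_minr. Qed.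

Lemma mxfun_tr (k : pzRingType) (N : 'M[k]_3) p q :
  mxfun N^T p q = mxfun N q p.
Proof. by rewrite /mxfun mxE. Qed.

Lemma mxfun_min (k : pzRingType) (N : 'M[k]_3) p q :
  mxfun N p q = mxfun N (minn p 2) (minn q 2).
Proof. by rewrite /mxfun -!minnA minnn. Qed.

Lemma mx3_tr (k : pzRingType) (a b c d e f h i j : k) :
  (mx3 [:: [:: a; b; c]; [:: d; e; f]; [:: h; i; j]])^T
  = mx3 [:: [:: a; d; h]; [:: b; e; i]; [:: c; f; j]].
Proof.
by apply/matrixP => -[[|[|[|x]]] //= ?] [[|[|[|y]]] //= ?]; rewrite !mxE.
Qed.

Variant step_spec : nat -> nat -> bool -> Prop :=
| Step00 : step_spec 0 0 false
| Step11 : step_spec 1 1 false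
| Step22 : step_spec 2 2 false
| Step02 : step_spec 0 2 false
| Step12 : step_spec 1 2 false
| Step01n : step_spec 0 1 true
| Step11n : step_spec 1 1 true
| Step21n : step_spec 2 1 true.

Lemma stepP p p' n : step_ok p p' n -> step_spec p p' n.
Proof. by case: p p' n => [|[|[|p]]] [|[|[|p']]] [] //; constructor. Qed.

Section Classification.
Variable k : fieldType.
Implicit Types (x y w : k) (N : 'M[k]_3).

(** Reduces each consequence [w = 0] of an instance [x = y] of the system to an identity [w = x - y]
    for [ring]. *)
Lemma eq_sub_eq0 x y w : x = y -> w = x - y -> w = 0.
Proof. by move=> -> ->; rewrite subrr. Qed.

Lemma quad_eqs_tr (g : nat -> nat -> k) : quad_eqs g -> quad_eqs (gop g).
Proof. by move=> gQ p p' n q' q m pn qm; rewrite /gop; apply/esym/gQ. Qed.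

Lemma listed_quad N : listed_mx N -> quad_eqs (mxfun N).
Proof.
move=> NL p p' n q' q m /stepP pn /stepP qm.
by case: NL => *; case: pn; case: qm; rewrite !mxfun_mx3 /=; ring.
Qed.

Definition ent (a b c d e f h i j : k) (p q : nat) : k :=
  nth 0 (nth [::] [:: [:: a; b; c]; [:: d; e; f]; [:: h; i; j]] p) q.

Section Solve.
Variables a b c d e f h i j : k.
Hypothesis gQ : quad_eqs (ent a b c d e f h i j).

(** For steps that change nothing the equation is [g p q * (g 1 q - g p 1) = 0]; the six lemmas
    [entry_eq] are its instances. *)
Lemma entry_eq00 : a * (d - b) = 0.
Proof.
by apply: (eq_sub_eq0 (@gQ 0 0 false 0 0 false isT isT));
  rewrite /ent /=; ring.
Qed.

Lemma entry_eq01 : b * (e - b) = 0.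
Proof.
by apply: (eq_sub_eq0 (@gQ 0 0 false 1 1 false isT isT));
  rewrite /ent /=; ring.
Qed.

Lemma entry_eq10 : d * (e - d) = 0.
Proof.
by apply: (eq_sub_eq0 (esym (@gQ 1 1 false 0 0 false isT isT)));
  rewrite /ent /=; ring.
Qed.

Lemma entry_eq12 : f * (e - f) = 0.
Proof.
by apply: (eq_sub_eq0 (esym (@gQ 1 1 false 2 2 false isT isT)));
  rewrite /ent /=; ring.
Qed.

Lemma entry_eq21 : i * (e - i) = 0.
Proof.
by apply: (eq_sub_eq0 (@gQ 2 2 false 1 1 false isT isT));
  rewrite /ent /=; ring.
Qed.

Lemma entry_eq22 : j * (f - i) = 0.
Proof.
by apply: (eq_sub_eq0 (@gQ 2 2 false 2 2 false isT isT));
  rewrite /ent /=; ring.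
Qed.

(** A new greatest element with [p = 1] gives [g 1 q * (g 1 q + 1) = (e + 1) * g 2 q], and the step
    from 1 to 2 gives [g 2 q * (2 * g 1 q - e - g 2 q) = 0]. The row equations are the
    transposes. *)
Lemma col_new0 : d * (d + 1) - (e + 1) * h = 0.
Proof.
by apply: (eq_sub_eq0 (@gQ 1 1 true 0 0 false isT isT));
  rewrite /ent /=; ring.
Qed.

Lemma col_old0 : h * (2 * d - e - h) = 0.
Proof.
by apply: (eq_sub_eq0 (@gQ 1 2 false 0 0 false isT isT));
  rewrite /ent /=; ring.
Qed.

Lemma col_new1 : e * (e + 1) - (e + 1) * i = 0.
Proof.
by apply: (eq_sub_eq0 (@gQ 1 1 true 1 1 false isT isT));
  rewrite /ent /=; ring.
Qed.

Lemma col_new2 : f * (f + 1) - (e + 1) * j = 0.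
Proof.
by apply: (eq_sub_eq0 (@gQ 1 1 true 2 2 false isT isT));
  rewrite /ent /=; ring.
Qed.

Lemma col_old2 : j * (2 * f - e - j) = 0.
Proof.
by apply: (eq_sub_eq0 (@gQ 1 2 false 2 2 false isT isT));
  rewrite /ent /=; ring.
Qed.

Lemma row_new0 : (e + 1) * c - b * (b + 1) = 0.
Proof.
by apply: (eq_sub_eq0 (@gQ 0 0 false 1 1 true isT isT));
  rewrite /ent /=; ring.
Qed.

Lemma row_old0 : c * (2 * b - e - c) = 0.
Proof.
by apply: (eq_sub_eq0 (esym (@gQ 0 0 false 1 2 false isT isT)));
  rewrite /ent /=; ring.
Qed.

Lemma row_new1 : (e + 1) * f - e * (e + 1) = 0.
Proof.
by apply: (eq_sub_eq0 (@gQ 1 1 false 1 1 true isT isT));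
  rewrite /ent /=; ring.
Qed.

End Solve.

Lemma eq_mulf u x y w : u != 0 -> w = 0 -> w = u * (x - y) -> x = y.
Proof.
by move=> u0 -> /esym/eqP; rewrite mulf_eq0 (negbTE u0) subr_eq0 => /eqP.
Qed.

Lemma two_values x v : x * (v - x) = 0 -> x = 0 \/ x = v.
Proof.
move/eqP; rewrite mulf_eq0 subr_eq0.
by case/orP=> /eqP ->; [left | right].
Qed.

Lemma eq_sub1 x y : x = y -> x - y = 1 -> False.
Proof. by move=> ->; rewrite subrr => /esym/eqP; rewrite oner_eq0. Qed.

Lemma eq_subN1 x y : x = y -> x - y = -1 -> False.
Proof. by move=> ->; rewrite subrr => /esym/eqP; rewrite oppr_eq0 oner_eq0. Qed.

Lemma eq_subl a v x y : x = y -> x - y = a - v -> a = v.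
Proof. by move=> ->; rewrite subrr => /esym/eqP; rewrite subr_eq0 => /eqP. Qed.

Lemma eq_subr a v x y : x = y -> x - y = v - a -> a = v.
Proof. by move=> ->; rewrite subrr => /esym/eqP; rewrite subr_eq0 => /eqP. Qed.

(** Used with middle entry -1 only, hence the value -1 for the parameters of the families in which
    that entry is free. *)
Ltac listed a :=
  first
  [ by exists (mxA (-1) a); split; [constructor | left]
  | by exists (mxA (-1) a); split; [constructor | right; rewrite mx3_tr]
  | by exists (mxB1 (-1)); split; [constructor | left]
  | by exists (mxB1 (-1)); split; [constructor | right; rewrite mx3_tr]
  | by exists (mxB2 (-1)); split; [constructor | left]
  | by exists (mxB2 (-1)); split; [constructor | right; rewrite mx3_tr]
  | by exists (mxB3 a); split; [constructor | left]
  | by exists (mxB3 a); split; [constructor | right; rewrite mx3_tr]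
  | by exists (mxB4 a); split; [constructor | left]
  | by exists (mxB4 a); split; [constructor | right; rewrite mx3_tr]
  | by exists (mxB5 a); split; [constructor | left]
  | by exists (mxB5 a); split; [constructor | right; rewrite mx3_tr]
  | by exists (mxC1 k); split; [constructor | left]
  | by exists (mxC1 k); split; [constructor | right; rewrite mx3_tr]
  | by exists (mxC2 k); split; [constructor | left]
  | by exists (mxC2 k); split; [constructor | right; rewrite mx3_tr]
  | by exists (mxC3 k); split; [constructor | left]
  | by exists (mxC3 k); split; [constructor | right; rewrite mx3_tr]
  | by exists (mxC4 k); split; [constructor | left]
  | by exists (mxC4 k); split; [constructor | right; rewrite mx3_tr]
  | by exists (mxC5 k); split; [constructor | left]
  | by exists (mxC5 k); split; [constructor | right; rewrite mx3_tr]
  | by exists (mxC6 k); split; [constructor | left]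
  | by exists (mxC6 k); split; [constructor | right; rewrite mx3_tr]
  | by exists (mxC7 k); split; [constructor | left]
  | by exists (mxC7 k); split; [constructor | right; rewrite mx3_tr]
  | by exists (mxC8 k); split; [constructor | left]
  | by exists (mxC8 k); split; [constructor | right; rewrite mx3_tr] ].

Ltac absurd_eq gQ :=
  exfalso; first
  [ apply: (eq_sub1 (@gQ 1 2 false 0 1 true isT isT));
    rewrite /ent /=; ring
  | apply: (eq_subN1 (@gQ 1 2 false 0 1 true isT isT));
    rewrite /ent /=; ring
  | apply: (eq_sub1 (@gQ 0 1 true 0 2 false isT isT));
    rewrite /ent /=; ring
  | apply: (eq_subN1 (@gQ 0 1 true 0 2 false isT isT));
    rewrite /ent /=; ring
  | apply: (eq_sub1 (@gQ 1 2 false 2 1 true isT isT));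
    rewrite /ent /=; ring
  | apply: (eq_subN1 (@gQ 1 2 false 2 1 true isT isT));
    rewrite /ent /=; ring
  | apply: (eq_sub1 (@gQ 2 2 false 0 0 false isT isT));
    rewrite /ent /=; ring
  | apply: (eq_subN1 (@gQ 2 2 false 0 0 false isT isT));
    rewrite /ent /=; ring
  | apply: (eq_sub1 (@gQ 0 0 false 2 2 false isT isT));
    rewrite /ent /=; ring
  | apply: (eq_subN1 (@gQ 0 0 false 2 2 false isT isT));
    rewrite /ent /=; ring ].

Ltac value_eq gQ :=
  first
  [ apply: (eq_subl (@gQ 0 0 false 0 0 false isT isT));
    rewrite /ent /=; ring
  | apply: (eq_subr (@gQ 0 0 false 0 0 false isT isT));
    rewrite /ent /=; ring
  | apply: (eq_subl (@gQ 0 0 false 0 2 false isT isT));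
    rewrite /ent /=; ring
  | apply: (eq_subr (@gQ 0 0 false 0 2 false isT isT));
    rewrite /ent /=; ring
  | apply: (eq_subl (@gQ 0 2 false 0 0 false isT isT));
    rewrite /ent /=; ring
  | apply: (eq_subr (@gQ 0 2 false 0 0 false isT isT));
    rewrite /ent /=; ring ].

(** A leaf ends in a contradiction, or in an equation that fixes [a] at 0, 1 or -1, or with [a] as a
    free parameter. *)
Ltac leaf a gQ :=
  first
  [ match goal with
    | fi : 0 = -1 |- _ => by case: (eq_sub1 fi); ring
    | fi : -1 = 0 |- _ => by case: (eq_subN1 fi); ring
    end
  | absurd_eq gQ
  | (have ? : a = 0 by value_eq gQ); subst a; listed (0 : k)
  | (have ? : a = 1 by value_eq gQ); subst a; listed (1 : k)
  | (have ? : a = -1 by value_eq gQ); subst a; listed (-1 : k)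
  | listed a ].

(** The middle entry [e] decides. If [e + 1] is nonzero, it can be cancelled and the last row and
    column repeat the middle ones. If [e = -1], every entry but [a] has finitely many candidates.
    Each contradiction reads 1 = 0 up to sign, so the characteristic does not matter. *)
Lemma quad_listed (a b c d e f h i j : k) :
  quad_eqs (ent a b c d e f h i j) ->
  listed_or_tr (mx3 [:: [:: a; b; c]; [:: d; e; f]; [:: h; i; j]]).
Proof.
move=> gQ; have bE := two_values (entry_eq01 gQ); have dE := two_values (entry_eq10 gQ).
have [e1|e1] := eqVneq (e + 1) 0; last first.
  have iE : e = i by apply: eq_mulf e1 (col_new1 gQ) _; ring.
  have fE : f = e by apply: eq_mulf e1 (row_new1 gQ) _; ring.
  subst f i; have jE : e = j by apply: eq_mulf e1 (col_new2 gQ) _; ring.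
  subst j; have hE : d = h.
    by case: dE => ?; subst d; apply: eq_mulf e1 (col_new0 gQ) _; ring.
  have cE : c = b.
    by case: bE => ?; subst b; apply: eq_mulf e1 (row_new0 gQ) _; ring.
  subst c h; case: bE dE => [->|->] [->|->] in gQ *.
  - by exists (mxA e a); split; [constructor | left].
  - have := entry_eq00 gQ; rewrite subr0 => /eqP; rewrite mulf_eq0.
    case/orP=> /eqP zE; last subst e;
      last by exists (mxA 0 a); split; [constructor | left].
    by subst a; exists (mxB2 e); split; [constructor | right; rewrite mx3_tr].
  - have := entry_eq00 gQ; rewrite sub0r mulrN => /eqP; rewrite oppr_eq0 mulf_eq0.
    case/orP=> /eqP zE; last subst e;
      last by exists (mxA 0 a); split; [constructor | left].
    by subst a; exists (mxB2 e); split; [constructor | left].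
  have /eqP : e * (a - e) = 0.
    by apply: (eq_sub_eq0 (@gQ 0 1 true 0 0 false isT isT)); rewrite /ent /=; ring.
  rewrite mulf_eq0 subr_eq0 => /orP[] /eqP zE.
    by subst e; exists (mxA 0 a); split; [constructor | left].
  by subst a; exists (mxB1 e); split; [constructor | left].
have {e1} eE : e = -1 by apply/eqP; rewrite -addr_eq0 e1.
have fE := two_values (entry_eq12 gQ); have iE := two_values (entry_eq21 gQ).
have cE := two_values (row_old0 gQ); have hE := two_values (col_old0 gQ).
have jE : (f = i /\ (j = 0 \/ j = 2 * f - e)) \/ j = 0.
  have [fi|fi] := eqVneq f i.
    by left; split=> //; exact: two_values (col_old2 gQ).
  right; have /eqP := entry_eq22 gQ.
  by rewrite mulf_eq0 subr_eq0 (negbTE fi) orbF => /eqP.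
have two0 : 2 * 0 - -1 = 1 :> k by ring.
(* At [e = -1] the second candidates [2 * b - e], [2 * d - e] and [2 * f - e] for [c], [h] and [j]
   are 1 or -1. *)
have two1 : 2 * -1 - -1 = -1 :> k by ring.
subst e; case: bE dE fE iE => [?|?] [?|?] [?|?] [?|?]; subst b d f i;
  rewrite ?two0 ?two1 in cE hE jE;
  case: cE hE => [?|?] [?|?]; subst c h;
  case: jE => [[fi [?|?]]|?]; subst j; leaf a gQ.
Qed.

Lemma quad_eqs_eq (g g' : nat -> nat -> k) :
  (forall p q, (p <= 2)%N -> (q <= 2)%N -> g p q = g' p q) ->
  quad_eqs g -> quad_eqs g'.
Proof.
move=> gg' gQ p p' n q' q m pn qm; have := gQ _ _ _ _ _ _ pn qm.
case/and3P: pn => p2 p'2 _; case/and3P: qm => q'2 q2 _.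
by rewrite !gg'.
Qed.

Lemma quad_eqsP N : quad_eqs (mxfun N) <-> listed_or_tr N.
Proof.
split=> [gQ|[L [LL [->|->]]]]; last 2 first.
- exact: listed_quad.
- apply: (quad_eqs_eq _ (quad_eqs_tr (listed_quad LL))) => p q _ _.
  by rewrite mxfun_tr.
have -> : N = mx3 [:: [:: mxfun N 0 0; mxfun N 0 1; mxfun N 0 2];
                      [:: mxfun N 1 0; mxfun N 1 1; mxfun N 1 2];
                      [:: mxfun N 2 0; mxfun N 2 1; mxfun N 2 2] ].
  apply/matrixP => -[[|[|[|x]]] //= ?] [[|[|[|y]]] //= ?]; rewrite !mxE /mxfun;
  by congr (N _ _); apply: val_inj; rewrite /= inordK.
apply/quad_listed/quad_eqs_eq; last exact: gQ.
by case=> [|[|[|p]]] [|[|[|q]]].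
Qed.

End Classification.

(** * Moebius inversion *)

Section Moebius.
Variables (k : comPzRingType) (P : poset).
Implicit Types (c : pr P) (h phi : pr P -> k).

Definition cle c c' := (c.1 \subset c'.1) && (c.2 \subset c'.2).
Definition crank c := (#|c.1| + #|c.2|)%N.

Lemma cle_refl c : cle c c.
Proof. by rewrite /cle !subxx. Qed.

Lemma cle_rank c c' : cle c c' -> c' != c -> (crank c < crank c')%N.
Proof.
case: c c' => [D U] [D' U'] /andP[/= sD sU] c'c.
have cD := subset_leq_card sD; have cU := subset_leq_card sU.
rewrite ltn_neqAle leq_add // andbT; apply: contra c'c => /eqP.
rewrite /crank /= => E; apply/eqP; congr pair; apply/eqP;
  rewrite eq_sym eqEcard ?sD ?sU /= leqNgt; apply/negP => lt.
  by have := leq_add lt cU; rewrite addSn E ltnn.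
by have := leq_add cD lt; rewrite addnS E ltnn.
Qed.

Lemma crank_max c : (crank c <= 2 * #|P|)%N.
Proof. by rewrite mul2n -addnn leq_add // max_card. Qed.

(** Downward induction on [crank]: the sum over the pairs above [c] is the value at [c] plus values
    of larger rank. *)
Lemma moebius_uniq phi psi :
  (forall c, \sum_(c' | cle c c') phi c' = \sum_(c' | cle c c') psi c') ->
  phi =1 psi.
Proof.
move=> E c; have [n] := ubnP (2 * #|P| - crank c)%N.
elim: n c => // n IHn c; rewrite ltnS => cn; have := E c.
rewrite (bigD1 c) ?cle_refl //= [in RHS](bigD1 c) ?cle_refl //=.
rewrite (eq_bigr psi) => [/addIr //|c' /andP[cc' c'c]]; apply: IHn.
apply: leq_trans cn; rewrite ltn_sub2l ?cle_rank //.
exact: leq_trans (cle_rank cc' c'c) (crank_max c').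
Qed.

(** [n] is fuel for the downward recursion; ranks are at most [2 * #|P|], so [(2 * #|P|).+1]
    suffices by [mob_stable]. Outside the cuts the value is 0, which is why [moebius_sum] prescribes
    the sums at cuts only. *)
Fixpoint mob h n c : k :=
  if n is n'.+1 then
    if is_cut c then h c - \sum_(c' | cle c c' && (c' != c)) mob h n' c' else 0
  else 0.

Lemma mob_stable h n c : (2 * #|P| - crank c < n)%N ->
  mob h n.+1 c = mob h n c.
Proof.
elim: n c => // n IHn c; rewrite ltnS => cn.
rewrite [in LHS]/= -/(mob h n.+1) [in RHS]/=; case: ifP => // _.
congr (_ - _); apply: eq_bigr => c' /andP[cc' c'c]; apply: IHn.
apply: leq_trans cn; rewrite ltn_sub2l ?cle_rank //.
exact: leq_trans (cle_rank cc' c'c) (crank_max c').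
Qed.

Definition moebius h c := mob h (2 * #|P|).+1 c.

Lemma moebius_noncut h c : ~~ is_cut c -> moebius h c = 0.
Proof. by move=> cN; rewrite /moebius /= (negbTE cN). Qed.

Lemma moebius_sum h c : is_cut c -> \sum_(c' | cle c c') moebius h c' = h c.
Proof.
move=> cP; rewrite (bigD1 c) ?cle_refl //= {1}/moebius /= cP.
rewrite [X in _ - X](eq_bigr (moebius h)) ?subrK // => c' /andP[cc' c'c].
rewrite /moebius mob_stable //.
have lt := cle_rank cc' c'c.
rewrite ltn_subLR ?crank_max // -[X in (X < _)%N]add0n ltn_add2r.
exact: leq_trans lt.
Qed.

End Moebius.

Section Closure.
Variables (P : poset) (D U : {set P}).

(** Closing [(D, U)] gives a cut with the same extremal elements and the same points between, so
    [fg_counted] can appeal to [moebius_sum]. *)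
Definition down := [set x | [exists d in D, (x <= d)%O]].
Definition upc := [set x | [exists u in U, (u <= x)%O]].

Lemma sub_down : D \subset down.
Proof.
by apply/subsetP => d dD; rewrite inE; apply/exists_inP; exists d; rewrite ?lexx.
Qed.

Lemma sub_upc : U \subset upc.
Proof.
by apply/subsetP => d dD; rewrite inE; apply/exists_inP; exists d; rewrite ?lexx.
Qed.

Lemma closure_cut : below D U -> is_cut (down, upc).
Proof.
move=> DU; apply/is_cutP; split=> [x y|x y|x y]; rewrite !inE.
- move=> /exists_inP[d dD xd] /exists_inP[u uU uy].
  exact: lt_le_trans (le_lt_trans xd (DU d u dD uU)) uy.
- move=> /exists_inP[d dD yd] xy; apply/exists_inP; exists d => //.
  exact: le_trans xy yd.
- move=> /exists_inP[d dD yd] xy; apply/exists_inP; exists d => //.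
  exact: le_trans yd xy.
Qed.

Lemma maxs_down : maxs down = maxs D.
Proof.
apply/setP=> x; apply/idP/idP => xm.
  have /[!inE]/exists_inP[d dD xd] := maxs_sub xm.
  have dd : d \in down by rewrite (subsetP sub_down).
  have xE : x = d.
    apply/eqP; move: xm; rewrite inE => /andP[_ /forall_inP/(_ d dd)].
    by rewrite lt_neqAle xd andbT negbK.
  rewrite {1}xE dD; apply/forall_inP => e eD.
  move: xm; rewrite inE => /andP[_ /forall_inP]; apply.
  by rewrite (subsetP sub_down).
have xD := maxs_sub xm; rewrite inE (subsetP sub_down) //=.
apply/forall_inP => e /[!inE]/exists_inP[d dD ed]; apply/negP => xe.
have xd := lt_le_trans xe ed.
by move: xm; rewrite inE => /andP[_ /forall_inP/(_ d dD)]; rewrite xd.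
Qed.

Lemma mins_upc : mins upc = mins U.
Proof.
apply/setP=> x; apply/idP/idP => xm.
  have /[!inE]/exists_inP[d dD xd] := mins_sub xm.
  have dd : d \in upc by rewrite (subsetP sub_upc).
  have xE : x = d.
    apply/eqP; move: xm; rewrite inE => /andP[_ /forall_inP/(_ d dd)].
    by rewrite lt_neqAle xd andbT negbK eq_sym.
  rewrite {1}xE dD; apply/forall_inP => e eD.
  move: xm; rewrite inE => /andP[_ /forall_inP]; apply.
  by rewrite (subsetP sub_upc).
have xD := mins_sub xm; rewrite inE (subsetP sub_upc) //=.
apply/forall_inP => e /[!inE]/exists_inP[d dD ed]; apply/negP => xe.
have xd := le_lt_trans ed xe.
by move: xm; rewrite inE => /andP[_ /forall_inP/(_ d dD)]; rewrite xd.
Qed.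

Lemma btw_closure (x : pts P) : valid_pt x -> btw down upc x = btw D U x.
Proof.
move=> xP; congr andb.
  apply/idP/idP => [|/subsetP Dx]; first exact: subset_trans sub_down.
  apply/subsetP => y /[!inE]/exists_inP[d dD yd].
  exact: lox_down xP (Dx d dD) yd.
apply/idP/idP => [|/subsetP Ux]; first exact: subset_trans sub_upc.
apply/subsetP => y /[!inE]/exists_inP[u uU uy]; have := Ux u uU.
case: x xP {Ux} => [z _|[A B] /is_cutP[_ _ upB]] /=.
  by rewrite !inE => zu; exact: lt_le_trans zu uy.
by move=> uB; exact: upB uB uy.
Qed.

End Closure.

Lemma natr_card (k : pzSemiRingType) (T : finType) (A : pred T) :
  #|[set y | A y]|%:R = \sum_(y | A y) 1 :> k.
Proof. by rewrite sumr_const cardsE. Qed.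

Section CountSums.
Variables (k : comPzRingType) (f : forall P : poset, pr P -> k).
Variable g : nat -> nat -> k.

Lemma cle_cut_below (P : poset) (c c' : pr P) :
  cle c c' -> is_cut c' -> below c.1 c.2.
Proof.
case: c c' => [D U] [D' U'] /andP[/= /subsetP sD /subsetP sU].
by case/is_cutP => lt _ _ d u dD uU; apply: lt; [exact: sD | exact: sU].
Qed.

(** The total weight that the new points between [c.1] and [c.2] must have, the old ones
    contributing 1 each. *)
Definition gaps (P : poset) (c : pr P) : k :=
  g #|maxs c.1| #|mins c.2| - #|[set y | btw c.1 c.2 (inl y)]|%:R.

Lemma wt_sum (P : poset) (D U : {set P}) :
  \sum_(x | btw D U x) wt f x
  = #|[set y | btw D U (inl y)]|%:R + \sum_(c' | cle (D, U) c') f c'.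
Proof.
rewrite big_sumType /=; congr (_ + _).
by rewrite sumr_const; congr (_ *+ _); apply: eq_card => y; rewrite inE.
Qed.

Lemma sum_cle (P : poset) (D U : {set P}) :
  cut_supported f -> counted_by f g -> below D U ->
  \sum_(c | cle (D, U) c) f c = gaps (D, U).
Proof.
by move=> fS fC DU; rewrite /gaps -(fC _ _ _ DU) wt_sum addrAC subrr add0r.
Qed.

Lemma sum_cle0 (P : poset) (D U : {set P}) :
  cut_supported f -> ~~ belowb D U -> \sum_(c | cle (D, U) c) f c = 0.
Proof.
move=> fS DUN; apply: big1 => c cc; apply: fS; apply: contra DUN => cP.
apply/belowP; exact: cle_cut_below cc cP.
Qed.

End CountSums.

(** * Restrictive weights with prescribed counts *)

Section FromCounts.
Variables (k : comPzRingType) (g : nat -> nat -> k).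

Definition fg (P : poset) (c : pr P) : k := moebius (@gaps k g P) c.

Lemma fg_supp : cut_supported fg.
Proof. by move=> P c; exact: moebius_noncut. Qed.

Lemma fg_counted : counted_by fg g.
Proof.
move=> P D U DU; rewrite -(maxs_down D) -(mins_upc U).
transitivity (\sum_(x | btw (down D) (upc U) x) wt fg x).
  rewrite big_mkcond [RHS]big_mkcond; apply: eq_bigr => x _.
  have [xP|xN] := boolP (valid_pt x); first by rewrite btw_closure.
  by rewrite (wt_cut fg_supp xN) !if_same.
by rewrite wt_sum moebius_sum ?closure_cut // addrC subrK.
Qed.

Lemma pre_cut (P P' : poset) (b : embedding P P') (c : pr P') :
  is_cut c -> is_cut (b @^-1: c.1, b @^-1: c.2).
Proof.
case: c => D U /= /is_cutP[h1 h2 h3]; apply/is_cutP; split.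
- by move=> d u; rewrite !inE => dD uU; rewrite -(emb_lt b) h1.
- by move=> x y; rewrite !inE => yD xy; apply: h2 yD _; rewrite emb_le.
- by move=> x y; rewrite !inE => yU xy; apply: h3 yU _; rewrite emb_le.
Qed.

(** Both sides have the same sums over the pairs above [c]. Passing to the images in [P'] keeps the
    numbers of extremal elements, and on both sides what is subtracted from the value of [g] is the
    number of points between that come from [P]. *)
Lemma fg_restrictive : restrictive fg.
Proof.
move=> P P' b c; pose tb y := (lo b y, up b y).
pose pre (c' : pr P') := (b @^-1: c'.1, b @^-1: c'.2).
pose psi c := #|[set y | (y \notin codom b) && (tb y == c)]|%:R
  + \sum_(c' : pr P' | pre c' == c) fg c'.
rewrite -/(psi c); move: c; apply: moebius_uniq => c.
have psiE : \sum_(c1 | cle c c1) psi c1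
    = #|[set y | (y \notin codom b) && cle c (tb y)]|%:R
      + \sum_(c' | cle c (pre c')) fg c'.
  rewrite big_split /= natr_card; congr (_ + _).
    rewrite [RHS](partition_big tb (cle c)) => [|y /andP[] //].
    apply: eq_bigr => c1 cc1; rewrite natr_card; apply: eq_bigl => y.
    by case: eqP => [->|]; rewrite ?andbF // cc1 !andbT.
  rewrite [RHS](partition_big pre (cle c)) //.
  apply: eq_bigr => c1 cc1; apply: eq_bigl => c'.
  by case: eqP => [->|]; rewrite ?andbF // cc1.
have preE c' : cle c (pre c') = cle (b @: c.1, b @: c.2) c'.
  by rewrite /cle /= !sub_imset_pre.
(* If [c.1] is not below [c.2], no cut contains [c], and all terms vanish. *)
rewrite {}psiE; have [/belowP cb|cNb] := boolP (belowb c.1 c.2); last first.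
  have nocut c' : cle c c' -> is_cut c' = false.
    move=> cc'; apply: contraNF cNb => c'P; apply/belowP.
    exact: cle_cut_below cc' c'P.
  rewrite [c in LHS]surjective_pairing sum_cle0 //; last exact: fg_supp.
  rewrite big1 => [|c' /nocut h]; last first.
    by apply: fg_supp; apply: contraFN h; exact: pre_cut.
  rewrite natr_card big_pred0 ?addr0 // => y; apply: contraFF (erefl false).
  by move=> /andP[_ /nocut]; rewrite lo_up_cut.
have cb' : below (b @: c.1) (b @: c.2).
  by move=> _ _ /imsetP[d dD ->] /imsetP[u uU ->]; rewrite emb_lt cb.
rewrite [c in LHS]surjective_pairing (sum_cle fg_supp fg_counted cb) (eq_bigl _ _ preE)
  (sum_cle fg_supp fg_counted cb').
rewrite /gaps /= maxs_imset mins_imset !card_imset; try exact: emb_inj.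
rewrite [RHS]addrCA; congr (_ + _); apply/eqP; rewrite eq_sym subr_eq addrC.
rewrite -subr_eq opprK !natr_card. apply/eqP.
rewrite addrC [RHS](bigID (fun y => y \in codom b)) /=.
have preLo y : b @^-1: [set z | (z < y)%O] = lo b y.
  by apply/setP => p; rewrite !inE.
have preUp y : b @^-1: [set z | (y < z)%O] = up b y.
  by apply/setP => p; rewrite !inE.
have btwE y : btw (b @: c.1) (b @: c.2) (inl y) = cle c (tb y).
  by rewrite /btw /cle /= !sub_imset_pre preLo preUp.
have btwI p : btw c.1 c.2 (inl p) = cle c (tb (b p)).
  rewrite /btw /cle /tb /= (_ : lo b (b p) = [set z | (z < p)%O]); last first.
    by apply/setP => q; rewrite !inE emb_lt.
  rewrite (_ : up b (b p) = [set z | (p < z)%O]) //.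
  by apply/setP => q; rewrite !inE emb_lt.
congr (_ + _); last by apply: eq_bigl => y; rewrite btwE andbC.
transitivity (\sum_(y in b @: [set p | btw c.1 c.2 (inl p)]) 1 : k).
  rewrite big_imset /=; last exact: in2W (@emb_inj _ _ b).
  by apply: eq_bigl => p; rewrite inE.
apply: eq_bigl => y; rewrite btwE.
apply/imsetP/andP => [[p /[!inE] pc ->]|[yc /codomP[p yE]]].
  by rewrite -btwI; split; last exact: codom_f.
by exists p => //; rewrite inE btwI -yE.
Qed.

End FromCounts.

(** * From the Fubini identity back to the exchange relations *)

Section Exchange.
Variables (k : comPzRingType) (f : forall P : poset, pr P -> k).
Variable g : nat -> nat -> k.
Hypothesis f_supp : cut_supported f.
Hypothesis f_count : counted_by f g.

Section Pairs.
Variable P : poset.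

Definition f_above (c c1 : pr P) : k := wt f (inr c) * w_above f (inr c) (inr c1).
Definition f_below (c c1 : pr P) : k := wt f (inr c1) * w_below f (inr c1) (inr c).

Lemma f_above_supp c c1 :
  ~~ [&& is_cut c, is_cut c1, c.1 \subset c1.1 & c1.2 \subset c.2] ->
  f_above c c1 = 0.
Proof.
rewrite /f_above /=; have [cP|cN] := boolP (is_cut c); last first.
  by rewrite (f_supp cN) mul0r.
rewrite insubT /= => h; rewrite (@f_supp _ (above_pt _ _)) ?mulr0 //.
by apply: contra h => /above_pt_cut_inv[/= -> -> ->].
Qed.

Lemma f_below_supp c c1 :
  ~~ [&& is_cut c, is_cut c1, c.1 \subset c1.1 & c1.2 \subset c.2] ->
  f_below c c1 = 0.
Proof.
rewrite /f_below /=; have [c1P|c1N] := boolP (is_cut c1); last first.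
  by rewrite (f_supp c1N) mul0r.
rewrite insubT /= => h; rewrite (@f_supp _ (below_pt _ _)) ?mulr0 //.
by apply: contra h => /below_pt_cut_inv[/= -> -> ->].
Qed.

Lemma w_old (x y : pts P) :
  (if x is inl _ then true else if y is inl _ then true else false) ->
  wt f x * w_above f x y = wt f y * w_below f y x.
Proof.
case: x y => [a|c] [z|c1] //= _; rewrite ?mul1r //;
by case: ifP => _; rewrite ?mulr1 ?mulr0.
Qed.

(** Pairs with an old member agree term by term by [w_old]; cancelling them in the identity leaves
    the pairs of new points. *)
Lemma sum_pairs (D D' U U' : {set P}) : fubini f g ->
  D \subset D' -> U' \subset U -> below D U -> below D' U' ->
  \sum_(c | cle (D, U) c) \sum_(c1 | cle (D', U') c1) f_above c c1
  = \sum_(c | cle (D, U) c) \sum_(c1 | cle (D', U') c1) f_below c c1.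
Proof.
move=> fF sD sU DU DU'.
have E : \sum_(x | btw D U x) \sum_(y | btw D' U' y) wt f x * w_above f x y
       = \sum_(x | btw D U x) \sum_(y | btw D' U' y) wt f y * w_below f y x.
  transitivity (\sum_(x | btw D U x) wt f x * g (nmaxs D' x) #|mins U'|).
    apply: eq_bigr => x /andP[_ Ux]; rewrite -mulr_sumr.
    have [xP|xN] := boolP (valid_pt x); last by rewrite (wt_cut f_supp xN) !mul0r.
    by rewrite (sum_above f_supp f_count xP DU') // (subset_trans sU).
  rewrite fF // [RHS]exchange_big /=; apply: eq_bigr => y /andP[Dy _].
  rewrite -mulr_sumr.
  have [yP|yN] := boolP (valid_pt y); last by rewrite (wt_cut f_supp yN) !mul0r.
  by rewrite (sum_below f_supp f_count yP DU) // (subset_trans sD).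
have split F : \sum_(x | btw D U x) \sum_(y | btw D' U' y) F x y
    = \sum_(a | btw D U (inl a)) \sum_(y | btw D' U' y) F (inl a) y
    + (\sum_(c | cle (D, U) c) \sum_(b | btw D' U' (inl b)) F (inr c) (inl b)
       + \sum_(c | cle (D, U) c) \sum_(c1 | cle (D', U') c1)
           F (inr c) (inr c1)) :> k.
  rewrite big_sumType /=; congr (_ + _); rewrite -big_split /=.
  by apply: eq_bigr => c _; rewrite big_sumType.
move: E; rewrite !split.
have -> : \sum_(a | btw D U (inl a)) \sum_(y | btw D' U' y)
    wt f (inl a) * w_above f (inl a) y
  = \sum_(a | btw D U (inl a)) \sum_(y | btw D' U' y)
    wt f y * w_below f y (inl a).
  by apply: eq_bigr => a _; apply: eq_bigr => y _; exact: w_old.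
move/addrI; have -> : \sum_(c | cle (D, U) c) \sum_(b | btw D' U' (inl b))
    wt f (inr c) * w_above f (inr c) (inl b)
  = \sum_(c | cle (D, U) c) \sum_(b | btw D' U' (inl b))
    wt f (inl b) * w_below f (inl b) (inr c).
  by apply: eq_bigr => c _; apply: eq_bigr => b _; exact: w_old.
exact: addrI.
Qed.

(** Moebius inversion in [c] and then in [c1] reduces the equality to double sums over all [(D, U)]
    and [(D', U')], nested or not. *)
Lemma f_above_below : fubini f g -> f_above =2 f_below.
Proof.
move=> fF c c1; move: c; apply: moebius_uniq => -[D U].
move: c1; pose S F (c1 : pr P) : k := \sum_(c | cle (D, U) c) F c c1.
apply: (@moebius_uniq _ _ (S f_above) (S f_below)) => -[D' U'].
rewrite /S exchange_big [RHS]exchange_big /=.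
pose v (c c1 : pr P) :=
  [&& is_cut c, is_cut c1, c.1 \subset c1.1 & c1.2 \subset c.2].
(* Nonzero terms have [c.1] inside [c1.1] and [c1.2] inside [c.2]. So [U] may absorb [U'] and [D']
   may absorb [D], which produces the nesting that [fubini] requires. *)
have enlarge F : (forall c c1, ~~ v c c1 -> F c c1 = 0) ->
    \sum_(c | cle (D, U) c) \sum_(c1 | cle (D', U') c1) F c c1
    = \sum_(c | cle (D, U :|: U') c) \sum_(c1 | cle (D :|: D', U') c1)
        F c c1 :> k.
  move=> F0; rewrite !pair_big /= big_mkcond [RHS]big_mkcond.
  apply: eq_bigr => -[c c1] _ /=.
  have [/and4P[_ _ s1 s2]|vN] := boolP (v c c1); last by rewrite F0 ?if_same.
  congr (if _ then _ else _); rewrite /cle /= !subUset.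
  apply/andP/andP => [[/andP[Dc Uc] /andP[Dc1 Uc1]]|].
    by rewrite Dc Uc Dc1 Uc1 (subset_trans Dc s1) (subset_trans Uc1 s2).
  by case=> /andP[-> /andP[-> _]] /andP[/andP[_ ->] ->].
rewrite !enlarge; [|exact: f_below_supp|exact: f_above_supp].
have [/belowP DU|DUN] := boolP (belowb D (U :|: U')); last first.
  have noc c : cle (D, U :|: U') c -> is_cut c = false.
    move=> cc; apply: contraNF DUN => cP; apply/belowP.
    exact: cle_cut_below cc cP.
  rewrite !big1 // => c /noc cN; apply: big1 => c1 _;
    by [apply: f_below_supp; rewrite cN | apply: f_above_supp; rewrite cN].
have [/belowP DU'|DUN'] := boolP (belowb (D :|: D') U'); last first.
  have noc c : cle (D :|: D', U') c -> is_cut c = false.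
    move=> cc; apply: contraNF DUN' => cP; apply/belowP.
    exact: cle_cut_below cc cP.
  rewrite !big1 // => c _; apply: big1 => c1 /noc cN;
    by [apply: f_below_supp; rewrite cN andbF | apply: f_above_supp; rewrite cN andbF].
by apply: sum_pairs => //; [exact: subsetUl | exact: subsetUr].
Qed.

End Pairs.

Lemma fubini_pts_exchange : fubini f g -> pts_exchange f.
Proof.
move=> fF P [a|c] [z|c1]; try exact: w_old.
exact: f_above_below.
Qed.

End Exchange.

(** * Construction of a measure *)

Definition subp (Q : poset) (S : {set Q}) : predArgType := {x : Q | x \in S}.

HB.instance Definition _ (Q : poset) (S : {set Q}) := Finite.on (subp S).
HB.instance Definition _ (Q : poset) (S : {set Q}) := SubChoice.on (subp S).
HB.instance Definition _ (Q : poset) (S : {set Q}) :=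
  [SubChoice_isSubPOrder of subp S by <: with poset_display].

Definition subp_emb (Q : poset) (S : {set Q}) : embedding (subp S) Q :=
  @mkemb (subp S) Q val (fun x y => erefl).

Lemma subp_embE (Q : poset) (S : {set Q}) x : subp_emb S x = val x.
Proof. exact: mkembE. Qed.

Lemma codom_subp (Q : poset) (S : {set Q}) : codom (subp_emb S) =i S.
Proof.
move=> y; apply/codomP/idP => [[x ->]|yS]; first by rewrite subp_embE (valP x).
by exists (Sub y yS); rewrite subp_embE.
Qed.

Lemma factor_emb_ex (P P' Q : poset) (a : embedding P Q) (a' : embedding P' Q) :
  {subset codom a <= codom a'} -> exists h : embedding P P', a = emb_comp a' h.
Proof.
move=> sub; have sub' p : a p \in codom a' by apply: sub; exact: codom_f.
have hE p : a' (iinv (sub' p)) = a p by rewrite f_iinv.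
have hM : {mono (fun p => iinv (sub' p)) : x y / (x <= y)%O}.
  by move=> x y; rewrite -(emb_le a') !hE emb_le.
by exists (mkemb hM); apply: embP => p; rewrite emb_compE mkembE hE.
Qed.

Section Positions.
Variables (k : comPzRingType) (f : forall P : poset, pr P -> k).
Hypothesis f_restr : restrictive f.

Definition pos_val (P Q : poset) (a : embedding P Q) (x : Q) : k :=
  f (lo a x, up a x).

Lemma pos_val_iso (P P' Q : poset) (a : embedding P Q) (h : embedding P' P) x :
  bijective h -> pos_val (emb_comp a h) x = pos_val a x.
Proof.
move=> hB; rewrite /pos_val (restrictive_iso _ f_restr hB).
case: hB => h' hK h'K; have hI := can_inj hK.
by congr f; congr pair; apply/setP => p; rewrite -(h'K p) mem_imset // !inE
  emb_compE.
Qed.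

(** Embeddings with the same image differ by an isomorphism of their sources. Hence the value of a
    point depends only on a subset of [Q], which justifies [rel_val]. *)
Lemma pos_val_codom (P P' Q : poset) (a : embedding P Q) (a' : embedding P' Q) x :
  codom a =i codom a' -> pos_val a x = pos_val a' x.
Proof.
move=> E; have [p pa|h aE] := @factor_emb_ex _ _ _ a a'; first by rewrite -E.
rewrite aE pos_val_iso //; apply: emb_surj_bij => p'.
have /codomP[p pE] : a' p' \in codom a by rewrite E codom_f.
by exists p; apply: (@emb_inj _ _ a'); rewrite pE aE emb_compE.
Qed.

Lemma pos_val_comp (P Q R : poset) (a : embedding P Q) (h : embedding Q R) x :
  pos_val (emb_comp h a) (h x) = pos_val a x.
Proof.
by congr f; congr pair; apply/setP => p; rewrite !inE emb_compE emb_lt.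
Qed.

Definition rel_val (Q : poset) (S : {set Q}) (x : Q) : k := pos_val (subp_emb S) x.

Lemma codom_imset (P Q : poset) (a : embedding P Q) : codom a =i a @: setT.
Proof.
move=> y; apply/codomP/imsetP => [[x ->]|[x _ ->]]; first by exists x.
by exists x.
Qed.

Lemma rel_val_emb (P Q : poset) (a : embedding P Q) x :
  rel_val (a @: setT) x = pos_val a x.
Proof.
by apply: pos_val_codom => y; rewrite codom_subp codom_imset.
Qed.

Lemma rel_val_imset (Q R : poset) (h : embedding Q R) (S : {set Q}) x :
  rel_val (h @: S) (h x) = rel_val S x.
Proof.
rewrite -[RHS](pos_val_comp _ h); apply: pos_val_codom => y.
rewrite codom_subp; apply/imsetP/codomP => [[z zS ->]|[[z zS] ->]].
  by exists (Sub z zS); rewrite emb_compE subp_embE.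
by exists z => //; rewrite emb_compE subp_embE.
Qed.

(** Restrictivity along P -> P + x: a point of cut [c1] is x itself, or is incomparable to x, above
    x or below x. *)
Lemma restr_ext (P : poset) (c c1 : cut P) : cut_supported f ->
  f (val c1) = (c == c1)%:R
    + f ((Some @: (val c1).1, Some @: (val c1).2) : pr (ext c))
    + f (above_pt c (val c1)) + f (below_pt c (val c1)).
Proof.
move=> fS; rewrite (f_restr (ext_emb c) (val c1)) -!addrA; congr (_ + _).
  rewrite natr_card.
  rewrite (eq_bigl (fun y : ext c => (y == None) && (c == c1))); last first.
    case=> [p|].
      have -> : (Some p : ext c) = ext_emb c p by rewrite ext_embE.
      by rewrite codom_f ext_embE.
    have -> : (None : ext c) \notin codom (ext_emb c).
      by apply/negP => /codomP[p]; rewrite ext_embE.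
    have -> : (lo (ext_emb c) None, up (ext_emb c) None) = val c.
      rewrite [RHS]surjective_pairing; congr pair; apply/setP => p.
        by rewrite inE ext_embE ext_ltSN.
      by rewrite inE ext_embE ext_ltNS.
    by [].
  rewrite big_mkcondr big_pred1_eq; by case: ifP.
pose withN (b : bool) (A : {set P}) : {set ext c} :=
  if b then None |: Some @: A else Some @: A.
have mem_withN b A : (None \in withN b A) = b.
  by case: b; rewrite /withN ?setU11 ?mem_None.
have mem_withS b A p : (Some p \in withN b A) = (p \in A).
  by case: b; rewrite /withN ?in_setU1 mem_Some.
pose h (b : bool * bool) : pr (ext c) := (withN b.1 (val c1).1, withN b.2 (val c1).2).
rewrite (reindex_onto h (fun c' => (None \in c'.1, None \in c'.2))) /=; last first.
  move=> [A B] /eqP cE.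
  rewrite /h (_ : val c1 = (ext_emb c @^-1: A, ext_emb c @^-1: B)) /=;
    last exact/esym/cE.
  congr pair; apply/setP => -[p|];
    by rewrite ?mem_withN // mem_withS inE ext_embE.
rewrite (eq_bigl xpredT) => [|[b1 b2]]; last first.
  rewrite /= !mem_withN eqxx andbT; apply/eqP.
  rewrite [RHS]surjective_pairing; congr pair; apply/setP => p;
  by rewrite inE ext_embE mem_withS.
rewrite -(pair_bigA _ (fun b1 b2 => f (h (b1, b2)))) /= !big_bool /= /h /withN /=.
rewrite (fS _ (_, _)) ?add0r; last first.
  by apply/negP => /is_cutP[/(_ None None)]; rewrite !setU11 ltxx => /(_ isT isT).
by rewrite addrA addrC.
Qed.

Hypothesis f_supp : cut_supported f.
Hypothesis f_exch : pts_exchange f.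

Lemma rel_val_ext (Q : poset) (S : {set Q}) (x y : Q)
    (h : embedding (ext (tp (subp_emb S) x)) Q) :
  x \notin S -> h None = x -> (forall p, h (Some p) = subp_emb S p) ->
  rel_val (x |: S) y = pos_val h y.
Proof.
move=> xS hN hS; apply: pos_val_codom => z; rewrite codom_subp in_setU1.
apply/orP/codomP => [[/eqP ->|zS]|[[p|] ->]].
- by exists None.
- by exists (Some (Sub z zS : subp S)); rewrite hS subp_embE.
- by right; rewrite hS subp_embE (valP p).
- by left; rewrite hN.
Qed.

Lemma exch_above (P : poset) (c c1 : cut P) :
  f (val c) * f (above_pt c (val c1)) = f (val c1) * f (below_pt c1 (val c)).
Proof. by have := f_exch (inr (val c)) (inr (val c1)); rewrite /= !valK. Qed.

(** For comparable points this is [exch_above]. For incomparable ones it follows from the comparable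
    case, by expanding the product of the two values over P over each of the two one-point
    extensions. *)
Lemma rel_val_exch (Q : poset) (S : {set Q}) (x y : Q) :
  x \notin S -> y \notin S -> x != y ->
  rel_val S x * rel_val (x |: S) y = rel_val S y * rel_val (y |: S) x.
Proof.
wlog yx : x y / (y < x)%O = false => [W|xS yS xy].
  case yx: (y < x)%O; last exact: W.
  by move=> xS yS xy; apply/esym/W => //; [rewrite lt_gtF | rewrite eq_sym].
set a := subp_emb S; set c := tp a x; set c1 := tp a y.
have [h [hN hS]] : {h : embedding (ext c) Q |
    h None = x /\ forall p, h (Some p) = a p}.
  by apply: ext_emb_ex => //; rewrite codom_subp.
have [h1 [h1N h1S]] : {h : embedding (ext c1) Q |
    h None = y /\ forall p, h (Some p) = a p}.
  by apply: ext_emb_ex => //; rewrite codom_subp.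
rewrite (rel_val_ext _ xS hN hS) (rel_val_ext _ yS h1N h1S).
rewrite -[rel_val S x]/(f (val c)) -[rel_val S y]/(f (val c1)).
case xyE: (x < y)%O.
  have -> : pos_val h y = f (above_pt c (val c1)).
    congr f; congr pair; apply/setP => -[p|]; rewrite inE ?hS ?hN.
    - by rewrite in_setU1 mem_Some inE.
    - by rewrite xyE setU11.
    - by rewrite mem_Some inE.
    - by rewrite mem_None lt_gtF.
  have -> : pos_val h1 x = f (below_pt c1 (val c)).
    congr f; congr pair; apply/setP => -[p|]; rewrite inE ?h1S ?h1N.
    - by rewrite mem_Some inE.
    - by rewrite mem_None lt_gtF.
    - by rewrite in_setU1 mem_Some inE.
    - by rewrite xyE setU11.
  exact: exch_above.
have -> : pos_val h y = f ((Some @: (val c1).1, Some @: (val c1).2) : pr (ext c)).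
  congr f; congr pair; apply/setP => -[p|]; rewrite inE ?hS ?hN.
  - by rewrite mem_Some inE.
  - by rewrite mem_None xyE.
  - by rewrite mem_Some inE.
  - by rewrite mem_None yx.
have -> : pos_val h1 x = f ((Some @: (val c).1, Some @: (val c).2) : pr (ext c1)).
  congr f; congr pair; apply/setP => -[p|]; rewrite inE ?h1S ?h1N.
  - by rewrite mem_Some inE.
  - by rewrite mem_None yx.
  - by rewrite mem_Some inE.
  - by rewrite mem_None xyE.
(* After expanding one factor on each side by [restr_ext], the diagonal terms agree and the
   comparable terms match by [exch_above]; cancelling leaves the terms of incomparable points. *)
have E : f (val c) * f (val c1) = f (val c1) * f (val c) by rewrite mulrC.
move: E; rewrite {1}(restr_ext c c1 f_supp) [in RHS](restr_ext c1 c f_supp).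
rewrite !mulrDr -[f (val c1) * f (below_pt c1 _)]exch_above.
rewrite [f (val c1) * f (above_pt c1 _)]exch_above -!addrA.
have -> : f (val c) * (c == c1)%:R = f (val c1) * (c1 == c)%:R.
  by rewrite eq_sym; case: eqP => [->|]; rewrite ?mulr0.
by move/addrI; rewrite [_ + f (val c) * _]addrC => /addIr.
Qed.

Fixpoint chain (Q : poset) (S : {set Q}) (l : seq Q) : k :=
  if l is x :: l' then rel_val S x * chain (x |: S) l' else 1.

Lemma chain_cat (Q : poset) (S : {set Q}) l1 l2 :
  chain S (l1 ++ l2) = chain S l1 * chain ([set x in l1] :|: S) l2.
Proof.
elim: l1 S => [|x l1 IHl] S /=; first by rewrite mul1r set_nil set0U.
rewrite IHl mulrA; congr (_ * chain _ _); apply/setP => y.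
by rewrite !inE orbCA orbA.
Qed.

Lemma chain_front (Q : poset) (S : {set Q}) x l1 l2 :
  uniq (x :: l1) -> x \notin S -> {in l1, forall y, y \notin S} ->
  chain S (l1 ++ x :: l2) = chain S (x :: l1 ++ l2).
Proof.
elim: l1 S => //= y l1 IHl S; rewrite inE negb_or -andbA => /and4P[xy xl yl ul] xS lS.
have yS : y \notin S by rewrite lS ?mem_head.
rewrite IHl /=; first last.
- move=> z zl; rewrite in_setU1 negb_or lS ?inE ?zl ?orbT // andbT.
  by apply: contraNneq yl => <-.
- by rewrite in_setU1 negb_or xy.
- by rewrite xl.
by rewrite !mulrA rel_val_exch // 1?eq_sym // setUCA.
Qed.

Lemma chain_perm (Q : poset) (S : {set Q}) l l' :
  uniq l -> {in l, forall y, y \notin S} -> perm_eq l l' ->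
  chain S l = chain S l'.
Proof.
elim: l S l' => [|x l IHl] S l' /=; first by move=> _ _ /perm_size/esym/size0nil ->.
case/andP=> xl ul lS pl.
have ul' : uniq l' by rewrite -(perm_uniq pl) /= xl.
have xl' : x \in l' by rewrite -(perm_mem pl) mem_head.
case/splitPr: xl' pl ul' => l1 l2 pl ul'.
have pl' : perm_eq l (l1 ++ l2).
  rewrite -(perm_cons x); apply: (perm_trans pl).
  by rewrite perm_catC /= perm_cons perm_catC.
rewrite chain_front.
- rewrite /= (IHl _ (l1 ++ l2)) // => y yl.
  rewrite in_setU1 negb_or lS ?inE ?yl ?orbT // andbT.
  by apply: contraNneq xl => <-.
- move: ul'; rewrite uniq_catC /= mem_cat negb_or cat_uniq.
  by case/and4P => /andP[_ ->] _ _ ->.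
- by rewrite lS ?mem_head.
- move=> y yl; apply: lS; rewrite (perm_mem pl) mem_cat yl //.
Qed.

Lemma chain_imset (Q R : poset) (h : embedding Q R) (S : {set Q}) l :
  chain (h @: S) [seq h x | x <- l] = chain S l.
Proof.
elim: l S => //= x l IHl S; rewrite rel_val_imset -IHl.
by rewrite imsetU1.
Qed.

(** The points outside the image are added one at a time, in the order of [enum]; by [chain_perm]
    the order is irrelevant. *)
Definition nuf (P Q : poset) (a : embedding P Q) : k :=
  chain (a @: setT) (enum (~: a @: setT)).

Lemma nuf_iso (P Q : poset) (a : embedding P Q) : bijective a -> nuf a = 1.
Proof.
case=> a' aK a'K; rewrite /nuf (_ : ~: _ = set0) ?enum_set0 //.
apply/setP => y; rewrite !inE; apply/negbTE; rewrite negbK.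
by rewrite -(a'K y) imset_f.
Qed.

Lemma nuf_comp (P Q R : poset) (b : embedding Q R) (a : embedding P Q) :
  nuf (emb_comp b a) = nuf b * nuf a.
Proof.
have imE : emb_comp b a @: setT = b @: (a @: setT).
  by rewrite -imset_comp; apply: eq_imset => x; rewrite emb_compE.
have bI := @emb_inj _ _ b.
(* List the complement of the composite as the image under [b] of the complement of [a], followed by
   the complement of the image of [b]. *)
rewrite /nuf imE (@chain_perm _ _ _
  ([seq b x | x <- enum (~: a @: setT)] ++ enum (~: b @: setT))).
- rewrite chain_cat chain_imset mulrC; congr (chain _ _ * _).
  apply/setP => y; rewrite !inE; apply/orP/imsetP.
    by case=> [/mapP[x _ ->]|/imsetP[x _ ->]]; exists x.
  case=> x _ ->; have [xa|xa] := boolP (x \in a @: setT).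
    by right; rewrite imset_f.
  by left; rewrite map_f // mem_enum inE.
- exact: enum_uniq.
- by move=> y; rewrite mem_enum inE.
apply: uniq_perm; first exact: enum_uniq.
  rewrite cat_uniq map_inj_uniq ?enum_uniq //= andbT.
  apply/hasPn => y; rewrite mem_enum inE; apply: contra.
  by case/mapP => x _ ->; rewrite imset_f.
move=> y; rewrite mem_cat !mem_enum !inE.
have [/imsetP[x _ ->]|yb] := boolP (y \in b @: setT); last first.
  rewrite orbT; apply: contra yb => /imsetP[x _ ->].
  by rewrite imset_f.
by rewrite orbF mem_map // mem_enum inE mem_imset.
Qed.

End Positions.

Lemma emb_comp_inj (P Q R : poset) (e : embedding Q R) (a b : embedding P Q) :
  emb_comp e a = emb_comp e b -> a = b.
Proof.
move=> ab; apply: embP => x; apply: (@emb_inj _ _ e).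
by have := emb_eqP ab x; rewrite !emb_compE.
Qed.

(** Every embedding is a composite of one-point extensions and an isomorphism; the induction is on
    the number of points outside the image. *)
Lemma embedding_ind (T : forall P Q : poset, embedding P Q -> Prop) :
  (forall (P Q : poset) (a : embedding P Q), bijective a -> T P Q a) ->
  (forall (P Q : poset) (c : cut P) (h : embedding (ext c) Q),
     T (ext c) Q h -> T P Q (emb_comp h (ext_emb c))) ->
  forall (P Q : poset) (a : embedding P Q), T P Q a.
Proof.
move=> T0 T1 P Q a; have [n] := ubnP #|~: (a @: setT)|.
elim: n P a => // n IHn P a; rewrite ltnS => an.
have [a0|/set0Pn[x]] := eqVneq (~: (a @: setT)) set0.
  apply: T0; apply: emb_surj_bij => y.
  have : y \notin ~: (a @: setT) by rewrite a0 inE.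
  by rewrite inE negbK => /imsetP[w _ ->]; exists w.
rewrite inE -codom_imset => xa.
have [h [hN hS]] := @ext_emb_ex _ _ a (tp a x) x xa erefl.
have -> : a = emb_comp h (ext_emb (tp a x)).
  by apply: embP => p; rewrite emb_compE ext_embE hS.
apply: T1; apply: IHn; apply: leq_trans an; apply/proper_card/properP; split.
  apply/subsetP => y; rewrite !inE; apply: contra => /imsetP[p _ ->].
  by rewrite -hS imset_f.
exists x; first by rewrite inE -codom_imset.
by rewrite inE negbK -codom_imset; apply/codomP; exists None.
Qed.

(** * Amalgamations with a composite embedding *)

Section ComposeAmalgams.
Variables (P Q1 Q P' : poset) (a1 : embedding P Q1) (a2 : embedding Q1 Q).
Variable b : embedding P P'.

Section Build.
Variables (A : amalgamation a1 b) (B : amalgamation a2 (amalg_b A)).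

Lemma comp_amalg_comm :
  emb_comp (amalg_b B) (emb_comp a2 a1)
  = emb_comp (emb_comp (amalg_a B) (amalg_a A)) b.
Proof. by rewrite -emb_compA amalg_comm !emb_compA amalg_comm. Qed.

Lemma comp_amalg_cover (z : B) :
  (exists y, z = emb_comp (amalg_a B) (amalg_a A) y)
  \/ (exists y, z = amalg_b B y).
Proof.
case: (amalg_cover z) => [[y ->]|]; last by right.
case: (amalg_cover y) => -[x ->].
  by left; exists x; rewrite emb_compE.
by right; exists (a2 x); rewrite -!emb_compE amalg_comm.
Qed.

Definition comp_amalg : amalgamation (emb_comp a2 a1) b :=
  Amalgamation comp_amalg_comm comp_amalg_cover.

End Build.

Section Split.
Variable C : amalgamation (emb_comp a2 a1) b.

Let b1 : embedding Q1 C := emb_comp (amalg_b C) a2.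
Let S0 : {set C} := [set z | (z \in codom (amalg_a C)) || (z \in codom b1)].

(** The intermediate amalgamation is the subposet [S0] of [C], the union of the images of [P'] and
    [Q1]. *)
Lemma split_amalg : exists (A : amalgamation a1 b) (e : embedding A C),
  emb_comp e (amalg_a A) = amalg_a C /\ emb_comp e (amalg_b A) = b1.
Proof.
have [y|ha haE] := @factor_emb_ex _ _ _ (amalg_a C) (subp_emb S0).
  by move=> yC; rewrite codom_subp inE yC.
have [y|hb hbE] := @factor_emb_ex _ _ _ b1 (subp_emb S0).
  by move=> yC; rewrite codom_subp inE yC orbT.
have comm : emb_comp hb a1 = emb_comp ha b.
  apply: (@emb_comp_inj _ _ _ (subp_emb S0)).
  by rewrite -!emb_compA -hbE -haE /b1 emb_compA amalg_comm.
have cover (z : subp S0) : (exists y, z = ha y) \/ (exists y, z = hb y).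
  have := valP z; rewrite inE => /orP[]/codomP[y yE]; [left | right]; exists y;
  apply: val_inj; rewrite yE -subp_embE.
    by rewrite haE emb_compE.
  by rewrite hbE emb_compE.
by exists (Amalgamation comm cover), (subp_emb S0); rewrite /= haE hbE.
Qed.

Lemma factor_amalg (A : amalgamation a1 b) (e : embedding A C) :
  emb_comp e (amalg_a A) = amalg_a C -> emb_comp e (amalg_b A) = b1 ->
  exists B : amalgamation a2 (amalg_b A),
    forall B', amalg_iso B B' -> amalg_iso C (comp_amalg B').
Proof.
move=> ea eb.
have cover (z : C) : (exists y, z = e y) \/ (exists y, z = amalg_b C y).
  case: (amalg_cover z) => -[y ->]; last by right; exists y.
  by left; exists (amalg_a A y); rewrite -emb_compE ea.
exists (Amalgamation (esym eb) cover) => B' [t [tB ta tb]].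
exists t; split=> //=; rewrite -ea -emb_compA.
by rewrite /= in ta; rewrite ta.
Qed.

End Split.

Lemma comp_amalg_exists (I : Type) (S : I -> amalgamation a1 b)
    (J : I -> Type) (T : forall i, J i -> amalgamation a2 (amalg_b (S i))) C :
  complete_amalg S -> (forall i, complete_amalg (@T i)) ->
  exists ij : {i : I & J i}, amalg_iso C (comp_amalg (T (tag ij) (tagged ij))).
Proof.
move=> cS cT; have [A [e [ea eb]]] := split_amalg C.
have [i [/amalg_iso_sym[psi [_ pa pb]] _]] := cS A.
have ea' : emb_comp (emb_comp e psi) (amalg_a (S i)) = amalg_a C.
  by rewrite emb_compA pa.
have eb' : emb_comp (emb_comp e psi) (amalg_b (S i)) = emb_comp (amalg_b C) a2.
  by rewrite emb_compA pb.
have [B CB] := factor_amalg ea' eb'.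
have [j [Bj _]] := cT i B.
by exists (Tagged J j); exact: CB.
Qed.

(** An isomorphism respects the images of [P'] and [Q1], hence restricts to the intermediate
    amalgamations. The restriction [x] is returned because the next lemma has to recognise it as the
    identity. *)
Lemma comp_amalg_inj (A A' : amalgamation a1 b)
    (B : amalgamation a2 (amalg_b A)) (B' : amalgamation a2 (amalg_b A')) :
  amalg_iso (comp_amalg B) (comp_amalg B') ->
  exists (t : embedding B B') (x : embedding A A'),
  [/\ bijective t, emb_comp t (amalg_b B) = amalg_b B',
      emb_comp t (amalg_a B) = emb_comp (amalg_a B') x,
      amalg_iso A A' & emb_comp x (amalg_a A) = amalg_a A' /\
                       emb_comp x (amalg_b A) = amalg_b A'].
Proof.
case=> t [tB ta tb]; rewrite /= in t tB ta tb.
have tba : emb_comp (emb_comp t (amalg_a B)) (amalg_b A)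
         = emb_comp (amalg_a B') (amalg_b A').
  by rewrite emb_compA -amalg_comm -emb_compA tb amalg_comm.
have taa : emb_comp (emb_comp t (amalg_a B)) (amalg_a A)
         = emb_comp (amalg_a B') (amalg_a A') by rewrite emb_compA ta.
have [z|x xE] := @factor_emb_ex _ _ _ (emb_comp t (amalg_a B)) (amalg_a B').
  case/codomP => y ->; case: (amalg_cover y) => -[w ->].
    by rewrite -emb_compE taa emb_compE codom_f.
  by rewrite -emb_compE tba emb_compE codom_f.
have xa : emb_comp x (amalg_a A) = amalg_a A'.
  by apply: (@emb_comp_inj _ _ _ (amalg_a B')); rewrite -emb_compA -xE.
have xb : emb_comp x (amalg_b A) = amalg_b A'.
  by apply: (@emb_comp_inj _ _ _ (amalg_a B')); rewrite -emb_compA -xE.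
exists t, x; split=> //; exists x; split=> //; apply: emb_surj_bij => y.
case: (amalg_cover y) => -[w ->].
  by exists (amalg_a A w); rewrite -emb_compE xa.
by exists (amalg_b A w); rewrite -emb_compE xb.
Qed.

Lemma comp_amalg_complete (I : Type) (S : I -> amalgamation a1 b)
    (J : I -> Type) (T : forall i, J i -> amalgamation a2 (amalg_b (S i))) :
  complete_amalg S -> (forall i, complete_amalg (@T i)) ->
  complete_amalg (fun ij : {i : I & J i} => comp_amalg (T (tag ij) (tagged ij))).
Proof.
move=> cS cT; apply: complete_amalgP => [C|]; first exact: comp_amalg_exists.
case=> [i j] [i' j'] /= /comp_amalg_inj[t [x [tB tb tax /(complete_amalg_inj cS)]]].
move=> E; move: j' t x tB tb tax; rewrite -{i'}E => j' t x tB tb tax [xa xb].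
have xid : x = emb_id (S i).
  apply: embP => y; rewrite emb_idE; case: (amalg_cover y) => -[w ->].
    by rewrite -emb_compE xa.
  by rewrite -emb_compE xb.
congr existT; apply: (complete_amalg_inj (cT i)).
by exists t; split=> //; rewrite tax xid emb_comp_id.
Qed.

End ComposeAmalgams.

(** * Axiom (c) for all embeddings *)

Section AmalgSum.
Variables (k : comPzRingType) (nu : forall P Q : poset, embedding P Q -> k).
Hypothesis nu_iso : forall (P Q : poset) (a : embedding P Q), bijective a -> nu a = 1.
Hypothesis nu_comp : forall (P Q R : poset) (b : embedding Q R) (a : embedding P Q),
  nu (emb_comp b a) = nu b * nu a.

(** One complete family with the right sum is enough, since [amalg_sum_unique] carries the sum over
    to any other; this existential form is stable under composition. *)
Definition amalg_sum (P Q : poset) (a : embedding P Q) :=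
  forall (P' : poset) (b : embedding P P'),
  exists (I : finType) (S : I -> amalgamation a b),
    complete_amalg S /\ nu a = \sum_i nu (amalg_a (S i)).

Lemma nu_amalg_iso (P Q P' : poset) (a : embedding P Q) (b : embedding P P')
    (A B : amalgamation a b) : amalg_iso A B -> nu (amalg_a A) = nu (amalg_a B).
Proof. by case=> t [tB <- _]; rewrite nu_comp (nu_iso tB) mul1r. Qed.

Lemma amalg_sum_unique (P Q P' : poset) (a : embedding P Q) (b : embedding P P')
    (I J : finType) (S : I -> amalgamation a b) (T : J -> amalgamation a b) :
  complete_amalg S -> complete_amalg T ->
  \sum_i nu (amalg_a (S i)) = \sum_j nu (amalg_a (T j)).
Proof.
move=> cS cT.
have [s sE] : exists s : I -> J, forall i, amalg_iso (S i) (T (s i)).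
  apply: (@fin_all_exists _ (fun=> J) (fun i j => amalg_iso (S i) (T j))) => i.
  by have [j [ij _]] := cT (S i); exists j.
have [t tE] : exists t : J -> I, forall j, amalg_iso (T j) (S (t j)).
  apply: (@fin_all_exists _ (fun=> I) (fun j i => amalg_iso (T j) (S i))) => j.
  by have [i [ji _]] := cS (T j); exists i.
rewrite [RHS](reindex s) /=; last first.
  apply: onW_bij; exists t => i.
    apply: (complete_amalg_inj cS); apply: amalg_iso_sym.
    exact: amalg_iso_trans (sE i) (tE _).
  apply: (complete_amalg_inj cT); apply: amalg_iso_sym.
  exact: amalg_iso_trans (tE i) (sE _).
by apply: eq_bigr => i _; exact: nu_amalg_iso.
Qed.

(** Up to isomorphism the only amalgamation is [P'] itself. *)
Lemma amalg_sum_iso (P Q : poset) (a : embedding P Q) : bijective a -> amalg_sum a.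
Proof.
move=> aB P' b; have [a' [aK a'K]] := emb_inv_ex aB.
have comm : emb_comp (emb_comp b a') a = emb_comp (emb_id P') b.
  by apply: embP => x; rewrite !emb_compE aK emb_idE.
have cover (z : P') : (exists y, z = emb_id P' y) \/ (exists y, z = emb_comp b a' y).
  by left; exists z; rewrite emb_idE.
pose A := Amalgamation comm cover.
exists unit, (fun=> A); split; last first.
  by rewrite big_const card_unit /= addr0 !nu_iso //; exact: emb_id_bij.
apply: complete_amalgP => [B|[] []] //; exists tt; apply: amalg_iso_sym.
have bE : emb_comp (amalg_a B) (emb_comp b a') = amalg_b B.
  apply: embP => x; rewrite -(a'K x) !emb_compE aK -!emb_compE.
  by rewrite amalg_comm.
exists (amalg_a B : embedding A B); split=> //; last exact: emb_comp_id.
apply: emb_surj_bij => y; case: (amalg_cover y) => // -[w ->].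
by exists (b (a' w)); rewrite -bE !emb_compE.
Qed.

Lemma amalg_sum_comp (P Q1 Q : poset) (a1 : embedding P Q1) (a2 : embedding Q1 Q) :
  amalg_sum a1 -> amalg_sum a2 -> amalg_sum (emb_comp a2 a1).
Proof.
move=> s1 s2 P' b; have [I [S [cS Ssum]]] := s1 P' b.
(* A simultaneous choice of families for all [i], possible without axioms because [I] is finite. *)
have [u uP] : exists u :
    forall i, {J : finType & J -> amalgamation a2 (amalg_b (S i))},
    forall i, complete_amalg (projT2 (u i)) /\
      nu a2 = \sum_j nu (amalg_a (projT2 (u i) j)).
  apply: (@fin_all_exists _
    (fun i => {J : finType & J -> amalgamation a2 (amalg_b (S i))})
    (fun i v => complete_amalg (projT2 v) /\
      nu a2 = \sum_j nu (amalg_a (projT2 v j)))) => i.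
  by have [J [T TP]] := s2 _ (amalg_b (S i)); exists (existT _ J T).
exists {i : I & projT1 (u i)},
  (fun ij => comp_amalg (projT2 (u (tag ij)) (tagged ij))); split.
  exact: (@comp_amalg_complete _ _ _ _ a1 a2 b I S (fun i => projT1 (u i))
    (fun i => projT2 (u i)) cS (fun i => proj1 (uP i))).
rewrite nu_comp Ssum mulr_sumr.
transitivity (\sum_i \sum_j nu (amalg_a (comp_amalg (projT2 (u i) j)))).
  apply: eq_bigr => i _; rewrite (uP i).2 mulr_suml.
  by apply: eq_bigr => j _; rewrite nu_comp.
by rewrite sig_big_dep.
Qed.

Lemma amalg_sum_all :
  (forall (P : poset) (c : cut P), amalg_sum (ext_emb c)) ->
  forall (P Q : poset) (a : embedding P Q), amalg_sum a.
Proof.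
move=> s1; apply: embedding_ind => [P Q a|P Q c h sh].
  exact: amalg_sum_iso.
exact: amalg_sum_comp.
Qed.

End AmalgSum.
Section MeasureFrom.
Variables (k : comPzRingType) (f : forall P : poset, pr P -> k).
Hypothesis f_supp : cut_supported f.
Hypothesis f_restr : restrictive f.
Hypothesis f_exch : pts_exchange f.

Lemma nuf_ext (P : poset) (c : cut P) : nuf f (ext_emb c) = f (val c).
Proof.
rewrite /nuf (_ : ~: _ = [set None]); last first.
  apply/setP => -[p|]; rewrite in_setC -(codom_imset (ext_emb c)) in_set1.
    by apply/negbTE; rewrite negbK; apply/codomP; exists p; rewrite ext_embE.
  by apply/codomP => -[p]; rewrite ext_embE.
rewrite enum_set1 /= mulr1 rel_val_emb //.
rewrite /pos_val [val c]surjective_pairing; congr f; congr pair; apply/setP => p.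
  by rewrite inE ext_embE ext_ltSN.
by rewrite inE ext_embE ext_ltNS.
Qed.

Lemma nuf_amalg_ext (P : poset) (c : cut P) : amalg_sum (nuf f) (ext_emb c).
Proof.
move=> P' b; exists _, (one_point_family (c := c) (b := b)).
split; first exact: one_point_complete.
rewrite nuf_ext (f_restr b) big_sumType /=; congr (_ + _).
  rewrite -(sum_old_pt k); apply: eq_bigr => y _.
  by rewrite nuf_iso //; exact: emb_id_bij.
by rewrite -(sum_new_pt c b f_supp); apply: eq_bigr => d _; rewrite nuf_ext.
Qed.

Lemma nuf_amalg (P Q P' : poset) (a : embedding P Q) (b : embedding P P')
    (r : nat) (S : 'I_r -> amalgamation a b) :
  (forall A : amalgamation a b, exists! i : 'I_r, amalg_iso A (S i)) ->
  nuf f a = \sum_(i < r) nuf f (amalg_a (S i)).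
Proof.
move=> cS.
have nI := nuf_iso f; have nC := @nuf_comp k f f_restr f_supp f_exch.
have [I [T [cT ->]]] := amalg_sum_all nI nC nuf_amalg_ext a b.
exact: amalg_sum_unique nI nC _ _ _ _ _ _ _ _ _ cT cS.
Qed.

Definition measure_of : measure k :=
  Measure (nuf_iso f) (@nuf_comp k f f_restr f_supp f_exch) nuf_amalg.

End MeasureFrom.

(** * The classification of measures *)

Section MeasureCounts.
Variables (k : fieldType) (nu : measure k).

Definition J_val (p q : nat) : k := marked_measure nu (J_pt p q).

Lemma fm_fubini : fubini (fm nu) J_val.
Proof.
apply: pts_exchange_fubini; [exact: fm_supp | exact: fm_counted |].
exact: exchange_pts (@fm_supp k nu) (@fm_exchange k nu).
Qed.

Lemma J_val_min p q : J_val p q = J_val (minn p 2) (minn q 2).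
Proof.
exact: (fubini_truncated (@fm_supp k nu) (@fm_counted k nu) fm_fubini).
Qed.

Lemma J_val_mx p q : J_val p q = mxfun (measure_mx nu) p q.
Proof. by rewrite J_val_min /mxfun mxE !inordK // ltnS geq_minr. Qed.

Lemma J_val_quad : quad_eqs J_val.
Proof.
apply: (fubini_quad (@fm_supp k nu) (@fm_counted k nu) J_val_min).
  by move=> P c; exact: restrictive_opop (@fm_restrictive k nu).
exact: fm_fubini.
Qed.

End MeasureCounts.

Lemma counted_unique (k : comPzRingType) (f f' : forall P : poset, pr P -> k)
    (g g' : nat -> nat -> k) :
  cut_supported f -> cut_supported f' -> counted_by f g -> counted_by f' g' ->
  g =2 g' -> forall (P : poset) (c : pr P), f P c = f' P c.
Proof.
move=> fS fS' fC fC' gg P; apply: moebius_uniq => -[D U].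
have [/belowP DU|DUN] := boolP (belowb D U); last by rewrite !sum_cle0.
by rewrite (sum_cle fS fC DU) (sum_cle fS' fC' DU) /gaps gg.
Qed.

(** Bottom and top of [three_levels p 0 q 0] have [p] and [q] extremal elements, so every [g p q]
    occurs as a count. *)
Lemma counted_inj (k : comPzRingType) (f : forall P : poset, pr P -> k)
    (g g' : nat -> nat -> k) : counted_by f g -> counted_by f g' -> g =2 g'.
Proof.
move=> fC fC' p q; have h : below (bot p 0 q 0) (top p 0 q 0).
  by move=> x y xb; apply: below_top; rewrite in_setU xb.
have := fC _ _ _ h.
by rewrite (fC' _ _ _ h) maxs_bot mins_top card_bot card_top => ->.
Qed.

Theorem theorem1 (k : fieldType) :
  (forall nu nu' : measure k, measure_mx nu = measure_mx nu' ->
     forall (P Q : poset) (a : embedding P Q), nu P Q a = nu' P Q a) /\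
  (forall N : 'M[k]_3,
     (exists nu : measure k, measure_mx nu = N) <->
     (exists L : 'M[k]_3, listed_mx L /\ (N = L \/ N = L^T))).
Proof.
split=> [nu nu' E|N].
  have fE (P : poset) (c : pr P) : fm nu c = fm nu' c.
    apply: (counted_unique (@fm_supp k nu) (@fm_supp k nu')
      (@fm_counted k nu) (@fm_counted k nu')) => p q.
    by rewrite -!/(J_val _ _ _) !J_val_mx E.
  apply: embedding_ind => [P Q a aB|P Q c h IHh].
    by rewrite !measure_iso.
  by rewrite !measure_comp IHh -!fm_cut fE.
split=> [[nu <-]|NL].
  apply/quad_eqsP; apply: quad_eqs_eq (J_val_quad nu) => p q _ _.
  exact: J_val_mx.
have {NL} gQ : quad_eqs (mxfun N) by apply/quad_eqsP.
pose f := fg (mxfun N).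
have fS : cut_supported f := @fg_supp k (mxfun N).
have fC : counted_by f (mxfun N) := @fg_counted k (mxfun N).
have fR : restrictive f := @fg_restrictive k (mxfun N).
have fX : pts_exchange f.
  apply: (fubini_pts_exchange fS fC); apply: (quad_fubini fS fC _ _ gQ).
    exact: mxfun_min.
  by move=> P c; exact: restrictive_opop.
exists (measure_of fS fR fX); apply/matrixP => p q; rewrite mxE.
set nu := measure_of fS fR fX.
have fmE (P : poset) (c : pr P) : fm nu c = f P c.
  have [cP|cN] := boolP (is_cut c); last by rewrite fm_supp // fS.
  by rewrite -[c]/(val (Sub c cP : cut P)) fm_cut [LHS]nuf_ext.
(* The constructed [nu] has one-point values [f], so [f] is counted by [J_val nu] as well as by
   [mxfun N], and [counted_inj] identifies the two. *)
have fC' : counted_by f (J_val nu).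
  move=> P D U DU; rewrite /J_val -(fm_counted nu DU).
  by apply: eq_bigr => -[y|c] _ //=; rewrite fmE.
rewrite -/(J_val nu p q) (counted_inj fC' fC) /mxfun.
by congr (N _ _); apply: val_inj; rewrite /= inordK ?ltnS ?geq_minr //;
  apply/minn_idPl; rewrite -ltnS ltn_ord.
Qed.
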